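(* Let $p\ge 2$ and $n\geq 1$ be integers, and let $P(w)=A+B|w|^r$ for $w\in\mathbb R$, where $A$, $B$ and $r$ are non-negative constants. Suppose $g\in C_P^{p-1}(\mathbb{R})$. Let $X_{1},\ldots,X_{n}$ be independent real random variables with $\mathbb{E}X_{i}^k=\mathbb{E}Z^k$ for all $1\leq i\leq n$ and all positive integers $k\leq p$, where $Z\sim N(0,1)$. Suppose also that $\mathbb{E}|X_{i}|^{r+p+2}<\infty$ for all $1\leq i\leq n$. Let $W=\frac{1}{\sqrt n}\sum_{i=1}^nX_i$. Then, for $h\in C_b^{p-1}(\mathbb{R})$, \begin{align*}|\mathbb{E}h(g(W))-\mathbb{E}h(g(Z))| &\leq\frac{p+1}{p!\,n^{(p+1)/2}}h_{p-1}\sum_{i=1}^{n}\bigg[3A\mathbb{E}|X_{i}|^{p+1}+2^rB\bigg(2^{r+1}\mathbb{E}|X_i|^{p+1}\big(\mathbb{E}|W|^{r+1}+\mathbb{E}|W|^{r}\big)\\ &\quad+4\mathbb{E}|Z|^{r+1}\mathbb{E}|X_i|^{p+2}+\frac{2^{r+2}}{n^{r/2}}\mathbb{E}|X_i|^{r+p+2}\bigg)\bigg]. \end{align*}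
   Context: For a function $u$ on $\mathbb R$, $\|u\|$ is its supremum norm (essential supremum for a derivative that exists only almost everywhere). $h\in C_b^m(\mathbb{R})$ means that $h:\mathbb R\to\mathbb R$ is such that $h^{(m-1)}$ exists and is absolutely continuous (locally), and the derivatives $h',\ldots,h^{(m)}$ are bounded; $h$ itself need not be bounded. For $P:\mathbb R\to[0,\infty)$, $g\in C_P^m(\mathbb{R})$ means that $g:\mathbb R\to\mathbb R$ has derivatives up to order $m$ and $|g^{(k)}(w)|^{m/k}\le P(w)$ for all $w\in\mathbb R$ and $k=1,\ldots,m$. For $h\in C_b^m(\mathbb R)$, $h_m:=\sum_{k=1}^m{m\brace k}\|h^{(k)}\|$, where ${m\brace k}$ is the Stirling number of the second kind. *)

(* Defs.v *)
Set Warnings "-notation-overridden,-notation-incompatible-prefix,-ambiguous-paths".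
From mathcomp Require Export all_boot all_order all_algebra.
From mathcomp Require Export all_classical all_reals all_analysis ess_sup_inf.

Set Implicit Arguments.
Unset Strict Implicit.
Unset Printing Implicit Defensive.

Import Order.TTheory GRing.Theory Num.Theory.
Import numFieldNormedType.Exports.

Local Open Scope classical_set_scope.
Local Open Scope ring_scope.

(* Stirling numbers of the second kind, by the triangular recurrence
   S(m+1, k+1) = (k+1) S(m, k+1) + S(m, k). *)
Fixpoint stirling2 (m k : nat) : nat :=
  match m, k with
  | 0, 0 => 1
  | 0, _.+1 | _.+1, 0 => 0
  | m'.+1, k'.+1 => k * stirling2 m' k + stirling2 m' k'
  end%N.

Definition absolutely_continuous_on (R : realType) (a b : R) (f : R -> R) :=
  forall e : R, 0 < e -> exists2 d : R, 0 < d &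
    forall (N : nat) (u v : 'I_N -> R),
      (forall i, a <= u i /\ u i <= v i /\ v i <= b) ->
      trivIset [set: 'I_N] (fun i => `]u i, v i[%classic) ->
      \sum_(i < N) (v i - u i) < d ->
      \sum_(i < N) `|f (v i) - f (u i)| < e.

Definition locally_absolutely_continuous (R : realType) (f : R -> R) :=
  forall a b : R, a <= b -> absolutely_continuous_on a b f.

(* For k >= 1: since f^`(k) is the library's total derivative, "f has k
   derivatives everywhere" is derivability of f, ..., f^`(k-1). *)
Definition has_derivatives (R : realType) (k : nat) (f : R -> R) :=
  forall j, (j < k)%N -> forall x : R, derivable f^`(j)%classic x 1.

(* The norm of f^`(k), k >= 1, as an extended real: the supremum norm if the
   derivative exists everywhere, the essential supremum otherwise (in which
   case the default values of f^`(k) lie on a null set and are ignored). *)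
Definition derivative_norm (R : realType) (k : nat) (f : R -> R) : \bar R :=
  if `[< has_derivatives k f >]
  then ereal_sup [set `|f^`(k)%classic x|%:E | x in [set: R]]
  else ess_sup (@lebesgue_measure R) (fun x => `|f^`(k)%classic x|%:E).

Definition class_Cb (R : realType) (m : nat) (h : R -> R) :=
  [/\ has_derivatives m.-1 h,
      locally_absolutely_continuous h^`(m.-1)%classic &
      forall k, (1 <= k <= m)%N -> (derivative_norm k h < +oo)%E].

Definition class_CP (R : realType) (m : nat) (P : R -> R) (g : R -> R) :=
  has_derivatives m g /\
  forall (w : R) (k : nat), (1 <= k <= m)%N ->
    `|g^`(k)%classic w| `^ (m%:R / k%:R) <= P w.

Definition stirling_norm (R : realType) (m : nat) (h : R -> R) : \bar R :=
  (\sum_(1 <= k < m.+1) (stirling2 m k)%:R%:E * derivative_norm k h)%E.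

Definition mutually_independent (d : measure_display) (T : measurableType d)
    (R : realType) (Pr : probability T R) (I : finType)
    (X : I -> {RV Pr >-> R}) :=
  forall (J : {set I}) (A : I -> set R), (forall i, measurable (A i)) ->
    Pr (\bigcap_(i in [set j | j \in J]) (X i @^-1` A i)) =
    (\prod_(i in J) Pr (X i @^-1` A i))%E.

Definition standard_normal (d : measure_display) (T : measurableType d)
    (R : realType) (Q : probability T R) (Z : {RV Q >-> R}) :=
  forall A : set R, measurable A -> distribution Q Z A = normal_prob 0 1 A.

Definition normalized_sum (d : measure_display) (T : measurableType d)
    (R : realType) (Pr : probability T R) (n : nat)
    (X : 'I_n -> {RV Pr >-> R}) : T -> R :=
  fun t => (Num.sqrt n%:R)^-1 * \sum_(i < n) X i t.

(* Main.v *)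
Require Import Defs.
From HB Require Import structures.
From mathcomp Require Import measurable_realfun lebesgue_stieltjes_measure ring lra.

Set Implicit Arguments.
Unset Strict Implicit.
Unset Printing Implicit Defensive.

Import Order.TTheory GRing.Theory Num.Theory.
Import numFieldNormedType.Exports.

Local Open Scope classical_set_scope.
Local Open Scope ring_scope.

(** Put m = p - 1 and u = h o g.  Replacing h by its Steklov means, which inherit
    the bounds on h', ..., h^(m), makes h as smooth as needed, so Faa di Bruno's
    formula gives |u^(m)| <= h_m P.  The solution phi of Stein's equation
    phi' - w phi = u - E u(Z) satisfies, with F = phi^(m-1), the equation
    F'' - w F' - m F = u^(m); a maximum principle comparing F with explicit
    supersolutions bounds |phi^(p)| by h_m (2 A + B (c |w|^r + 2^(r+2) E|Z|^(r+1))).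
    In E (phi'(W) - W phi(W)) every summand X_i is split off W and phi, phi' are
    expanded around W - X_i / sqrt n to order p; the terms of the expansion cancel
    in expectation because the moments of X_i up to order p are those of Z and
    E Z^(k+1) = k E Z^(k-1), and only the remainders survive. *)

(** * Derivatives on the real line *)

(** A maximum principle for the equation of F bounds F alone, whereas F'' is wanted. Since F'' is
    the sum of w F' + m F and u^(m), the principle is carried over to w F' + m F; these two summands
    account for 2 A. The weight |w|^r lacks a second derivative at 0 for 0 < r < 2; there it is
    majorized by some a + b x^2 whose coefficients depend on the point w of evaluation, and larger r
    descend to this case in steps of 2, E|w + Z|^r satisfying the required recursion. Smoothing is
    forced by the composition: h^(m) may exist only almost everywhere, and g may send a set of
    positive measure into the exceptional set. Derivatives of a Steklov mean are difference
    quotients, so Lipschitz bounds for h, ..., h^(m-1) suffice; at the last order such a bound rests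
    on the fundamental theorem of calculus for absolutely continuous functions, obtained from total
    variation and the Radon-Nikodym theorem. *)

Section RealDerivatives.
Variable R : realType.
Implicit Types (f g : R -> R) (x a b c : R).

Lemma der_cst c x : is_derive x 1 (fun=> c : R) 0.
Proof. exact: is_derive_cst. Qed.

Lemma der_id x : is_derive x 1 (fun y => y : R) 1.
Proof. exact: is_derive_id. Qed.

Lemma derD f g x a b : is_derive x 1 f a -> is_derive x 1 g b ->
  is_derive x 1 (fun y => f y + g y) (a + b).
Proof. exact: is_deriveD. Qed.

Lemma derN f x a : is_derive x 1 f a -> is_derive x 1 (fun y => - f y) (- a).
Proof. exact: is_deriveN. Qed.

Lemma derB f g x a b : is_derive x 1 f a -> is_derive x 1 g b ->
  is_derive x 1 (fun y => f y - g y) (a - b).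
Proof. exact: is_deriveB. Qed.

Lemma derM f g x a b : is_derive x 1 f a -> is_derive x 1 g b ->
  is_derive x 1 (fun y => f y * g y) (a * g x + f x * b).
Proof.
move=> df dg; apply: is_derive_eq (is_deriveM df dg) _.
by rewrite /GRing.scale /= addrC mulrC.
Qed.

Lemma derZ c f x a : is_derive x 1 f a -> is_derive x 1 (fun y => c * f y) (c * a).
Proof.
by move=> df; apply: is_derive_eq (derM (der_cst c x) df) _; rewrite mul0r add0r.
Qed.

Lemma derX f n x a : is_derive x 1 f a ->
  is_derive x 1 (fun y => f y ^+ n) (n%:R * f x ^+ n.-1 * a).
Proof.
move=> df; have := @is_deriveX _ _ f n x 1 a df.
by rewrite /GRing.scale /=; congr (is_derive _ _ _ _); apply/funext => y; rewrite fctE.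
Qed.

Lemma der_comp f g x a b : is_derive (g x) 1 f a -> is_derive x 1 g b ->
  is_derive x 1 (fun y => f (g y)) (a * b).
Proof. exact: is_derive1_comp. Qed.

Lemma der_exp f x a : is_derive x 1 f a ->
  is_derive x 1 (fun y => expR (f y)) (expR (f x) * a).
Proof. by move=> df; apply: der_comp df. Qed.

Lemma der_eq f x a b : is_derive x 1 f a -> a = b -> is_derive x 1 f b.
Proof. exact: is_derive_eq. Qed.

Lemma der_continuous f df : (forall x, is_derive x 1 f (df x)) -> continuous f.
Proof.
move=> H x; apply: differentiable_continuous; apply/derivable1_diffP.
by have [] := H x.
Qed.

Lemma der_within f df a b :
  (forall x, a <= x <= b -> is_derive x 1 f (df x)) ->
  {within `[a, b], continuous f}.
Proof.
move=> H; apply: derivable_within_continuous => x; rewrite in_itv /= => xab.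
by have [] := H x xab.
Qed.

Lemma der_MVT f df a b : a <= b ->
  (forall x, a <= x <= b -> is_derive x 1 f (df x)) ->
  exists2 c, a <= c <= b & f b - f a = df c * (b - a).
Proof.
move=> ab H.
have [|c cab e] := @MVT_segment _ f df a b ab _ (der_within H).
  by move=> x; rewrite in_itv /= => /andP[ax xb]; apply: H; rewrite !ltW.
by exists c => //; move: cab; rewrite in_itv.
Qed.

Lemma der_ge0_le f df a b : a <= b ->
  (forall x, a <= x <= b -> is_derive x 1 f (df x)) ->
  (forall x, a <= x <= b -> 0 <= df x) -> f a <= f b.
Proof.
move=> ab H H0; have [c cab e] := der_MVT ab H.
by rewrite -subr_ge0 e mulr_ge0 ?H0 ?subr_ge0.
Qed.

Lemma der_lip f df a b M : a <= b ->
  (forall x, a <= x <= b -> is_derive x 1 f (df x)) ->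
  (forall x, a <= x <= b -> `|df x| <= M) -> `|f b - f a| <= M * (b - a).
Proof.
move=> ab H H0; have [c cab ->] := der_MVT ab H.
by rewrite normrM (ger0_norm (x := b - a)) ?subr_ge0 // ler_wpM2r ?subr_ge0 // H0.
Qed.

Lemma der_reflect f df x : is_derive (- x) 1 f df ->
  is_derive x 1 (fun y => f (- y)) (- df).
Proof.
move=> H; apply: der_eq (der_comp (g := fun y => - y) H (derN (der_id x))) _.
by rewrite mulrN1.
Qed.

(** If [k2] were positive, [K1], which vanishes at [c], would be positive just to the right of [c],
    and [K] would exceed its maximum there. *)
Lemma second_derivative_max (K K1 : R -> R) (k2 c : R) :
  (forall x, is_derive x 1 K (K1 x)) -> is_derive c 1 K1 k2 ->
  (forall x, K x <= K c) -> k2 <= 0.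
Proof.
move=> dK dK1 Kmax.
have K1c : K1 c = 0.
  have [||||_ <-] := @derive1_at_max _ K (c - 1) (c + 1) c.
  - lra.
  - by move=> t _; have [] := dK t.
  - by rewrite in_itv /=; apply/andP; split; lra.
  - by [].
  by have [_ ->] := dK c.
rewrite leNgt; apply/negP => k20.
have [d0 d1] := dK1.
move: d0; rewrite /derivable => /cvg_ex [l /= Hl].
have el : l = k2 by rewrite -d1 /derive; apply/esym/cvg_lim.
rewrite el in Hl.
have : \forall h \near 0^', 0 < h^-1 *: (K1 (h *: 1 + c) - K1 c).
  by apply: (cvgr_gt k2) => //.
rewrite near_withinE => -[e /= e0 He].
have K1pos y : c < y < c + e -> 0 < K1 y.
  move=> /andP[cy ye].
  have := He (y - c); rewrite /ball_ /= sub0r normrN.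
  have -> : (y - c)%:A + c = y by rewrite /GRing.scale /= mulr1 subrK.
  rewrite K1c subr0 ger0_norm ?subr_ge0; last exact: ltW.
  have H1 : y - c < e by lra.
  have H2 : y - c != 0 by rewrite gt_eqF //; lra.
  move=> /(_ H1 H2); rewrite /GRing.scale /= pmulr_rgt0 //.
  by rewrite invr_gt0; lra.
have H1 : K c <= K (c + e / 4).
  apply: (der_ge0_le _ (fun x _ => dK x)); first by lra.
  move=> x /andP[]; rewrite le_eqVlt => /predU1P[<-|cx] xe; first by rewrite K1c.
  by apply/ltW/K1pos; apply/andP; split; lra.
(* The second interval stays away from [c], where [K1] vanishes, so that the mean value is strictly
   positive. *)
have ee : c + e / 4 <= c + e / 2 by lra.
have [y /andP[y1 y2] E] := der_MVT ee (fun x _ => dK x).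
have : 0 < K1 y * (c + e / 2 - (c + e / 4)).
  by rewrite mulr_gt0 ?K1pos //; [apply/andP; split; lra|lra].
by rewrite -E; have := Kmax (c + e / 2); lra.
Qed.

End RealDerivatives.

(** * Subgaussian growth and comparison principles *)

Section Subgaussian.
Variable R : realType.
Implicit Types (f g : R -> R).

(** A growth class that is stable under products and primitives, is integrable against the normal
    density, and excludes the homogeneous solution exp (x^2 / 2) of Stein's equation. *)
Definition subgaussian f :=
  forall e : R, 0 < e -> exists C, forall x, `|f x| <= C * expR (e * x ^+ 2).

Lemma subgaussian_le f g : (forall x, `|f x| <= `|g x|) ->
  subgaussian g -> subgaussian f.
Proof.
by move=> fg sg e e0; have [C HC] := sg e e0; exists C => x; apply: le_trans (HC x).
Qed.

Lemma subgaussianD f g : subgaussian f -> subgaussian g ->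
  subgaussian (fun x => f x + g x).
Proof.
move=> sf sg e e0; have [C HC] := sf e e0; have [D HD] := sg e e0.
by exists (C + D) => x; rewrite mulrDl (le_trans (ler_normD _ _)) // lerD.
Qed.

Lemma subgaussianM f g : subgaussian f -> subgaussian g ->
  subgaussian (fun x => f x * g x).
Proof.
move=> sf sg e e0; have e20 : 0 < e / 2 by rewrite divr_gt0.
have [C HC] := sf _ e20; have [D HD] := sg _ e20.
exists (C * D) => x.
have -> : e * x ^+ 2 = (e / 2 * x ^+ 2) + (e / 2 * x ^+ 2) by field.
by rewrite expRD mulrACA normrM ler_pM.
Qed.

Lemma subgaussian_cst (c : R) : subgaussian (fun=> c).
Proof.
move=> e e0; exists `|c| => x; rewrite ler_peMr // -expR0 ler_expR.
by rewrite mulr_ge0 ?sqr_ge0 // ltW.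
Qed.

Lemma subgaussianN f : subgaussian f -> subgaussian (fun x => - f x).
Proof. by apply: subgaussian_le => x; rewrite normrN. Qed.

Lemma subgaussianZ (c : R) f : subgaussian f -> subgaussian (fun x => c * f x).
Proof. by move=> sf; apply: subgaussianM (subgaussian_cst c) sf. Qed.

Lemma subgaussian_reflect f : subgaussian f -> subgaussian (fun x => f (- x)).
Proof.
move=> sf e e0; have [C HC] := sf e e0; exists C => x.
by have := HC (- x); rewrite sqrrN.
Qed.

Lemma powR_le_expR (s e : R) : 0 <= s -> 0 < e ->
  exists C, forall y : R, 0 <= y -> y `^ s <= C * expR (e * y).
Proof.
move=> s0 e0; have s10 : 0 < s + 1 by lra.
(* The inequality ln (a y) <= a y - 1 gives s ln y <= s a y + s (- 1 - ln a), and s a <= e. The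
   summand 1 of the constant covers y = 0, where [powR] equals 1 if s = 0. *)
set a := e / (s + 1); have a0 : 0 < a by rewrite divr_gt0.
exists (1 + expR (s * (- 1 - ln a))) => y y0.
rewrite mulrDl mul1r -expRD.
have [->|yn0] := eqVneq y 0.
  rewrite mulr0 expR0 addr0 (@le_trans _ _ 1) // ?lerDl ?expR_ge0 //.
  by have [->|s1] := eqVneq s 0; rewrite ?powRr0 // powR0.
have y1 : 0 < y by rewrite lt_neqAle eq_sym yn0.
rewrite /powR (negbTE yn0) ler_wpDl ?expR_ge0 // ler_expR.
have : ln (1 + (y * a - 1)) <= y * a - 1.
  by apply: le_ln1Dx; rewrite ltrBDl subrr mulr_gt0.
rewrite addrC subrK lnM ?posrE // => H.
have H2 : s * (ln y + ln a) <= s * (y * a - 1) by rewrite ler_wpM2l.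
have H3 : s * (y * a) <= e * y.
  have -> : s * (y * a) = s * a * y by ring.
  by apply: ler_wpM2r => //; rewrite /a mulrCA ler_piMr ?(ltW e0) // ler_pdivrMr //; lra.
by rewrite mulrDr in H2; rewrite mulrBr mulrN1; lra.
Qed.

Lemma subgaussian_powR (s : R) : 0 <= s -> subgaussian (fun x => `|x| `^ s).
Proof.
move=> s0 e e0.
have [|C HC] := @powR_le_expR (s / 2) e _ e0; first by rewrite divr_ge0.
exists C => x; rewrite ger0_norm ?powR_ge0 //.
have -> : `|x| `^ s = (x ^+ 2) `^ (s / 2).
  rewrite -(@ger0_norm _ (x ^+ 2)) ?sqr_ge0 // normrX -powR_mulrn // -powRrM.
  by congr powR; field.
by rewrite HC ?sqr_ge0.
Qed.

Lemma subgaussian_id : subgaussian (fun x => x).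
Proof.
by apply: subgaussian_le (subgaussian_powR ler01) => x; rewrite powRr1 // normr_id.
Qed.

Lemma subgaussian_expn n : subgaussian (fun x => x ^+ n).
Proof.
elim: n => [|n IH]; first exact: subgaussian_cst.
by apply: subgaussian_le (subgaussianM subgaussian_id IH) => x; rewrite exprS.
Qed.

Lemma subgaussian_primitive (f df : R -> R) : (forall x : R, is_derive x 1 f (df x)) ->
  subgaussian df -> subgaussian f.
Proof.
move=> dfE sdf.
have main : forall e, 0 < e -> exists C, forall x,
    `|f x| <= `|f 0| + `|x| * (C * expR (e * x ^+ 2)).
  move=> e e0; have [C HC] := sdf e e0; exists C => x.
  have C0 : 0 <= C by have := HC 0; rewrite expr0n mulr0 expR0 mulr1; apply: le_trans.
  have bnd y : `|y| <= `|x| -> `|df y| <= C * expR (e * x ^+ 2).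
    move=> yx; apply: le_trans (HC y) _; rewrite ler_wpM2l // ler_expR ler_wpM2l ?(ltW e0) //.
    by rewrite -(real_normK (num_real x)) -(real_normK (num_real y)) lerXn2r ?nnegrE.
  have : `|f x - f 0| <= `|x| * (C * expR (e * x ^+ 2)).
    have [x0|x0] := leP 0 x.
      rewrite (ger0_norm x0) mulrC; rewrite -[X in _ * X]subr0.
      apply: (der_lip x0 (fun y _ => dfE y)) => y /andP[y0 yx]; apply: bnd.
      by rewrite !ger0_norm.
    rewrite (ltr0_norm x0) mulrC distrC; rewrite -[X in _ * X]sub0r.
    apply: (der_lip (ltW x0) (fun y _ => dfE y)) => y /andP[yx y0]; apply: bnd.
    by rewrite (ler0_norm y0) (ltr0_norm x0) lerN2.
  move=> H; rewrite -{1}(subrK (f 0) (f x)) addrC (le_trans (ler_normD _ _)) //.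
  by rewrite lerD2l.
move=> e e0; have e20 : 0 < e / 2 by rewrite divr_gt0.
have [C HC] := main _ e20.
have [D HD] := subgaussian_id e20; have [B HB] := subgaussian_cst (f 0) e0.
exists (B + `|D| * `|C|) => x; apply: le_trans (HC x) _.
rewrite mulrDl lerD //.
have -> : e * x ^+ 2 = (e / 2 * x ^+ 2) + (e / 2 * x ^+ 2) by field.
rewrite expRD; move: (HD x); set E := expR _ => HDx.
have E0 : 0 <= E by exact: expR_ge0.
apply: le_trans (_ : `|x| * (`|C| * E) <= _).
  by rewrite ler_wpM2l // ler_wpM2r // ler_norm.
rewrite mulrACA ler_wpM2r ?mulr_ge0 ?normr_ge0 //.
by apply: le_trans HDx _; apply: ler_wpM2r => //; exact: ler_norm.
Qed.

(** Half of the exponent bounds [f], the other half exceeds any constant far out; hence [c] may be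
    arbitrarily small. *)
Lemma subgaussian_expR_small f (c e : R) : subgaussian f -> 0 < c -> 0 < e ->
  exists2 M : R, 1 <= M & forall x, M <= `|x| -> `|f x| < c * expR (e * x ^+ 2).
Proof.
move=> sf c0 e0; have e20 : 0 < e / 2 by rewrite divr_gt0.
have [C HC] := sf _ e20.
pose y := `|C| / c / (e / 2).
have y0 : 0 <= y by rewrite !divr_ge0 // ltW.
exists (1 + y); first by rewrite lerDl.
move=> x Mx; apply: le_lt_trans (HC x) _.
have -> : e * x ^+ 2 = (e / 2 * x ^+ 2) + (e / 2 * x ^+ 2) by field.
rewrite expRD mulrA ltr_pM2r ?expR_gt0 // mulrC -ltr_pdivrMr //.
have H : 1 + y <= x ^+ 2.
  rewrite -(real_normK (num_real x)) (le_trans Mx) // expr2 ler_peMr //.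
  by apply: le_trans Mx; rewrite lerDl.
have H2 : 1 + (e / 2) * (1 + y) <= expR (e / 2 * x ^+ 2).
  by apply: le_trans (expR_ge1Dx _); rewrite lerD2l ler_pM2l.
apply: lt_le_trans H2; rewrite mulrDr mulr1 /y.
have -> : e / 2 * (`|C| / c / (e / 2)) = `|C| / c by field; rewrite !gt_eqF.
have : C / c <= `|C| / c by rewrite ler_pM2r ?invr_gt0 // ler_norm.
lra.
Qed.

End Subgaussian.

(** * Maximum principles for F'' - x F' - m F on the whole line *)

Section Comparison.
Variables (R : realType) (m : R).
Hypothesis m1 : 1 <= m.

(** The operator sends exp (x^2 / 4) to - exp (x^2 / 4) (x^2 / 4 + m - 1/2), so d exp (x^2 / 4) is a
    strict supersolution, and it outgrows [F]. If [F] were positive somewhere, F - d exp (x^2 / 4)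
    with small d would have a positive maximum, and there the inequality for [F] would fail. *)
Lemma max_principle (F F1 F2 : R -> R) :
  (forall x : R, is_derive x 1 F (F1 x)) -> (forall x : R, is_derive x 1 F1 (F2 x)) ->
  subgaussian F -> (forall x, 0 <= F2 x - x * F1 x - m * F x) ->
  forall x, F x <= 0.
Proof.
move=> dF dF1 sF LF w; rewrite leNgt; apply/negP => Fw.
pose E (x : R) : R := expR (4^-1 * x ^+ 2).
have E0 x : 0 < E x by exact: expR_gt0.
(* Chosen so that half of [F w] survives: [K w] = F w / 2. *)
pose d := F w / (2 * E w).
have d0 : 0 < d by rewrite divr_gt0 // mulr_gt0.
have [M M1 HM] := @subgaussian_expR_small _ F d 4^-1 sF d0 ltac:(lra).
pose K x := F x - d * E x.
pose K1 x := F1 x - d * (E x * (4^-1 * (2%:R * x))).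
have dE (x : R) : is_derive x 1 E (E x * (4^-1 * (2%:R * x))).
  apply: der_eq (der_exp (derZ _ (derX 2 (der_id x)))) _.
  by rewrite /E expr1 mulr1.
have dK (x : R) : is_derive x 1 K (K1 x) by apply: derB (dF x) (derZ d (dE x)).
have Kw : 0 < K w.
  have -> : K w = F w / 2 by rewrite /K /d; field; rewrite gt_eqF.
  by rewrite divr_gt0.
have Kfar x : M <= `|x| -> K x <= 0.
  by move=> Mx; rewrite subr_le0 ltW // (le_lt_trans (ler_norm _)) // HM.
pose M' := M + `|w|.
have M'0 : - M' <= M' by have := normr_ge0 w; rewrite /M'; lra.
have [c cM Kc] := EVT_max M'0 (der_within (fun x _ => dK x)).
have Kwc : K w <= K c.
  apply: Kc; rewrite in_itv /= -ler_norml /M'; lra.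
have Kmax x : K x <= K c.
  have [xM|/ltW xM] := leP `|x| M'; first by apply: Kc; rewrite in_itv /= -ler_norml.
  by apply: le_trans (le_trans (ltW Kw) Kwc); apply: Kfar; apply: le_trans xM; rewrite lerDl.
have k1 : K1 c = 0.
  have [||||_ <-] := @derive1_at_max _ K (c - 1) (c + 1) c.
  - lra.
  - by move=> t _; have [] := dK t.
  - by rewrite in_itv /=; apply/andP; split; lra.
  - by [].
  by have [_ ->] := dK c.
pose k2 := F2 c - d * (E c * (2^-1 + c ^+ 2 / 4)).
have dK1 : is_derive c 1 K1 k2.
  apply: der_eq (derB (dF1 c) (derZ d (derM (dE c) (derZ _ (derZ _ (der_id c)))))) _.
  by rewrite /k2; congr (_ - _ * _); field.
have k20 := second_derivative_max dK dK1 Kmax.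
have := LF c; rewrite leNgt => /negP; apply.
have Kc0 : 0 < K c by apply: lt_le_trans Kwc.
have F1c : F1 c = d * (E c * (4^-1 * (2%:R * c))).
  by apply/eqP; rewrite -subr_eq0; apply/eqP.
have Fc : F c = K c + d * E c by rewrite /K; ring.
have F2c : F2 c = k2 + d * (E c * (2^-1 + c ^+ 2 / 4)) by rewrite /k2; ring.
rewrite F1c Fc F2c.
have -> : k2 + d * (E c * (2^-1 + c ^+ 2 / 4)) - c * (d * (E c * (4^-1 * (2 * c)))) -
  m * (K c + d * E c) = k2 - m * K c - d * E c * (c ^+ 2 / 4 + (m - 2^-1)) by field.
have m1' : 1 <= m := m1.
have m0 : 0 < m by lra.
have p1 : 0 < m * K c by apply: mulr_gt0.
have p2 : 0 <= d * E c * (c ^+ 2 / 4 + (m - 2^-1)).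
  apply: mulr_ge0; first by apply: mulr_ge0; apply: ltW.
  by have := sqr_ge0 c; lra.
lra.
Qed.

(* If [D = x F' + m F] were positive at some [w > 0], then [D' >= (x + (m+1)/x) D]
   beyond [w] would make [D] grow like [exp (x^2/2)]. *)
Lemma first_order_comparison_pos (F F1 F2 : R -> R) :
  (forall x : R, is_derive x 1 F (F1 x)) -> (forall x : R, is_derive x 1 F1 (F2 x)) ->
  subgaussian F -> subgaussian F1 ->
  (forall x, 0 <= F2 x - x * F1 x - m * F x) ->
  forall x, 0 < x -> x * F1 x + m * F x <= 0.
Proof.
move=> dF dF1 sF sF1 LF w w0; rewrite leNgt; apply/negP => Dw.
have m1' : 1 <= m := m1.
have Fle := max_principle dF dF1 sF LF.
pose D x := x * F1 x + m * F x.
pose D1 x := F1 x + x * F2 x + m * F1 x.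
have dD (x : R) : is_derive x 1 D (D1 x).
  apply: der_eq (derD (derM (der_id x) (dF1 x)) (derZ m (dF x))) _.
  by rewrite /D1 mul1r.
(* [G] is the integrating factor: its logarithmic derivative [q] is minus the rate (m + 1) / x +
   x. *)
pose G (x : R) : R := x `^ (- (m + 1)) * expR (- (2^-1 * x ^+ 2)).
pose q (x : R) : R := - ((m + 1) / x + x).
have dG (x : R) : 0 < x -> is_derive x 1 G (G x * q x).
  move=> x0; have dp := is_derive1_powR (- (m + 1)) x0.
  apply: der_eq (derM dp (der_exp (derN (derZ 2^-1 (derX 2 (der_id x)))))) _.
  rewrite /G /q expr1 powRB ?(gt_eqF x0) ?implybT // powRr1 ?ltW //.
  by field; rewrite gt_eqF.
have main x : w <= x -> D w * G w <= D x * G x.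
  move=> wx.
  apply: (@der_ge0_le _ (fun y => D y * G y) (fun y => G y * (D1 y + D y * q y))) => //.
    move=> y /andP[wy _]; have y0 : 0 < y by apply: lt_le_trans wy.
    by apply: der_eq (derM (dD y) (dG y y0)) _; ring.
  move=> y /andP[wy _]; have y0 : 0 < y by apply: lt_le_trans wy.
  rewrite mulr_ge0 // ?mulr_ge0 ?powR_ge0 ?expR_ge0 //.
  (* The first term is y times the assumed inequality; the second is nonnegative because [F] <= 0 by
     the maximum principle. *)
  have -> : D1 y + D y * q y = y * (F2 y - y * F1 y - m * F y) -
     (m * (m + 1)) * F y / y.
    by rewrite /D1 /D /q; field; rewrite gt_eqF.
  rewrite addr_ge0 ?mulr_ge0 ?(ltW y0) ?LF //.
  rewrite -mulNr mulr_ge0 ?invr_ge0 ?(ltW y0) // -mulrN mulr_ge0 ?oppr_ge0 //.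
  by rewrite mulr_ge0; lra.
have sD : subgaussian D.
  apply: subgaussianD; first exact: subgaussianM (@subgaussian_id R) sF1.
  exact: subgaussianZ.
have c0 : 0 < D w * G w by rewrite mulr_gt0 // mulr_gt0 ?expR_gt0 // powR_gt0.
have [M M1 HM] := @subgaussian_expR_small _ D (D w * G w) 2^-1 sD c0 ltac:(lra).
pose x := M + w.
have x0 : 0 < x by rewrite /x; lra.
have x1 : 1 <= x by rewrite /x; lra.
have := HM x; rewrite (ger0_norm (ltW x0)) => /(_ ltac:(rewrite /x; lra)).
have wx : w <= x by rewrite /x; lra.
move=> H; have := main x wx.
rewrite leNgt => /negP; apply.
have Dx : D x < D w * G w * expR (2^-1 * x ^+ 2) by apply: le_lt_trans H; apply: ler_norm.
have xp : x `^ (- (m + 1)) <= 1.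
  by rewrite powRN invf_le1 ?powR_gt0 // -{1}(powRr0 x) ler_powR //; lra.
rewrite /G expRN mulrA ltr_pdivrMr ?expR_gt0 //.
have [D0|D0] := leP 0 (D x).
  by apply: le_lt_trans Dx; rewrite -{2}(mulr1 (D x)) ler_wpM2l.
apply: lt_le_trans (_ : 0 <= _); last by rewrite mulr_ge0 ?expR_ge0 ?ltW.
by rewrite nmulr_rlt0 // powR_gt0.
Qed.

(** The equation and the expression x F' + m F are both invariant under x -> - x, so negative points
    reduce to positive ones; at 0 only m F remains. *)
Lemma first_order_comparison (F F1 F2 : R -> R) :
  (forall x : R, is_derive x 1 F (F1 x)) -> (forall x : R, is_derive x 1 F1 (F2 x)) ->
  subgaussian F -> subgaussian F1 ->
  (forall x, 0 <= F2 x - x * F1 x - m * F x) ->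
  forall x, x * F1 x + m * F x <= 0.
Proof.
move=> dF dF1 sF sF1 LF w.
have m1' : 1 <= m := m1.
have [w0|w0|->] := ltgtP w 0; first last.
- rewrite mul0r add0r pmulr_rle0; last lra.
  exact: (max_principle dF dF1 sF LF).
- exact: (first_order_comparison_pos dF dF1).
have := @first_order_comparison_pos (fun x => F (- x)) (fun x => - F1 (- x))
  (fun x => F2 (- x)).
move=> H; have := H _ _ _ _ _ (- w); rewrite opprK mulrNN; apply.
- by move=> x; apply: der_reflect.
- by move=> x; apply: der_eq (derN (der_reflect (dF1 _))) _; rewrite opprK.
- exact: subgaussian_reflect.
- by apply: subgaussianN; apply: subgaussian_reflect.
- by move=> x; have := LF (- x); rewrite mulNr mulrN.
- by rewrite oppr_gt0.
Qed.

Lemma comparison (F F1 F2 S S1 S2 : R -> R) :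
  (forall x : R, is_derive x 1 F (F1 x)) -> (forall x : R, is_derive x 1 F1 (F2 x)) ->
  (forall x : R, is_derive x 1 S (S1 x)) -> (forall x : R, is_derive x 1 S1 (S2 x)) ->
  subgaussian F -> subgaussian F1 -> subgaussian S -> subgaussian S1 ->
  (forall x, `|F2 x - x * F1 x - m * F x| <= - (S2 x - x * S1 x - m * S x)) ->
  forall x, `|x * F1 x + m * F x| <= x * S1 x + m * S x.
Proof.
move=> dF dF1 dS dS1 sF sF1 sS sS1 H x; rewrite ler_norml; apply/andP; split.
  have : x * (- F1 x - S1 x) + m * (- F x - S x) <= 0; last lra.
  apply: (@first_order_comparison (fun y => - F y - S y) (fun y => - F1 y - S1 y)
    (fun y => - F2 y - S2 y)).
  - by apply: subgaussianD; apply: subgaussianN.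
  - by apply: subgaussianD; apply: subgaussianN.
  - by move=> y; have := le_trans (ler_norm _) (H y); lra.
have : x * (F1 x - S1 x) + m * (F x - S x) <= 0; last lra.
apply: (@first_order_comparison (fun y => F y - S y) (fun y => F1 y - S1 y)
  (fun y => F2 y - S2 y)).
- by apply: subgaussianD => //; apply: subgaussianN.
- by apply: subgaussianD => //; apply: subgaussianN.
- by move=> y; have := H y; rewrite -normrN => /(le_trans (ler_norm _)); lra.
Qed.

End Comparison.

(** * Real powers and supersolutions *)

Section RealPowers.
Variable R : realType.
Implicit Types (x y t s r : R).

(** Young's inequality for x and 1 with the conjugate exponents s and s / (s - 1). *)
Lemma bernoulli_ge s x : 1 <= s -> 0 <= x -> 1 + s * (x - 1) <= x `^ s.
Proof.
rewrite le_eqVlt => /predU1P[<-|s1] x0; first by rewrite powRr1 //; lra.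
have s0 : 0 < s by lra.
pose q := s / (s - 1); have q0 : 0 < q by rewrite divr_gt0 //; lra.
have e : s^-1 + q^-1 = 1 by rewrite /q; field; rewrite !gt_eqF //; lra.
have := conjugate_powR x0 ler01 s0 q0 e; rewrite mulr1 powR1 => H.
have : s * x <= s * (x `^ s / s + 1 / q) by rewrite ler_pM2l.
have -> : s * (x `^ s / s + 1 / q) = x `^ s + (s - 1).
  by rewrite /q; field; rewrite !gt_eqF //; lra.
lra.
Qed.

Lemma bernoulli_le s x : 0 <= s <= 1 -> 0 <= x -> x `^ s <= 1 + s * (x - 1).
Proof.
move=> /andP[]; rewrite le_eqVlt => /predU1P[<-|s0] s1 x0; first by rewrite powRr0; lra.
have si : 1 <= s^-1 by rewrite invf_ge1.
have := bernoulli_ge si (powR_ge0 x s).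
rewrite -powRrM divff ?gt_eqF // powRr1 // => H.
have : s * (1 + s^-1 * (x `^ s - 1)) <= s * x by rewrite ler_pM2l.
rewrite mulrDr mulrA divff ?gt_eqF //; lra.
Qed.

(** Bernoulli's inequality at x / l; the right side is the tangent at [l] of the concave function
    x^s. *)
Lemma powR_le_tangent s x (l : R) : 0 <= s <= 1 -> 0 <= x -> 0 < l ->
  x `^ s <= s * l `^ s / l * x + (1 - s) * l `^ s.
Proof.
move=> s01 x0 l0; have xl : 0 <= x / l by rewrite divr_ge0 // ltW.
have := bernoulli_le s01 xl.
have -> : x `^ s = l `^ s * (x / l) `^ s.
  by rewrite -powRM ?(ltW l0) // mulrCA divff ?gt_eqF // mulr1.
move=> H; have : l `^ s * (x / l) `^ s <= l `^ s * (1 + s * (x / l - 1)).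
  by rewrite ler_wpM2l ?powR_ge0.
lra.
Qed.

Lemma powR_ge_tangent s x (l : R) : 1 <= s -> 0 <= x -> 0 < l ->
  s * l `^ s / l * x + (1 - s) * l `^ s <= x `^ s.
Proof.
move=> s01 x0 l0; have xl : 0 <= x / l by rewrite divr_ge0 // ltW.
have := bernoulli_ge s01 xl.
have -> : x `^ s = l `^ s * (x / l) `^ s.
  by rewrite -powRM ?(ltW l0) // mulrCA divff ?gt_eqF // mulr1.
move=> H; have : l `^ s * (1 + s * (x / l - 1)) <= l `^ s * (x / l) `^ s.
  by rewrite ler_wpM2l ?powR_ge0.
lra.
Qed.

Lemma powR_double r x : 0 <= x -> (2 * x) `^ r = 2 `^ r * x `^ r.
Proof. by move=> x0; rewrite powRM. Qed.

(** Sum of the tangent inequalities for x and for y at their midpoint. *)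
Lemma powRD_convex r x y : 1 <= r -> 0 <= x -> 0 <= y ->
  (x + y) `^ r <= 2 `^ (r - 1) * (x `^ r + y `^ r).
Proof.
move=> r1 x0 y0.
have [xy0|xy0] := eqVneq (x + y) 0.
  by rewrite xy0 powR0 ?mulr_ge0 ?addr_ge0 ?powR_ge0 // gt_eqF //; lra.
have l0 : 0 < (x + y) / 2.
  by rewrite divr_gt0 // lt_neqAle eq_sym xy0 addr_ge0.
set l := (x + y) / 2 in l0 *.
have := powR_ge_tangent r1 x0 l0; have := powR_ge_tangent r1 y0 l0.
have -> : (x + y) `^ r = 2 `^ (r - 1) * (2 * l `^ r).
  have -> : x + y = 2 * l by rewrite /l; field.
  rewrite (powR_double _ (ltW l0)) mulrA; congr (_ * _).
  by rewrite mulrC mulr_powRB1 //; lra.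
move=> Hy Hx; rewrite ler_wpM2l ?powR_ge0 //.
have : r * l `^ r / l * x + r * l `^ r / l * y = 2 * (r * l `^ r).
  rewrite -mulrDr; have -> : x + y = 2 * l by rewrite /l; field.
  by field; rewrite gt_eqF.
lra.
Qed.

(** With l = x + y, both x / l and y / l lie in [0, 1], where t <= t^r for 0 < r <= 1. *)
Lemma powRD_concave r x y : 0 <= r <= 1 -> 0 <= x -> 0 <= y ->
  (x + y) `^ r <= x `^ r + y `^ r.
Proof.
move=> /andP[]; rewrite le_eqVlt => /predU1P[<-|r0] r1 x0 y0.
  by rewrite !powRr0; lra.
have [xy0|xy0] := eqVneq (x + y) 0.
  by rewrite xy0 powR0 ?addr_ge0 ?powR_ge0 // gt_eqF.
have l0 : 0 < x + y by rewrite lt_neqAle eq_sym xy0 addr_ge0.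
set l := x + y in l0 *.
have H z : 0 <= z -> z <= l -> z / l * l `^ r <= z `^ r.
  move=> z0 zl; have zl1 : z / l <= 1 by rewrite ler_pdivrMr // mul1r.
  have zl0 : 0 <= z / l by rewrite divr_ge0 // ltW.
  have -> : z `^ r = (z / l) `^ r * l `^ r.
    by rewrite -powRM ?(ltW l0) // divfK ?gt_eqF.
  rewrite ler_wpM2r ?powR_ge0 //.
  have [->|zn0] := eqVneq (z / l) 0; first by rewrite powR0 ?gt_eqF.
  by apply: ger1_powR => //; rewrite lt_neqAle eq_sym zn0 zl0.
have := H x x0 ltac:(rewrite /l; lra); have := H y y0 ltac:(rewrite /l; lra).
have : x / l * l `^ r + y / l * l `^ r = l `^ r.
  by rewrite -mulrDl -mulrDl divff ?mul1r // gt_eqF.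
lra.
Qed.

(** The concave case with exponent 1 / r, applied to x^r and y^r. *)
Lemma powR_superadd r x y : 1 <= r -> 0 <= x -> 0 <= y ->
  x `^ r + y `^ r <= (x + y) `^ r.
Proof.
move=> r1 x0 y0; have r0 : 0 < r by lra.
have := @powRD_concave r^-1 (x `^ r) (y `^ r) _ (powR_ge0 _ _) (powR_ge0 _ _).
rewrite invr_ge0 invf_le1 // r1 (ltW r0) => /(_ isT).
rewrite -!powRrM divff ?gt_eqF // !powRr1 // => H.
have := @ge0_ler_powR R r (ltW r0) _ _ _ _ H.
rewrite !nnegrE powR_ge0 addr_ge0 // => /(_ isT isT).
by rewrite -powRrM mulVf ?gt_eqF // powRr1 ?addr_ge0 ?powR_ge0.
Qed.

Lemma sqr_normE x : `|x| ^+ 2 = x ^+ 2.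
Proof. exact: real_normK (num_real x). Qed.

Lemma powR_norm_sqr x s : `|x| `^ s = (x ^+ 2) `^ (s / 2).
Proof.
by rewrite -sqr_normE -powR_mulrn // -powRrM; congr powR; field.
Qed.

Lemma powR_norm2D x r : 0 <= r -> `|x| `^ (r + 2) = x ^+ 2 * `|x| `^ r.
Proof.
move=> r0; have [->|x0] := eqVneq x 0.
  by rewrite normr0 powR0 ?gt_eqF ?expr0n ?mul0r //; lra.
rewrite powRD ?normr_eq0 ?x0 ?implybT // mulrC; congr (_ * _).
by rewrite powR_mulrn // sqr_normE.
Qed.

(** The signed power: up to constants it is the derivative of |x|^(s + 2) and a primitive of |x|^s,
    also at 0. *)
Definition spow s x := x * `|x| `^ s.

Lemma der_spow s x : 0 <= s -> is_derive x 1 (spow s) ((s + 1) * `|x| `^ s).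
Proof.
rewrite le_eqVlt => /predU1P[<-|s0].
  have -> : spow 0 = fun y => y by apply/funext => y; rewrite /spow powRr0 mulr1.
  by apply: der_eq (der_id x) _; rewrite powRr0; ring.
have [->|x0] := eqVneq x 0.
  rewrite normr0 powR0 ?gt_eqF // mulr0.
  have H : h^-1 *: (spow s (h *: 1 + 0) - spow s 0) @[h --> 0^'] --> (0 : R).
    apply/cvgrPdist_lt => e e0; rewrite near_withinE.
    exists (e `^ s^-1) => /=; first exact: powR_gt0.
    move=> h; rewrite /ball_ /= sub0r normrN => hs h0.
    rewrite addr0 /spow mul0r subr0 sub0r normrN /GRing.scale /= mulr1 mulrA mulVf // mul1r.
    rewrite ger0_norm ?powR_ge0 //.
    have := @gt0_ltr_powR R s s0 _ _ _ _ hs.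
    by rewrite !nnegrE normr_ge0 powR_ge0 -powRrM mulVf ?gt_eqF // powRr1 ?ltW //; apply.
  by split; [apply/cvg_ex; exists 0|apply/cvg_lim].
have -> : spow s = fun y => y * (y ^+ 2) `^ (s / 2).
  by apply/funext => y; rewrite /spow powR_norm_sqr.
have x20 : 0 < x ^+ 2 by rewrite exprn_even_gt0.
have dp := der_comp (g := fun y => y ^+ 2) (is_derive1_powR (s / 2) x20) (derX 2 (der_id x)).
apply: der_eq (derM (der_id x) dp) _.
rewrite powR_norm_sqr powRB ?(gt_eqF x20) ?implybT // powRr1 ?(ltW x20) //= expr1.
by field.
Qed.

Lemma der_norm_powR r x : 2 <= r ->
  is_derive x 1 (fun y => `|y| `^ r) (r * spow (r - 2) x).
Proof.
move=> r2; have r20 : 0 <= r - 2 by lra.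
have -> : (fun y => `|y| `^ r) = fun y => y * spow (r - 2) y.
  apply/funext => y; rewrite /spow mulrA -expr2 -powR_norm2D //.
  by congr powR; lra.
apply: der_eq (derM (der_id x) (der_spow x r20)) _.
by rewrite /spow; ring.
Qed.

Lemma subgaussian_spow s : 0 <= s -> subgaussian (spow s).
Proof. by move=> s0; apply: subgaussianM (@subgaussian_id R) (subgaussian_powR s0). Qed.

End RealPowers.

(** * Explicit supersolutions for powers of |x| *)

Section Supersolutions.
Variables (R : realType) (m : R).
Hypothesis m1 : 1 <= m.

(* [b] bounds [w S' + m S] at the single point [w], so [S] may depend on [w]. *)
Definition supersolution (k : R -> R) (w b : R) := exists S S1 S2 : R -> R,
  [/\ (forall x : R, is_derive x 1 S (S1 x)) /\ (forall x : R, is_derive x 1 S1 (S2 x)),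
      subgaussian S /\ subgaussian S1,
      forall x, k x <= - (S2 x - x * S1 x - m * S x) &
      w * S1 w + m * S w <= b].

Lemma supersolutionD k k' w b b' : supersolution k w b -> supersolution k' w b' ->
  supersolution (fun x => k x + k' x) w (b + b').
Proof.
move=> [S [S1 [S2 [[d1 d2] [s1 s2] H Hb]]]] [T [T1 [T2 [[e1 e2] [t1 t2] K Kb]]]].
exists (fun x => S x + T x), (fun x => S1 x + T1 x), (fun x => S2 x + T2 x); split.
- by split => x; apply: derD.
- by split; apply: subgaussianD.
- by move=> x; have := H x; have := K x; lra.
- by lra.
Qed.

Lemma supersolutionZ c k w b : 0 <= c -> supersolution k w b ->
  supersolution (fun x => c * k x) w (c * b).
Proof.
move=> c0 [S [S1 [S2 [[d1 d2] [s1 s2] H Hb]]]].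
exists (fun x => c * S x), (fun x => c * S1 x), (fun x => c * S2 x); split.
- by split => x; apply: derZ.
- by split; apply: subgaussianZ.
- by move=> x; have := ler_wpM2l c0 (H x); lra.
- by have := ler_wpM2l c0 Hb; lra.
Qed.

Lemma supersolution_le k k' w b b' : (forall x, k x <= k' x) -> b' <= b ->
  supersolution k' w b' -> supersolution k w b.
Proof.
move=> kk' bb' [S [S1 [S2 [[d1 d2] [s1 s2] H Hb]]]].
exists S, S1, S2; split => //; last exact: le_trans bb'.
by move=> x; apply: le_trans (kk' x) (H x).
Qed.

Lemma supersolution_cst w : supersolution (fun=> 1) w 1.
Proof.
have m1' : 1 <= m := m1.
have m0 : m != 0 by rewrite gt_eqF //; lra.
exists (fun=> m^-1), (fun=> 0), (fun=> 0); split.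
- by split => x; exact: der_cst.
- by split; exact: subgaussian_cst.
- by move=> x; rewrite mulr0 divff //; lra.
- by rewrite mulr0 divff //; lra.
Qed.

Lemma supersolution_sqr w : supersolution (fun x => x ^+ 2) w (w ^+ 2 + 2 / (m + 2)).
Proof.
have m1' : 1 <= m := m1.
have m0 : m != 0 by rewrite gt_eqF //; lra.
have m20 : m + 2 != 0 by rewrite gt_eqF //; lra.
(* The operator sends x^2 to 2 - (m + 2) x^2 and the constant 2 / m to - 2, so the source term x^2
   is matched exactly. *)
exists (fun x => (m + 2)^-1 * (x ^+ 2 + 2 / m)), (fun x => (m + 2)^-1 * (2 * x)),
  (fun=> (m + 2)^-1 * 2); split.
- split => x.
    apply: der_eq (derZ _ (derD (derX 2 (der_id x)) (der_cst _ x))) _.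
    by rewrite expr1; ring.
  by apply: der_eq (derZ _ (derZ _ (der_id x))) _; rewrite mulr1.
- split; last by do 2 apply: subgaussianZ; exact: subgaussian_id.
  apply: subgaussianZ; apply: subgaussianD; first exact: subgaussian_expn.
  exact: subgaussian_cst.
- by move=> x; rewrite le_eqVlt; apply/orP; left; apply/eqP; field; rewrite m0 m20.
- by rewrite le_eqVlt; apply/orP; left; apply/eqP; field; rewrite m0 m20.
Qed.

(* By concavity [|x|^r] lies below
   the combination of [1] and [x^2] tangent to it at [x^2 = w^2 + 2/(m+2)]. *)
Lemma supersolution_powR_small w r : 0 <= r < 2 ->
  supersolution (fun x => `|x| `^ r) w ((w ^+ 2 + 2 / 3) `^ (r / 2)).
Proof.
move=> /andP[r0 r2]; have m1' : 1 <= m := m1.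
have s01 : 0 <= r / 2 <= 1 by apply/andP; split; lra.
set s := r / 2 in s01 *.
pose l := w ^+ 2 + 2 / (m + 2).
have lp : 0 < 2 / (m + 2) by rewrite divr_gt0 //; lra.
have l0 : 0 < l by rewrite ltr_wpDl ?sqr_ge0.
have a0 : 0 <= s * l `^ s / l.
  by rewrite divr_ge0 ?(ltW l0) // mulr_ge0 ?powR_ge0 //; case/andP: s01.
have b0 : 0 <= (1 - s) * l `^ s.
  by rewrite mulr_ge0 ?powR_ge0 // subr_ge0; case/andP: s01.
have := supersolutionD (supersolutionZ a0 (supersolution_sqr w))
  (supersolutionZ b0 (supersolution_cst w)).
apply: supersolution_le.
  move=> x; rewrite mulr1 powR_norm_sqr; apply: powR_le_tangent => //.
  exact: sqr_ge0.
rewrite -/l divfK ?gt_eqF // mulr1 -mulrDl addrC subrK mul1r.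
(* As m >= 1, 2 / (m + 2) <= 2 / 3, which frees the bound from m. *)
apply: ge0_ler_powR; rewrite ?nnegrE.
- by case/andP: s01.
- exact: ltW.
- by have := sqr_ge0 w; lra.
- by rewrite lerD2l ler_pM2l // lef_pV2 ?posrE //; lra.
Qed.

(** The operator sends |x|^r to r (r - 1) |x|^(r - 2) - (r + m) |x|^r, so (|x|^r + r (r - 1) S) / (r
    + m) serves for r whenever S serves for r - 2. The hypotheses on [N] are what this recursion,
    started on 0 <= r < 2, asks of a bound uniform in m. *)
Lemma supersolution_powR (C : R) (N : R -> R -> R) : 1 <= C ->
  (forall r t, 0 <= N r t) ->
  (forall r t, 0 <= r < 2 -> (t ^+ 2 + 2 / 3) `^ (r / 2) <= C * N r t) ->
  (forall r t, 2 <= r -> `|t| `^ r + (r - 1) * N (r - 2) t <= N r t) ->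
  forall w r, 0 <= r -> supersolution (fun x => `|x| `^ r) w (C * N r w).
Proof.
move=> C1 N0 Nbase Nstep w r r0; have m1' : 1 <= m := m1.
have [k rk] : exists k : nat, r < 2 * k%:R.
  have [k Hk] : exists k : nat, r < k%:R.
    by exists (Num.bound r); apply: le_lt_trans (archi_boundP r0); rewrite lexx.
  by exists k; apply: lt_le_trans Hk _; have := ler0n R k; lra.
elim: k r r0 rk => [|k IH] r r0 rk; first by rewrite mulr0 in rk; lra.
have [r2|r2] := ltP r 2.
  apply: supersolution_le (supersolution_powR_small w _) => //; last exact/andP.
  by apply: Nbase; apply/andP.
have rm0 : r + m != 0 by rewrite gt_eqF //; lra.
have rm1 : 0 <= (r + m)^-1 by rewrite invr_ge0; lra.
have r20 : 0 <= r - 2 by lra.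
have [|S [S1 [S2 [[d1 d2] [s1 s2] H Hb]]]] := IH _ r20.
  by rewrite -natr1 in rk; lra.
have rr1 : 0 <= r * (r - 1) by rewrite mulr_ge0 //; lra.
exists (fun x => (r + m)^-1 * (`|x| `^ r + r * (r - 1) * S x)),
  (fun x => (r + m)^-1 * (r * spow (r - 2) x + r * (r - 1) * S1 x)),
  (fun x => (r + m)^-1 * (r * ((r - 2 + 1) * `|x| `^ (r - 2)) + r * (r - 1) * S2 x)).
have xx x : x * spow (r - 2) x = `|x| `^ r.
  by rewrite /spow mulrA -expr2 -powR_norm2D //; congr powR; lra.
split.
- split => x; apply: derZ; apply: derD; try exact: derZ.
    exact: der_norm_powR.
  by apply: derZ; apply: der_spow.
- split; apply: subgaussianZ; apply: subgaussianD; try exact: subgaussianZ.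
    exact: subgaussian_powR.
  by apply: subgaussianZ; apply: subgaussian_spow.
- move=> x; have := ler_wpM2l rr1 (H x) => {}H.
  set a := (r + m)^-1 in rm1 *.
  have -> : - (a * (r * ((r - 2 + 1) * `|x| `^ (r - 2)) + r * (r - 1) * S2 x) -
     x * (a * (r * spow (r - 2) x + r * (r - 1) * S1 x)) -
     m * (a * (`|x| `^ r + r * (r - 1) * S x))) =
     a * ((r + m) * `|x| `^ r + (r * (r - 1) * - (S2 x - x * S1 x - m * S x) -
          r * (r - 1) * `|x| `^ (r - 2))) by rewrite -xx; ring.
  rewrite mulrDr mulrA mulVf // mul1r lerDl mulr_ge0 // subr_ge0 //.
have := Nstep r w r2.
have -> : w * ((r + m)^-1 * (r * spow (r - 2) w + r * (r - 1) * S1 w)) +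
   m * ((r + m)^-1 * (`|w| `^ r + r * (r - 1) * S w)) =
   `|w| `^ r + r / (r + m) * ((r - 1) * (w * S1 w + m * S w)).
  by rewrite -xx; field.
move=> HN; have C0 : 0 <= C by lra.
apply: le_trans (ler_wpM2l C0 HN).
have p1 : `|w| `^ r <= C * `|w| `^ r by rewrite ler_peMl // powR_ge0.
have r10 : 0 <= r - 1 by lra.
have p2 := ler_wpM2l r10 Hb.
have p3 : r / (r + m) * ((r - 1) * (w * S1 w + m * S w)) <= (r - 1) * (C * N (r - 2) w).
  apply: le_trans (_ : r / (r + m) * ((r - 1) * (C * N (r - 2) w)) <= _).
    by rewrite ler_wpM2l // divr_ge0 //; lra.
  rewrite ler_piMl ?mulr_ge0 // ler_pdivrMr; lra.
lra.
Qed.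

End Supersolutions.

(** * Integration and the Gaussian measure *)

Section RealIntegrals.
Context d (T : measurableType d) (R : realType) (mu : {measure set T -> \bar R}).
Implicit Types f g : T -> R.

Definition itg f := mu.-integrable [set: T] (EFin \o f).
Definition Ex f : R := (\int[mu]_x f x)%R.

Lemma itg_measurable f : itg f -> measurable_fun [set: T] f.
Proof. by move=> /measurable_int /measurable_EFinP. Qed.

Lemma itg_le f g : measurable_fun [set: T] f -> (forall x, `|f x| <= `|g x|) ->
  itg g -> itg f.
Proof.
move=> mf fg ig; apply: le_integrable ig => //; first exact/measurable_EFinP.
by move=> x _ /=; rewrite lee_fin.
Qed.

Lemma itgD f g : itg f -> itg g -> itg (fun x => f x + g x).
Proof. by move=> fi gi; apply: eq_integrable (integrableD _ fi gi). Qed.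

Lemma itgZ c f : itg f -> itg (fun x => c * f x).
Proof. by move=> fi; apply: eq_integrable (integrableZl _ c fi). Qed.

Lemma itgN f : itg f -> itg (fun x => - f x).
Proof.
by move=> fi; apply: eq_integrable (itgZ (-1) fi) => // x _; rewrite /= mulN1r.
Qed.

Lemma itgB f g : itg f -> itg g -> itg (fun x => f x - g x).
Proof. by move=> fi gi; apply: itgD fi (itgN gi). Qed.

Lemma itg_norm f : itg f -> itg (fun x => `|f x|).
Proof.
move=> fi; apply: (itg_le _ _ fi) => [|x]; last by rewrite normr_id.
by apply: measurableT_comp => //; exact: itg_measurable.
Qed.

Lemma itg_sum (I : Type) (s : seq I) (F : I -> T -> R) :
  (forall i, itg (F i)) -> itg (fun x => \sum_(i <- s) F i x).
Proof.
move=> Fi; elim: s => [|i s IH].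
  by rewrite (_ : (fun _ => _) = cst 0) //; [exact: integrable0|apply/funext => x; rewrite big_nil].
rewrite (_ : (fun _ => _) = fun x => F i x + \sum_(j <- s) F j x).
  exact: itgD.
by apply/funext => x; rewrite big_cons.
Qed.

Lemma ExD f g : itg f -> itg g -> Ex (fun x => f x + g x) = Ex f + Ex g.
Proof. by move=> fi gi; rewrite /Ex RintegralD. Qed.

Lemma ExB f g : itg f -> itg g -> Ex (fun x => f x - g x) = Ex f - Ex g.
Proof. by move=> fi gi; rewrite /Ex RintegralB. Qed.

Lemma ExZ c f : itg f -> Ex (fun x => c * f x) = c * Ex f.
Proof. by move=> fi; rewrite /Ex RintegralZl. Qed.

Lemma Ex_sum (I : Type) (s : seq I) (F : I -> T -> R) : (forall i, itg (F i)) ->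
  Ex (fun x => \sum_(i <- s) F i x) = \sum_(i <- s) Ex (F i).
Proof.
move=> Fi; elim: s => [|i s IH].
  rewrite big_nil (_ : (fun _ => _) = cst 0) ?/Ex ?Rintegral_cst ?mul0r //.
  by apply/funext => x; rewrite big_nil.
rewrite big_cons -IH -ExD //; last exact: itg_sum.
by congr Ex; apply/funext => x; rewrite big_cons.
Qed.

Lemma Ex_le f g : itg f -> itg g -> (forall x, f x <= g x) -> Ex f <= Ex g.
Proof. by move=> fi gi fg; apply: le_Rintegral. Qed.

Lemma Ex_ge0 f : (forall x, 0 <= f x) -> 0 <= Ex f.
Proof. by move=> f0; apply: Rintegral_ge0. Qed.

Lemma Ex_norm f : itg f -> `|Ex f| <= Ex (fun x => `|f x|).
Proof. by move=> fi; apply: le_normr_Rintegral. Qed.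

Lemma Ex_EFin f : itg f -> (\int[mu]_x (f x)%:E)%E = (Ex f)%:E.
Proof. by move=> fi; rewrite /Ex /Rintegral fineK //; apply: integrable_fin_num. Qed.

End RealIntegrals.

Section ProbabilityIntegrals.
Context d (T : measurableType d) (R : realType) (P : probability T R).

Lemma itg_cst (c : R) : itg P (fun=> c).
Proof. by apply: finite_measure_integrable_cst. Qed.

Lemma Ex_cst (c : R) : Ex P (fun=> c) = c.
Proof.
by rewrite /Ex Rintegral_cst // (congr1 fine (probability_setT P)) mulr1.
Qed.

End ProbabilityIntegrals.

Section Gaussian.
Variable R : realType.
Local Notation mu := (@lebesgue_measure R).
Implicit Types f : R -> R.

Definition gamma : probability (measurableTypeR R) R := normal_prob (0 : R) 1.
Definition npdf : R -> R := normal_pdf 0 1.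
Definition npeak : R := normal_peak 1.

Lemma npeak_gt0 : 0 < npeak.
Proof. exact: normal_peak_gt0. Qed.

Lemma npdfE x : npdf x = npeak * expR (- (2^-1 * x ^+ 2)).
Proof.
rewrite /npdf normal_pdfE // /normal_fun subr0 expr1n.
by congr (_ * expR _); rewrite mulrC; field.
Qed.

Lemma npdf_gt0 x : 0 < npdf x.
Proof. by rewrite npdfE mulr_gt0 ?npeak_gt0 ?expR_gt0. Qed.

Lemma npdf_even x : npdf (- x) = npdf x.
Proof. by rewrite !npdfE sqrrN. Qed.

Lemma der_npdf (x : R) : is_derive x 1 npdf (- x * npdf x).
Proof.
have -> : npdf = fun x => npeak * expR (- (2^-1 * x ^+ 2)).
  by apply/funext => y; exact: npdfE.
apply: der_eq (derZ _ (der_exp (derN (derZ _ (derX 2 (der_id x)))))) _.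
by rewrite expr1; field.
Qed.

Lemma measurable_npdf : measurable_fun [set: R] npdf.
Proof. exact: measurable_normal_pdf. Qed.

Lemma continuous_measurable f : continuous f -> measurable_fun [set: R] f.
Proof. by move=> cf; apply: continuous_measurable_fun. Qed.

Lemma itg_expR_sqr (a : R) : 0 < a -> itg mu (fun x : R => expR (- (a * x ^+ 2))).
Proof.
move=> a0; pose s := Num.sqrt (2 * a)^-1.
have s0 : 0 < s by rewrite sqrtr_gt0 invr_gt0 mulr_gt0.
have pk : 0 < normal_peak s by apply: normal_peak_gt0; rewrite gt_eqF.
have := itgZ (normal_peak s)^-1 (integrable_normal_pdf 0 s).
rewrite (_ : (fun x => _) = fun x : R => expR (- (a * x ^+ 2))) //.
apply/funext => x; rewrite normal_pdfE ?gt_eqF // mulrA mulVf ?gt_eqF // mul1r.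
rewrite /normal_fun subr0 sqr_sqrtr ?invr_ge0 ?mulr_ge0 ?(ltW a0) //; congr expR.
by field; rewrite gt_eqF.
Qed.

Lemma subgaussian_npdf_le f (e : R) : subgaussian f -> 0 < e -> exists2 C, 0 <= C &
  forall x, `|f x * npdf x| <= C * expR (- ((2^-1 - e) * x ^+ 2)).
Proof.
move=> sf e0; have [C HC] := sf e e0; exists (`|C| * npeak).
  by rewrite mulr_ge0 // ltW // npeak_gt0.
move=> x; rewrite normrM (gtr0_norm (npdf_gt0 x)) npdfE.
have -> : - ((2^-1 - e) * x ^+ 2) = e * x ^+ 2 + - (2^-1 * x ^+ 2) by ring.
rewrite expRD [leRHS](_ : _ = (`|C| * expR (e * x ^+ 2)) *
  (npeak * expR (- (2^-1 * x ^+ 2)))); last by ring.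
rewrite ler_wpM2r ?mulr_ge0 ?expR_ge0 ?(ltW npeak_gt0) //.
by apply: le_trans (HC x) _; rewrite ler_wpM2r ?expR_ge0 ?ler_norm.
Qed.

Lemma itg_subgaussian_npdf f : measurable_fun [set: R] f -> subgaussian f ->
  itg mu (fun x => f x * npdf x).
Proof.
move=> mf sf; have e0 : 0 < 4^-1 :> R by lra.
have [C C0 HC] := subgaussian_npdf_le sf e0.
apply: itg_le (itgZ C (itg_expR_sqr e0)) => [|x].
  by apply: measurable_funM => //; exact: measurable_npdf.
rewrite [leRHS]ger0_norm ?mulr_ge0 ?expR_ge0 //; apply: le_trans (HC x) _.
by rewrite (_ : 2^-1 - 4^-1 = 4^-1) //; lra.
Qed.

Lemma gamma_dominates : gamma `<< mu.
Proof. exact: normal_prob_dominates. Qed.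

(** Both functions integrate to [gamma] over every measurable set. This is how integrals against
    [gamma] become Lebesgue integrals with weight [npdf]. *)
Lemma gamma_density_ae :
  ae_eq mu [set: R] (Radon_Nikodym_SigmaFinite.f gamma mu) (EFin \o npdf).
Proof.
apply: integral_ae_eq => //.
- exact: Radon_Nikodym_SigmaFinite.f_integrable gamma_dominates.
- by apply/measurable_EFinP; exact: measurable_npdf.
- move=> E _ mE; rewrite -Radon_Nikodym_SigmaFinite.f_integral //.
  exact: gamma_dominates.
Qed.

Lemma ge0_integral_gamma (f : R -> \bar R) : measurable_fun [set: R] f ->
  (forall x, 0 <= f x)%E ->
  (\int[gamma]_x f x = \int[mu]_x (f x * (npdf x)%:E))%E.
Proof.
move=> mf f0.
rewrite -(Radon_Nikodym_SigmaFinite.change_of_variables gamma_dominates) //.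
apply: ae_eq_integral => //.
- apply: emeasurable_funM => //; apply: (measurable_int mu).
  exact: Radon_Nikodym_SigmaFinite.f_integrable gamma_dominates.
- by apply: emeasurable_funM => //; apply/measurable_EFinP; exact: measurable_npdf.
- by apply: ae_eqe_mul2l; exact: gamma_density_ae.
Qed.

Lemma itg_gamma f : measurable_fun [set: R] f -> subgaussian f -> itg gamma f.
Proof.
move=> mf sf; apply/integrableP; split; first exact/measurable_EFinP.
rewrite ge0_integral_gamma //; last first.
  by apply: measurableT_comp => //; exact/measurable_EFinP.
have /integrableP[_] := itg_subgaussian_npdf mf sf.
apply: le_lt_trans; rewrite le_eqVlt; apply/orP; left; apply/eqP.
apply: eq_integral => x _ /=.
by rewrite -EFinM normrM (gtr0_norm (npdf_gt0 x)).
Qed.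

Lemma Ex_gamma f : measurable_fun [set: R] f -> subgaussian f ->
  Ex gamma f = Ex mu (fun x => f x * npdf x).
Proof.
move=> mf sf; rewrite /Ex /Rintegral; congr fine.
rewrite -(Radon_Nikodym_change_of_variables gamma_dominates) //; last exact: itg_gamma.
apply: ae_eq_integral => //.
- apply: emeasurable_funM => //; first exact/measurable_EFinP.
  apply: (measurable_int mu); apply: Radon_Nikodym_integrable.
  exact: gamma_dominates.
- by apply/measurable_EFinP; apply: measurable_funM => //; exact: measurable_npdf.
- under [X in ae_eq _ _ _ X]eq_fun do rewrite EFinM.
  apply: ae_eqe_mul2l; apply: ae_eq_trans gamma_density_ae.
  apply/ae_eq_sym; exact: ae_eq_Radon_Nikodym_SigmaFinite gamma_dominates _ _.
Qed.

End Gaussian.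

Arguments gamma {R}.
Arguments npeak {R}.
Arguments npeak_gt0 {R}.

(** * Stein's equation *)

Section ContinuityOfPowers.
Variable R : realType.

(** For s >= 1 this is the absolute value of a differentiable signed power; for 0 < s < 1
    subadditivity makes it Hölder continuous. *)
Lemma continuous_norm_powR (s : R) : 0 <= s -> continuous (fun x : R => `|x| `^ s).
Proof.
rewrite le_eqVlt => /predU1P[<-|s0].
  by rewrite (_ : (fun x => _) = cst 1); [exact: cst_continuous|apply/funext => x; rewrite powRr0].
have [s1|s1] := leP 1 s.
  have s10 : 0 <= s - 1 by lra.
  have -> : (fun x : R => `|x| `^ s) = fun x => `|spow (s - 1) x|.
    apply/funext => x; rewrite /spow normrM (ger0_norm (powR_ge0 _ _)).
    by rewrite mulr_powRB1.
  move=> x; apply: (@continuous_comp _ _ _ (spow (s - 1)) (fun y => `|y|)).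
    exact: der_continuous (fun x => der_spow x s10) x.
  exact: norm_continuous.
have s01 : 0 <= s <= 1 by rewrite !ltW.
have holder (x y : R) : `|x| `^ s - `|y| `^ s <= `|x - y| `^ s.
  rewrite lerBlDr; apply: le_trans (powRD_concave s01 (normr_ge0 _) (normr_ge0 _)).
  apply: ge0_ler_powR; rewrite ?nnegrE ?addr_ge0 ?(ltW s0) //.
  by have := ler_normD (x - y) y; rewrite subrK.
move=> x; apply/cvgrPdist_lt => e e0; near=> y.
apply: (@le_lt_trans _ _ (`|x - y| `^ s)).
  by rewrite ler_norml holder andbT lerNl opprB distrC holder.
have -> : e = (e `^ s^-1) `^ s by rewrite -powRrM mulVf ?gt_eqF // powRr1 // ltW.
apply: gt0_ltr_powR; rewrite ?nnegrE ?powR_ge0 //.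
near: y; apply: (@cvgr_dist_lt _ _ _ (nbhs x) _ id) => //.
by rewrite powR_gt0.
Unshelve. all: by end_near. Qed.

Lemma measurable_norm_powR (s : R) : measurable_fun [set: R] (fun x : R => `|x| `^ s).
Proof.
apply: (measurableT_comp (measurable_powR s)).
exact: normr_measurable.
Qed.

End ContinuityOfPowers.

Section GaussianTails.
Variable R : realType.
Local Notation mu := (@lebesgue_measure R).
Implicit Types f : R -> R.

Definition Gprim f (w : R) : R := (\int[mu]_(x in `]-oo, w]) (f x * npdf x))%R.

(** On [D] the part exp (- (1/2 - e) x^2) of the Gaussian decay is at most its value at [w], and the
    remaining exp (- e x^2 / 2) is integrable over the line. The arbitrary set [D] lets one
    statement serve both tails. *)
Lemma subgaussian_tail f (e : R) : measurable_fun [set: R] f -> subgaussian f ->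
  0 < e -> e <= 4^-1 -> exists2 C, 0 <= C & forall (w : R) (D : set R), measurable D ->
    (forall x, D x -> `|w| <= `|x|) ->
    `|(\int[mu]_(x in D) (f x * npdf x))%R| <= C * expR (- ((2^-1 - e) * w ^+ 2)).
Proof.
move=> mf sf e0 e4; have e20 : 0 < e / 2 by lra.
have [C C0 HC] := subgaussian_npdf_le sf e20.
pose K := Ex mu (fun x => expR (- (e / 2 * x ^+ 2))).
have K0 : 0 <= K by apply: Ex_ge0 => x; exact: expR_ge0.
exists (C * K); first exact: mulr_ge0.
move=> w D mD wD.
have If : mu.-integrable D (EFin \o (fun x => f x * npdf x)).
  by apply: integrableS (itg_subgaussian_npdf mf sf).
have Ie : mu.-integrable D (EFin \o (fun x => expR (- (e / 2 * x ^+ 2)))).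
  by apply: integrableS (itg_expR_sqr e20).
have IeT := itg_expR_sqr e20.
apply: (@le_trans _ _ (\int[mu]_(x in D) `|f x * npdf x|)%R).
  exact: le_normr_Rintegral.
set E := expR (- ((2^-1 - e) * w ^+ 2)).
have IC : mu.-integrable D (EFin \o (fun x => C * E * expR (- (e / 2 * x ^+ 2)))).
  by apply: eq_integrable (integrableZl _ (C * E) Ie).
apply: (@le_trans _ _ (\int[mu]_(x in D) (C * E * expR (- (e / 2 * x ^+ 2))))%R).
  apply: le_Rintegral => //.
    by apply: eq_integrable (integrable_norm If).
  move=> x Dx; apply: le_trans (HC x) _; rewrite -mulrA ler_wpM2l // -expRD ler_expR.
  rewrite -opprD lerN2.
  have : (2^-1 - e) * w ^+ 2 <= (2^-1 - e) * x ^+ 2.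
    apply: ler_wpM2l; first by lra.
    by rewrite -sqr_normE -(sqr_normE x) lerXn2r ?nnegrE ?wD.
  lra.
rewrite RintegralZl // mulrAC ler_wpM2r ?expR_ge0 // ler_wpM2l //.
rewrite /K /Ex /Rintegral fine_le //.
- exact: integrable_fin_num Ie.
- exact: integrable_fin_num IeT.
- apply: ge0_subset_integral => //; exact: measurable_int IeT.
Qed.

Lemma Gprim_left f (e : R) : measurable_fun [set: R] f -> subgaussian f ->
  0 < e -> e <= 4^-1 -> exists2 C, 0 <= C & forall w, w <= 0 ->
    `|Gprim f w| <= C * expR (- ((2^-1 - e) * w ^+ 2)).
Proof.
move=> mf sf e0 e4; have [C C0 HC] := subgaussian_tail mf sf e0 e4.
exists C => // w w0; apply: HC => // x; rewrite /= in_itv /= => xw.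
by rewrite !ler0_norm ?lerN2 // (le_trans xw).
Qed.

Lemma Gprim_right f (e : R) : measurable_fun [set: R] f -> subgaussian f ->
  0 < e -> e <= 4^-1 -> exists2 C, 0 <= C & forall w, 0 <= w ->
    `|Ex gamma f - Gprim f w| <= C * expR (- ((2^-1 - e) * w ^+ 2)).
Proof.
move=> mf sf e0 e4; have [C C0 HC] := subgaussian_tail mf sf e0 e4.
exists C => // w w0; rewrite Ex_gamma // /Ex /Gprim -[in X in X - _]set_itvNyy.
rewrite Rintegral_itvB //; last by rewrite set_itvNyy; exact: itg_subgaussian_npdf.
apply: HC => // x; rewrite /= in_itv /= andbT => wx.
by rewrite !ger0_norm ?(ltW wx) // (le_trans w0) // ltW.
Qed.

Lemma der_Gprim f (w : R) : continuous f -> subgaussian f ->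
  is_derive w 1 (Gprim f) (f w * npdf w).
Proof.
move=> cf sf; have mf := continuous_measurable cf.
have w1 : w < w + 1 by lra.
have If : mu.-integrable `]-oo, (w + 1)] (EFin \o (fun x => f x * npdf x)).
  by apply: integrableS (itg_subgaussian_npdf mf sf).
have cfw : {for w, continuous (fun x => f x * npdf x)}.
  apply: cvgM; first exact: cf.
  by apply: continuous_normal_pdf; rewrite oner_eq0.
have [|H1 H2] := continuous_FTC1 w1 If _ cfw; first by rewrite ltNyr.
by split; rewrite // -derive1E H2.
Qed.

Lemma gaussian_small_eq0 (c C a : R) : 0 < a ->
  (forall w, 0 <= w -> `|c| <= C * expR (- (a * w ^+ 2))) -> c = 0.
Proof.
move=> a0 H; apply/eqP; rewrite -normr_eq0; apply/negPn/negP => c0.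
have cp : 0 < `|c| by rewrite lt_neqAle eq_sym c0 normr_ge0.
have C0 : 0 < C.
  by have := H 0 (lexx _); rewrite expr0n mulr0 oppr0 expR0 mulr1; apply: lt_le_trans.
pose y := C / `|c| / a.
have y0 : 0 < y by rewrite !divr_gt0.
have := H (1 + y); rewrite expRN ler_pdivlMr ?expR_gt0 // => /(_ ltac:(lra)).
rewrite leNgt => /negP; apply.
rewrite mulrC -ltr_pdivrMr //.
apply: lt_le_trans (expR_ge1Dx _).
have : C / `|c| = a * y by rewrite /y; field; rewrite !gt_eqF.
move=> ->; have : a * y <= a * (1 + y) ^+ 2; last lra.
by rewrite ler_pM2l // expr2; nra.
Qed.

End GaussianTails.

Section SteinEquation.
Variable R : realType.
Implicit Types f : R -> R.

(** The classical solution: exp (w^2 / 2) times the integral of f (x) exp (- x^2 / 2) over ]-oo, w],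
    [npeak] cancelling the normalization of [npdf]. *)
Definition stein f (w : R) : R := Gprim f w * (npeak^-1 * expR (2^-1 * w ^+ 2)).

Lemma der_stein f (w : R) : continuous f -> subgaussian f ->
  is_derive w 1 (stein f) (w * stein f w + f w).
Proof.
move=> cf sf; have dG := der_Gprim w cf sf.
apply: der_eq (derM dG (derZ _ (der_exp (derZ 2^-1 (derX 2 (der_id w)))))) _.
rewrite /stein npdfE expRN expr1; field.
by rewrite !gt_eqF ?expR_gt0 ?npeak_gt0.
Qed.

(** Centering allows the integral over ]-oo, w] to be traded for minus the right tail when w > 0, so
    that the factor exp (w^2 / 2) always meets a tail of size exp (- (1/2 - e) w^2). *)
Lemma subgaussian_stein f : measurable_fun [set: R] f -> subgaussian f ->
  Ex gamma f = 0 -> subgaussian (stein f).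
Proof.
move=> mf sf Ef0 e e0; pose e' := Num.min e 4^-1.
have e'0 : 0 < e' by rewrite lt_min e0 /=; lra.
have e'4 : e' <= 4^-1 by rewrite ge_min lexx orbT.
have e'e : e' <= e by rewrite ge_min lexx.
have [C C0 HC] := Gprim_left mf sf e'0 e'4.
have [D D0 HD] := Gprim_right mf sf e'0 e'4.
have p0 := @npeak_gt0 R.
exists ((C + D) * npeak^-1) => w.
have H : `|Gprim f w| <= (C + D) * expR (- ((2^-1 - e') * w ^+ 2)).
  rewrite mulrDl; have [w0|w0] := leP w 0.
    by apply: le_trans (HC w w0) _; rewrite lerDl mulr_ge0 ?expR_ge0.
  have := HD w (ltW w0); rewrite Ef0 sub0r normrN => /le_trans; apply.
  by rewrite lerDr mulr_ge0 ?expR_ge0.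
rewrite /stein normrM (ger0_norm (x := _ * expR _)); last first.
  by rewrite mulr_ge0 ?expR_ge0 // invr_ge0 ltW.
apply: le_trans (ler_wpM2r _ H) _; first by rewrite mulr_ge0 ?expR_ge0 // invr_ge0 ltW.
rewrite mulrACA -expRD ler_wpM2l ?mulr_ge0 ?addr_ge0 ?invr_ge0 ?(ltW p0) //.
rewrite ler_expR.
have -> : - ((2^-1 - e') * w ^+ 2) + 2^-1 * w ^+ 2 = e' * w ^+ 2 by ring.
by rewrite ler_wpM2r ?sqr_ge0.
Qed.

(** With f = q' - x q, the functions [Gprim f] and q times the density have the same derivative and
    both vanish at -oo, so they are equal; at +oo one tends to the expectation of f, the other to
    0. *)
Lemma gaussian_ibp (q q1 : R -> R) : (forall x : R, is_derive x 1 q (q1 x)) ->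
  continuous q1 -> subgaussian q -> subgaussian q1 ->
  Ex gamma q1 = Ex gamma (fun x => x * q x).
Proof.
move=> dq cq1 sq sq1.
have cq := der_continuous dq.
pose f (x : R) := q1 x - x * q x.
have cxq : continuous (fun x : R => x * q x).
  by move=> x; apply: cvgM; [exact: cvg_id|exact: cq].
have cf : continuous f by move=> x; apply: cvgB; [exact: cq1|exact: cxq].
have sxq : subgaussian (fun x => x * q x) by apply: subgaussianM (@subgaussian_id R) sq.
have sf : subgaussian f by apply: subgaussianD sq1 (subgaussianN sxq).
have mf := continuous_measurable cf.
apply/eqP; rewrite -subr_eq0 -ExB; first last.
- by apply: itg_gamma => //; exact: continuous_measurable.
- by apply: itg_gamma => //; exact: continuous_measurable.
rewrite -/f; pose K (x : R) := q x * npdf x.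
have e0 : 0 < 4^-1 :> R by lra.
have [C C0 HC] := Gprim_left mf sf e0 (lexx _).
have [D D0 HD] := Gprim_right mf sf e0 (lexx _).
have [B B0 HB] := subgaussian_npdf_le sq e0.
have dGK (x : R) : is_derive x 1 (fun x => Gprim f x - K x) 0.
  apply: der_eq (derB (der_Gprim x cf sf) (derM (dq x) (der_npdf x))) _.
  by rewrite /f; ring.
have GK (x y : R) : x <= y -> Gprim f y - K y = Gprim f x - K x.
  move=> xy; have [c _ E] := der_MVT xy (fun z _ => dGK z).
  by apply/eqP; rewrite -subr_eq0 E mul0r.
have GK0 (x : R) : Gprim f x - K x = 0.
  apply: (@gaussian_small_eq0 _ _ (C + B) 4^-1) => // w w0.
  (* A point to the left of both x and - w, at which the constant difference is evaluated. *)
  have [y yx yw] : exists2 y, y <= x & y = - (w + `|x|).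
    by exists (- (w + `|x|)) => //; have := ler_norm (- x); rewrite normrN; lra.
  have y0 : y <= 0 by rewrite yw; have := normr_ge0 x; lra.
  rewrite (GK y x yx); apply: le_trans (ler_normB _ _) _.
  have wy : expR (- ((2^-1 - 4^-1) * y ^+ 2)) <= expR (- (4^-1 * w ^+ 2)).
    rewrite ler_expR yw sqrrN; have := normr_ge0 x => x0.
    have : w ^+ 2 <= (w + `|x|) ^+ 2 by rewrite lerXn2r ?nnegrE //; lra.
    by lra.
  rewrite mulrDl lerD //.
    by apply: le_trans (HC y y0) _; rewrite ler_wpM2l.
  by apply: le_trans (HB y) _; rewrite ler_wpM2l.
apply/eqP/(@gaussian_small_eq0 _ _ (D + B) 4^-1) => // w w0.
have -> : Ex gamma f = (Ex gamma f - Gprim f w) + K w.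
  by have := GK0 w; lra.
apply: le_trans (ler_normD _ _) _; rewrite mulrDl.
have e4 : 2^-1 - 4^-1 = 4^-1 :> R by lra.
by apply: lerD; [have := HD w w0|have := HB w]; rewrite e4.
Qed.

(** The difference h (x) = f (- x) - f (x) is odd, so [Gprim h] is even; tending to 0 at -oo, it
    tends to 0 at +oo as well. *)
Lemma gaussian_symmetry f : continuous f -> subgaussian f ->
  Ex gamma (fun x => f (- x)) = Ex gamma f.
Proof.
move=> cf sf.
have cN : continuous (fun x : R => f (- x)).
  move=> x; apply: (@continuous_comp _ _ _ (fun x : R => - x) f); last exact: cf.
  exact: opp_continuous.
have sN := subgaussian_reflect sf.
pose h (x : R) := f (- x) - f x.
have ch : continuous h by move=> x; apply: cvgB; [exact: cN|exact: cf].
have sh : subgaussian h by apply: subgaussianD sN (subgaussianN sf).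
have mh := continuous_measurable ch.
apply/eqP; rewrite -subr_eq0 -ExB; first last.
- by apply: itg_gamma => //; exact: continuous_measurable.
- by apply: itg_gamma => //; exact: continuous_measurable.
rewrite -/h.
have e0 : 0 < 4^-1 :> R by lra.
have [C C0 HC] := Gprim_left mh sh e0 (lexx _).
have [D D0 HD] := Gprim_right mh sh e0 (lexx _).
have dH (x : R) : is_derive x 1 (fun x => Gprim h x - Gprim h (- x)) 0.
  apply: der_eq (derB (der_Gprim x ch sh) (der_reflect (der_Gprim (- x) ch sh))) _.
  by rewrite npdf_even /h !opprK; ring.
apply/eqP/(@gaussian_small_eq0 _ _ (D + C) 4^-1) => // w w0.
have GH : Gprim h w = Gprim h (- w).
  have [c _] := der_MVT w0 (fun z _ => dH z).
  rewrite mul0r oppr0; lra.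
have -> : Ex gamma h = (Ex gamma h - Gprim h w) + Gprim h (- w) by rewrite GH; ring.
have e4 : 2^-1 - 4^-1 = 4^-1 :> R by lra.
have w0' : - w <= 0 by lra.
apply: le_trans (ler_normD _ _) _; rewrite mulrDl.
by apply: lerD; [have := HD w w0|have := HC (- w) w0'; rewrite sqrrN]; rewrite e4.
Qed.

End SteinEquation.

(** * Moments and the second derivative bound *)

Section MomentComparison.
Context d (T : measurableType d) (R : realType) (P : probability T R).

(** Bernoulli's inequality twice: for t^a as the power a / b of t^b, then for t^b as the power b / 2
    of t^2. When a variable has second moment 1, the left side has expectation 0, and its moments
    are ordered. *)
Lemma powR_sub_ge (a b t : R) : 0 <= a <= b -> 2 <= b -> 0 <= t ->
  (1 - a / b) * (b / 2) * (t ^+ 2 - 1) <= t `^ b - t `^ a.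
Proof.
move=> /andP[a0 ab] b2 t0; have b0 : 0 < b by lra.
have s01 : 0 <= a / b <= 1 by rewrite divr_ge0 ?(ltW b0) // ler_pdivrMr // mul1r.
have H1 := bernoulli_le s01 (powR_ge0 t b).
rewrite -powRrM mulrCA divff ?gt_eqF // mulr1 in H1.
have b21 : 1 <= b / 2 by lra.
have H2 := bernoulli_ge b21 (sqr_ge0 t).
rewrite -powR_norm_sqr (ger0_norm t0) in H2.
have s1 : 0 <= 1 - a / b by rewrite subr_ge0; case/andP: s01.
have H3 : (1 - a / b) * (b / 2 * (t ^+ 2 - 1)) <= (1 - a / b) * (t `^ b - 1).
  by rewrite ler_wpM2l //; lra.
lra.
Qed.

Lemma itg_norm_powR_le (X : T -> R) (a b : R) : measurable_fun [set: T] X ->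
  0 <= a <= b -> itg P (fun t => `|X t| `^ b) -> itg P (fun t => `|X t| `^ a).
Proof.
move=> mX /andP[a0 ab] Xb.
apply: itg_le (itgD (itg_cst P 1) Xb) => [|t].
  exact: (measurableT_comp (measurable_norm_powR a) mX).
rewrite (ger0_norm (powR_ge0 _ _)) [leRHS]ger0_norm ?addr_ge0 ?powR_ge0 //.
have [X1|X1] := leP 1 `|X t|.
  apply: (@le_trans _ _ (`|X t| `^ b)); first exact: ler_powR.
  by rewrite lerDr.
apply: (@le_trans _ _ 1); last by rewrite lerDl powR_ge0.
have [x0|x0] := eqVneq `|X t| 0.
  rewrite x0; have [->|an] := eqVneq a 0; first by rewrite powRr0.
  by rewrite powR0.
by rewrite -[leRHS](powRr0 `|X t|) ger_powR // normr_gt0 -normr_eq0 x0 ltW.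
Qed.

Lemma moment_le (X : T -> R) (a b : R) : measurable_fun [set: T] X ->
  0 <= a <= b -> 2 <= b -> itg P (fun t => `|X t| `^ b) ->
  Ex P (fun t => X t ^+ 2) = 1 ->
  Ex P (fun t => `|X t| `^ a) <= Ex P (fun t => `|X t| `^ b).
Proof.
move=> mX ab b2 Xb X2.
have Xa := itg_norm_powR_le mX ab Xb.
have X2i : itg P (fun t => X t ^+ 2).
  have H : itg P (fun t => `|X t| `^ 2).
    by apply: (itg_norm_powR_le mX _ Xb); rewrite ler0n b2.
  apply: itg_le H => [|t]; first exact: measurable_funX.
  by rewrite (ger0_norm (powR_ge0 _ _)) powR_mulrn // sqr_normE ger0_norm ?sqr_ge0.
rewrite -subr_ge0 -ExB //; set c := (1 - a / b) * (b / 2).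
have <- : Ex P (fun t => c * (X t ^+ 2 - 1)) = 0.
  rewrite ExZ; last exact: itgB X2i (itg_cst P 1).
  by rewrite ExB ?X2 ?Ex_cst ?subrr ?mulr0 //; exact: itg_cst.
apply: Ex_le.
- exact: itgZ (itgB X2i (itg_cst P 1)).
- exact: itgB.
- by move=> t; have := powR_sub_ge ab b2 (normr_ge0 (X t)); rewrite sqr_normE.
Qed.

End MomentComparison.

(** * Moments of shifted Gaussians and the bound on the second derivative *)

Section GaussianMoments.
Variable R : realType.

Lemma itg_gamma_expn n : itg gamma (fun x : R => x ^+ n).
Proof.
by apply: itg_gamma; [exact: measurable_funX|exact: subgaussian_expn].
Qed.

Lemma itg_gamma_powR (s : R) : 0 <= s -> itg gamma (fun x : R => `|x| `^ s).
Proof.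
by move=> s0; apply: itg_gamma; [exact: measurable_norm_powR|exact: subgaussian_powR].
Qed.

Lemma continuous_expn n : continuous (fun x : R => x ^+ n).
Proof. exact: exprn_continuous. Qed.

Lemma gaussian_moment1 : Ex gamma (fun x : R => x) = 0.
Proof.
have := @gaussian_ibp R (fun=> 1) (fun=> 0) (fun x => der_cst _ x)
  (fun x => cvg_cst _) (subgaussian_cst _) (subgaussian_cst _).
rewrite Ex_cst => ->; congr Ex; apply/funext => x; by rewrite mulr1.
Qed.

Lemma gaussian_moment_rec n :
  Ex gamma (fun x : R => x ^+ n.+2) = n.+1%:R * Ex gamma (fun x : R => x ^+ n).
Proof.
have dq (x : R) : is_derive x 1 (fun y => y ^+ n.+1) (n.+1%:R * x ^+ n).
  by apply: der_eq (derX n.+1 (der_id x)) _; rewrite mulr1.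
have cq1 : continuous (fun x : R => n.+1%:R * x ^+ n).
  by move=> x; apply: cvgM; [exact: cvg_cst|exact: continuous_expn].
have := gaussian_ibp dq cq1 (subgaussian_expn _) (subgaussianZ _ (subgaussian_expn _)).
rewrite ExZ; last exact: itg_gamma_expn.
by move=> ->; congr Ex; apply/funext => x; rewrite -exprS.
Qed.

Lemma gaussian_moment2 : Ex gamma (fun x : R => x ^+ 2) = 1.
Proof. by rewrite gaussian_moment_rec mul1r Ex_cst. Qed.

Lemma gaussian_moment3 : Ex gamma (fun x : R => x ^+ 3) = 0.
Proof.
rewrite gaussian_moment_rec; have -> : (fun x : R => x ^+ 1) = fun x => x.
  by apply/funext => x; rewrite expr1.
by rewrite gaussian_moment1 mulr0.
Qed.

Lemma gaussian_moment4 : Ex gamma (fun x : R => x ^+ 4) = 3.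
Proof. by rewrite gaussian_moment_rec gaussian_moment2 mulr1. Qed.

(** Takes the role of [N] in [supersolution_powR]; Gaussian integration by parts supplies the
    recursion. *)
Definition shifted_moment (r t : R) : R := Ex gamma (fun z => `|t + z| `^ r).

Lemma subgaussian_shift (f : R -> R) (t : R) : subgaussian f ->
  subgaussian (fun z => f (t + z)).
Proof.
move=> sf e e0; have e20 : 0 < e / 2 by rewrite divr_gt0.
have [C HC] := sf _ e20; exists (`|C| * expR (e * t ^+ 2)) => z.
apply: le_trans (HC _) _; rewrite -[leRHS]mulrA -expRD.
apply: (@le_trans _ _ (`|C| * expR (e / 2 * (t + z) ^+ 2))).
  by rewrite ler_wpM2r ?expR_ge0 ?ler_norm.
rewrite ler_wpM2l // ler_expR.
have : e / 2 * (t + z) ^+ 2 <= e / 2 * (2 * (t ^+ 2 + z ^+ 2)).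
  by rewrite ler_pM2l //; have := sqr_ge0 (t - z); nra.
lra.
Qed.

Lemma continuous_shift (f : R -> R) (t : R) : continuous f ->
  continuous (fun z => f (t + z)).
Proof.
move=> cf z; apply: (@continuous_comp _ _ _ (fun z : R => t + z) f); last exact: cf.
by apply: cvgD; [exact: cvg_cst|exact: cvg_id].
Qed.

Lemma itg_gamma_shift (f : R -> R) (t : R) : continuous f -> subgaussian f ->
  itg gamma (fun z => f (t + z)).
Proof.
move=> cf sf; apply: itg_gamma; last exact: subgaussian_shift.
by apply: continuous_measurable; exact: continuous_shift.
Qed.

Lemma shifted_moment_ge0 (r t : R) : 0 <= shifted_moment r t.
Proof. by apply: Ex_ge0 => z; exact: powR_ge0. Qed.

(** |y|^r is bounded below by moments that can be computed: with L = t^2 + 1, x = y^2 / L and s = r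
    / 2 one has 2 x / 3 - x^2 / 9 <= x^s. As E (t + Z)^2 = L and E (t + Z)^4 <= 3 L^2, the
    expectation is at least (2/3 - 1/3) L^s, whence the factor 3. *)
Lemma shifted_moment_small (r t : R) : 0 <= r < 2 ->
  (t ^+ 2 + 1) `^ (r / 2) <= 3 * shifted_moment r t.
Proof.
move=> /andP[r0 r2]; set s := r / 2.
have s01 : 0 <= s <= 1 by rewrite /s; apply/andP; split; lra.
set L := t ^+ 2 + 1; have L0 : 0 < L by rewrite /L; have := sqr_ge0 t; lra.
have Ls0 : 0 <= L `^ s by exact: powR_ge0.
pose c1 := L `^ s * (2 / 3) / L; pose c2 := L `^ s / 9 / L ^+ 2.
have pt y : c1 * y ^+ 2 - c2 * y ^+ 4 <= `|y| `^ r.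
  rewrite powR_norm_sqr -/s.
  pose x := y ^+ 2 / L; have x0 : 0 <= x by rewrite divr_ge0 ?sqr_ge0 // ltW.
  have yx : y ^+ 2 = L * x by rewrite /x mulrCA divff ?mulr1 // gt_eqF.
  rewrite yx (powRM _ (ltW L0) x0).
  have -> : c1 * (L * x) - c2 * y ^+ 4 = L `^ s * (2 / 3 * x - x ^+ 2 / 9).
    rewrite (_ : y ^+ 4 = (L * x) ^+ 2); last by rewrite -yx -exprM.
    by rewrite /c1 /c2; field; rewrite gt_eqF.
  rewrite ler_wpM2l //.
  have [x1|x1] := leP 1 x.
    apply: (@le_trans _ _ 1); first by have := sqr_ge0 (1 - x / 3); lra.
    by rewrite -(powRr0 x); apply: ler_powR => //; case/andP: s01.
  apply: (@le_trans _ _ x); first by have := sqr_ge0 x; nra.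
  have [->|xn0] := eqVneq x 0; first exact: powR_ge0.
  have /andP[_ s1] := s01.
  by rewrite ger1_powR // lt_neqAle eq_sym xn0 x0 ltW.
have i1 : itg gamma (fun z : R => (t + z) ^+ 2).
  by apply: (@itg_gamma_shift (fun y => y ^+ 2)); [exact: continuous_expn|exact: subgaussian_expn].
have i2 : itg gamma (fun z : R => (t + z) ^+ 4).
  by apply: (@itg_gamma_shift (fun y => y ^+ 4)); [exact: continuous_expn|exact: subgaussian_expn].
have E1 : Ex gamma (fun z : R => (t + z) ^+ 2) = L.
  rewrite (_ : (fun z => _) = fun z => t ^+ 2 + 2 * t * z + z ^+ 2); last first.
    by apply/funext => z; ring.
  have j1 := @itgZ _ _ _ gamma (2 * t) (fun z : R => z) (itg_gamma_expn 1).
  have j2 := itgD (itg_cst gamma (t ^+ 2)) j1.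
  rewrite (ExD j2 (itg_gamma_expn 2)) (ExD (itg_cst _ _) j1) Ex_cst.
  by rewrite (ExZ _ (itg_gamma_expn 1)) gaussian_moment1 gaussian_moment2 /L; ring.
have E2 : Ex gamma (fun z : R => (t + z) ^+ 4) = t ^+ 4 + 6 * t ^+ 2 + 3.
  rewrite (_ : (fun z => _) = fun z => t ^+ 4 + 4 * t ^+ 3 * z +
     6 * t ^+ 2 * z ^+ 2 + 4 * t * z ^+ 3 + z ^+ 4); last first.
    by apply/funext => z; ring.
  have j1 := @itgZ _ _ _ gamma (4 * t ^+ 3) (fun z : R => z) (itg_gamma_expn 1).
  have j2 := itgZ (6 * t ^+ 2) (itg_gamma_expn 2).
  have j3 := itgZ (4 * t) (itg_gamma_expn 3).
  have k1 := itgD (itg_cst gamma (t ^+ 4)) j1.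
  have k2 := itgD k1 j2.
  have k3 := itgD k2 j3.
  rewrite (ExD k3 (itg_gamma_expn 4)) (ExD k2 j3) (ExD k1 j2) (ExD (itg_cst _ _) j1).
  rewrite Ex_cst (ExZ _ (itg_gamma_expn 1)) (ExZ _ (itg_gamma_expn 2)).
  rewrite (ExZ _ (itg_gamma_expn 3)) gaussian_moment1 gaussian_moment2.
  by rewrite gaussian_moment3 gaussian_moment4; ring.
have : c1 * L - c2 * (t ^+ 4 + 6 * t ^+ 2 + 3) <= shifted_moment r t.
  rewrite -E1 -E2 -(ExZ _ i1) -(ExZ _ i2) -(ExB (itgZ _ i1) (itgZ _ i2)).
  apply: Ex_le => //; first exact: itgB (itgZ _ i1) (itgZ _ i2).
  apply: (@itg_gamma_shift (fun y => `|y| `^ r)); first exact: continuous_norm_powR.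
  exact: subgaussian_powR.
have -> : c1 * L = 2 / 3 * L `^ s by rewrite /c1; field; rewrite gt_eqF.
have c20 : 0 <= c2 by rewrite !divr_ge0 // exprn_ge0 // ltW.
have : c2 * (t ^+ 4 + 6 * t ^+ 2 + 3) <= c2 * (3 * L ^+ 2).
  by rewrite ler_wpM2l // /L; have := sqr_ge0 (t ^+ 2); nra.
have -> : c2 * (3 * L ^+ 2) = L `^ s / 3 by rewrite /c2; field; rewrite gt_eqF.
lra.
Qed.

(** Both sides are even in t and in z. For 0 <= z <= t this is convexity of the power s + 1, for z >
    t >= 0 its superadditivity, since t + z = 2 t + (z - t). *)
Lemma spow_symmetrized (s t z : R) : 0 <= s ->
  2 * `|t| `^ (s + 2) <= t * (spow s (t + z) + spow s (t - z)).
Proof.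
move=> s0.
have spowN x : spow s (- x) = - spow s x by rewrite /spow normrN mulNr.
wlog t0 : t / 0 <= t => [H|].
  have [/H //|/ltW t0] := leP 0 t.
  have := H (- t); rewrite normrN oppr_ge0 => /(_ t0) /le_trans; apply.
  have -> : - t + z = - (t - z) by ring.
  have -> : - t - z = - (t + z) by ring.
  rewrite !spowN.
  by rewrite le_eqVlt; apply/orP; left; apply/eqP; ring.
wlog z0 : z / 0 <= z => [H|].
  have [/H //|/ltW z0] := leP 0 z.
  have := H (- z); rewrite oppr_ge0 => /(_ z0) /le_trans; apply.
  by rewrite opprK addrC.
have -> : 2 * `|t| `^ (s + 2) = t * (2 * t `^ (s + 1)).
  rewrite powR_norm2D // (ger0_norm t0) mulrA expr2.
  have := @mulr_powRB1 R t (s + 1) t0 ltac:(lra); rewrite addrK => <-; ring.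
rewrite ler_wpM2l //.
have spowE x : 0 <= x -> spow s x = x `^ (s + 1).
  by move=> x0; rewrite /spow ger0_norm // -[RHS]mulr_powRB1 ?addrK //; lra.
have s11 : 1 <= s + 1 by lra.
have pow2S : 2 `^ (s + 1) = 2 * 2 `^ s :> R.
  by rewrite -[LHS]mulr_powRB1 ?addrK //; lra.
have [zt|tz] := leP z t.
  have tz0 : 0 <= t + z by lra.
  have tz1 : 0 <= t - z by lra.
  rewrite !spowE //.
  have := powRD_convex s11 tz0 tz1; have -> : t + z + (t - z) = 2 * t by ring.
  rewrite powR_double // addrK pow2S => H.
  have p : 0 < 2 `^ s :> R by rewrite powR_gt0.
  by rewrite -(ler_pM2l p); apply: le_trans H; rewrite mulrCA mulrA.
have zt0 : 0 <= z - t by lra.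
have tz0 : 0 <= t + z by lra.
rewrite -(opprB z t) spowN !spowE // lerBrDr.
have t20 : 0 <= 2 * t by lra.
have := powR_superadd s11 t20 zt0; have -> : 2 * t + (z - t) = t + z by ring.
apply: le_trans; rewrite lerD2r powR_double //.
rewrite pow2S -mulrA ler_pM2l // ler_peMl ?powR_ge0 //.
by rewrite -[leLHS](powRr0 2); apply: ler_powR => //; lra.
Qed.

(** Write |t + Z|^r as (t + Z) q (Z) with a signed power q. Integration by parts turns E Z q (Z)
    into (r - 1) E|t + Z|^(r - 2), and symmetrizing t E q (Z) in Z leaves at least |t|^r. *)
Lemma shifted_moment_step (r t : R) : 2 <= r ->
  `|t| `^ r + (r - 1) * shifted_moment (r - 2) t <= shifted_moment r t.
Proof.
move=> r2; have s0 : 0 <= r - 2 by lra.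
set s := r - 2 in s0 *; have rs : r = s + 2 by rewrite /s; ring.
have cs : continuous (@spow R s) by exact: der_continuous (fun x => der_spow x s0).
have ss : subgaussian (@spow R s) := subgaussian_spow s0.
pose q z := spow s (t + z).
have cq : continuous q by exact: continuous_shift.
have sq : subgaussian q by exact: subgaussian_shift.
have dq (z : R) : is_derive z 1 q ((s + 1) * `|t + z| `^ s).
  apply: der_eq (der_comp (der_spow (t + z) s0) (derD (der_cst t z) (der_id z))) _.
  by rewrite add0r mulr1.
have cp : continuous (fun z : R => `|t + z| `^ s).
  exact: continuous_shift (continuous_norm_powR s0).
have sp : subgaussian (fun z : R => `|t + z| `^ s).
  exact: (subgaussian_shift (f := fun y => `|y| `^ s)) (subgaussian_powR s0).
have cq1 : continuous (fun z : R => (s + 1) * `|t + z| `^ s).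
  by move=> x; apply: cvgM; [exact: cvg_cst|exact: cp].
have := gaussian_ibp dq cq1 sq (subgaussianZ _ sp).
rewrite ExZ; last by apply: itg_gamma sp; exact: continuous_measurable.
have -> : r - 1 = s + 1 by rewrite rs; ring.
rewrite -/(shifted_moment s t) => ->.
have iq : itg gamma q by apply: itg_gamma sq; exact: continuous_measurable.
have iqN : itg gamma (fun z => q (- z)).
  apply: itg_gamma; last exact: subgaussian_reflect.
  apply: continuous_measurable => x.
  apply: (@continuous_comp _ _ _ (fun x : R => - x) q); last exact: cq.
  exact: opp_continuous.
have izq : itg gamma (fun z => z * q z).
  apply: itg_gamma; last exact: subgaussianM (@subgaussian_id R) sq.
  by apply: measurable_funM => //; exact: continuous_measurable.
have Nr : shifted_moment r t = t * Ex gamma q + Ex gamma (fun z => z * q z).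
  rewrite -ExZ // -ExD //; last exact: itgZ.
  congr Ex; apply/funext => z; rewrite /q /spow rs powR_norm2D //; ring.
rewrite Nr lerD2r.
have : Ex gamma (fun=> 2 * `|t| `^ r) <= Ex gamma (fun z => t * (q z + q (- z))).
  apply: Ex_le; [exact: itg_cst|exact: itgZ (itgD iq iqN)|] => z.
  by rewrite rs; exact: spow_symmetrized.
rewrite Ex_cst ExZ ?ExD //; last exact: itgD.
rewrite (gaussian_symmetry cq sq); lra.
Qed.

Lemma shifted_moment_le (r t : R) : 1 <= r ->
  shifted_moment r t <=
  2 `^ (r - 1) * (`|t| `^ r + Ex gamma (fun z : R => `|z| `^ r)).
Proof.
move=> r1; have r0 : 0 <= r by lra.
have i := itg_gamma_powR r0.
rewrite -[X in _ * (X + _)](Ex_cst gamma) -ExD ?itg_cst // -ExZ; last first.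
  exact: itgD (itg_cst _ _) i.
apply: Ex_le.
- apply: (@itg_gamma_shift (fun y => `|y| `^ r)); first exact: continuous_norm_powR.
  exact: subgaussian_powR.
- exact: itgZ (itgD (itg_cst _ _) i).
- move=> z; apply: le_trans (powRD_convex r1 (normr_ge0 _) (normr_ge0 _)).
  by apply: ge0_ler_powR; rewrite ?nnegrE ?addr_ge0 // ler_normD.
Qed.

(** The smaller value for r < 1 pays for the cruder comparison of E|W - X_i / sqrt n|^r with E|W|^r
    in [partial_sum_moment_le]. *)
Definition stein_coef (r : R) : R := if 1 <= r then 2 `^ (r + 2) else 2 `^ (r + 1).

Lemma stein_coef_ge0 r : 0 <= stein_coef r.
Proof. by rewrite /stein_coef; case: ifP => _; exact: powR_ge0. Qed.

(** The subtracted |w|^r leaves room for u^(m), which is added when w F' + m F is replaced by F''.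
    The moment of order r + 1 absorbs E|Z|^r for r >= 1 and an additive constant for r < 1. *)
Lemma supersolution_gaussian (m w r : R) : 1 <= m -> 0 <= r ->
  supersolution m (fun x => `|x| `^ r) w
    (stein_coef r * `|w| `^ r +
     2 `^ (r + 2) * Ex gamma (fun z : R => `|z| `^ (r + 1)) - `|w| `^ r).
Proof.
move=> m1 r0; have w0 := powR_ge0 `|w| r; rewrite /stein_coef.
set K := Ex gamma (fun z : R => `|z| `^ (r + 1)).
have pow2 : 1 <= 2 `^ r :> R by rewrite -[leLHS](powRr0 2); apply: ler_powR => //; lra.
have pow2S (x : R) : 0 < x + 1 -> 2 `^ (x + 1) = 2 * 2 `^ x :> R.
  by move=> x1; rewrite -[LHS]mulr_powRB1 ?addrK //; lra.
have pow2SS : 2 `^ (r + 2) = 4 * 2 `^ r :> R.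
  have -> : r + 2 = r + 1 + 1 by ring.
  by rewrite !pow2S; [ring|lra|lra].
rewrite pow2SS pow2S; last lra.
have small (x t : R) : 0 <= x < 2 -> (t ^+ 2 + 2 / 3) `^ (x / 2) <= (t ^+ 2 + 1) `^ (x / 2).
  move=> /andP[x0 x2]; have t0 := sqr_ge0 t.
  by apply: ge0_ler_powR; rewrite ?nnegrE; lra.
have [r1|r1] := leP 1 r.
  have D : supersolution m (fun x => `|x| `^ r) w (3 * shifted_moment r w).
    apply: supersolution_powR => //; first by lra.
    - by move=> x t; exact: shifted_moment_ge0.
    - by move=> x t x2; apply: le_trans (small x t x2) (shifted_moment_small _ _).
    - by move=> x t x2; exact: shifted_moment_step.
  apply: supersolution_le D => //.
  have H := shifted_moment_le w r1.
  have e1 : Ex gamma (fun z : R => `|z| `^ r) <= K.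
    apply: (@moment_le _ _ _ gamma (fun z : R => z)); try lra.
    - by [].
    - by apply: itg_gamma_powR; lra.
    - exact: gaussian_moment2.
  have e2 : 2 `^ (r - 1) = 2 `^ r / 2 :> R.
    by have := pow2S (r - 1); rewrite subrK => ->; [field|lra].
  rewrite e2 in H; set p := 2 `^ r in pow2 H *.
  have p1 : p * Ex gamma (fun z : R => `|z| `^ r) <= p * K by rewrite ler_wpM2l //; lra.
  have p2 : `|w| `^ r <= p * `|w| `^ r by rewrite ler_peMl.
  have K1 : 0 <= K by apply: Ex_ge0 => z; exact: powR_ge0.
  have K0 : 0 <= p * K by apply: mulr_ge0 => //; lra.
  lra.
have r02 : 0 <= r < 2 by rewrite r0 /=; lra.
apply: supersolution_le (supersolution_powR_small m1 w r02) => //.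
have s01 : 0 <= r / 2 <= 1 by apply/andP; split; lra.
have e3 : 0 <= (2 / 3 : R) by lra.
have H1 := powRD_concave s01 (sqr_ge0 w) e3.
rewrite -powR_norm_sqr in H1.
have H2 : (2 / 3 : R) `^ (r / 2) <= 1.
  rewrite -[leRHS](powRr0 (2 / 3)); apply: ger_powR; last by case/andP: s01.
  by apply/andP; split; lra.
have H3 : 1 <= 3 * K.
  have r12 : 0 <= r + 1 < 2 by apply/andP; split; lra.
  have := shifted_moment_small 0 r12; rewrite expr0n /= add0r powR1 /shifted_moment.
  by under [in X in Ex _ X]eq_fun do rewrite add0r.
have p2 : 2 * `|w| `^ r <= 2 * 2 `^ r * `|w| `^ r.
  by rewrite -mulrA ler_pM2l // ler_peMl.
have p3 : K <= 2 `^ r * K by rewrite ler_peMl //; lra.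
lra.
Qed.

Lemma second_derivative_bound (m A B r : R) (F F1 F2 : R -> R) :
  1 <= m -> 0 <= A -> 0 <= B -> 0 <= r ->
  (forall x : R, is_derive x 1 F (F1 x)) -> (forall x : R, is_derive x 1 F1 (F2 x)) ->
  subgaussian F -> subgaussian F1 ->
  (forall x, `|F2 x - x * F1 x - m * F x| <= A + B * `|x| `^ r) ->
  forall w, `|F2 w| <= 2 * A + B * (stein_coef r * `|w| `^ r +
     2 `^ (r + 2) * Ex gamma (fun z : R => `|z| `^ (r + 1))).
Proof.
move=> m1 A0 B0 r0 dF dF1 sF sF1 H w.
have [S [S1 [S2 [[d1 d2] [s1 s2] HS HSw]]]] :=
  supersolutionD (supersolutionZ A0 (supersolution_cst m1 w))
    (supersolutionZ B0 (supersolution_gaussian w m1 r0)).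
have D : `|w * F1 w + m * F w| <= w * S1 w + m * S w.
  apply: (@comparison _ m m1 F F1 F2 S S1 S2) => // x.
  by apply: le_trans (H x) _; have := HS x; rewrite mulr1.
have -> : F2 w = (w * F1 w + m * F w) + (F2 w - w * F1 w - m * F w) by ring.
apply: le_trans (ler_normD _ _) _; have := H w; lra.
Qed.

End GaussianMoments.

(** * Taylor expansion and derivatives of the Stein solution *)

Section Taylor.
Variable R : realType.

(** The derivative of the remainder is the remainder of the preceding order for f'; by induction it
    is dominated by the derivative of M t^(p + 1) / (p + 1)!. *)
Lemma taylor_bound_pos p (f : nat -> R -> R) (y x M : R) : 0 <= x ->
  (forall k, (k < p)%N -> forall z : R, is_derive z 1 (f k) (f k.+1 z)) ->
  (forall z, y <= z <= y + x -> `|f p z| <= M) ->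
  `|f 0%N (y + x) - \sum_(k < p) f k y * x ^+ k / k`!%:R| <= M * x ^+ p / p`!%:R.
Proof.
elim: p f x => [|p IH] f x x0 df fM.
  by rewrite big_ord0 subr0 expr0 fact0 mulr1 divr1; apply: fM; rewrite lerDl x0 lexx.
pose S (g : nat -> R -> R) n t := \sum_(k < n) g k y * t ^+ k / k`!%:R.
pose f' k := f k.+1.
have dS (t : R) : is_derive t 1 (S f p.+1) (S f' p t).
  have -> : S f p.+1 = fun t => f 0%N y + \sum_(k < p) f k.+1 y / k.+1`!%:R * t ^+ k.+1.
    apply/funext => s; rewrite /S big_ord_recl expr0 fact0 mulr1 divr1; congr (_ + _).
    by apply: eq_bigr => k _; rewrite mulrAC.
  apply: der_eq (derD (der_cst _ _) (_ : is_derive _ _ _ (S f' p t))) (add0r _).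
  rewrite /S /f'; elim: (p) => [|q IHq].
    rewrite big_ord0 (_ : (fun _ => _) = fun=> 0); first exact: der_cst.
    by apply/funext => s; rewrite big_ord0.
  rewrite big_ord_recr /= (_ : (fun _ => _) = fun s =>
    \sum_(k < q) f k.+1 y / k.+1`!%:R * s ^+ k.+1 + f q.+1 y / q.+1`!%:R * s ^+ q.+1).
    apply: derD => //; apply: der_eq (derZ _ (derX q.+1 (der_id t))) _.
    rewrite factS natrM /=; field.
    by rewrite nat1r !pnatr_eq0 -lt0n fact_gt0.
  by apply/funext => s; rewrite big_ord_recr.
have S0 : S f p.+1 0 = f 0%N y.
  rewrite /S big_ord_recl expr0 fact0 mulr1 divr1 big1 ?addr0 // => k _.
  by rewrite expr0n /= mulr0 mul0r.
pose G t := f 0%N (y + t) - S f p.+1 t.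
pose G1 t := f 1%N (y + t) - S f' p t.
have dG (t : R) : is_derive t 1 G (G1 t).
  apply: derB => //.
  apply: der_eq (der_comp (df 0%N isT (y + t)) (derD (der_cst y t) (der_id t))) _.
  by rewrite add0r mulr1.
have G1M t : 0 <= t <= x -> `|G1 t| <= M * t ^+ p / p`!%:R.
  move=> /andP[t0 tx]; apply: (IH f') => //.
    by move=> k kp z; apply: df.
  by move=> z /andP[yz zt]; apply: fM; rewrite yz /=; lra.
pose E (t : R) : R := M / p.+1`!%:R * t ^+ p.+1.
have dE (t : R) : is_derive t 1 E (M * t ^+ p / p`!%:R).
  apply: der_eq (derZ _ (derX p.+1 (der_id t))) _.
  by rewrite factS natrM /=; field; rewrite nat1r !pnatr_eq0 -lt0n fact_gt0.
have E0 : E 0 = 0 by rewrite /E expr0n mulr0.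
have G0 : G 0 = 0 by rewrite /G addr0 S0 subrr.
rewrite -/(S f p.+1 x) -/(G x).
have -> : M * x ^+ p.+1 / p.+1`!%:R = E x by rewrite /E mulrAC.
rewrite ler_norml; apply/andP; split.
  have : E 0 + G 0 <= E x + G x.
    apply: (der_ge0_le (f := fun t => E t + G t) x0 (fun t _ => derD (dE t) (dG t))).
    by move=> t tx; have := G1M t tx; rewrite ler_norml => /andP[H1 _]; lra.
  lra.
have : E 0 - G 0 <= E x - G x.
  apply: (der_ge0_le (f := fun t => E t - G t) x0 (fun t _ => derB (dE t) (dG t))).
  by move=> t tx; have := G1M t tx; rewrite ler_norml => /andP[_ H1]; lra.
lra.
Qed.

Lemma taylor_bound p (f : nat -> R -> R) (y x M : R) :
  (forall k, (k < p)%N -> forall z : R, is_derive z 1 (f k) (f k.+1 z)) ->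
  (forall z, `|z - y| <= `|x| -> `|f p z| <= M) ->
  `|f 0%N (y + x) - \sum_(k < p) f k y * x ^+ k / k`!%:R| <= M * `|x| ^+ p / p`!%:R.
Proof.
move=> df fM; have [x0|x0] := leP 0 x.
  rewrite (ger0_norm x0); apply: taylor_bound_pos => // z /andP[yz zx].
  by apply: fM; rewrite !ger0_norm ?subr_ge0 //; lra.
pose g k z := (-1) ^+ k * f k (- z).
have nx0 : 0 <= - x by lra.
have dg k : (k < p)%N -> forall z : R, is_derive z 1 (g k) (g k.+1 z).
  move=> kp z; apply: der_eq (derZ _ (der_reflect (df k kp _))) _.
  by rewrite /g exprS; ring.
have gM z : - y <= z <= - y + - x -> `|g p z| <= M.
  move=> /andP[z1 z2]; rewrite /g normrM normrX normrN1 expr1n mul1r; apply: fM.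
  by rewrite (ltr0_norm x0) ler_norml; apply/andP; split; lra.
have := taylor_bound_pos nx0 dg gM; rewrite (ltr0_norm x0).
have -> : g 0%N (- y + - x) = f 0%N (y + x) by rewrite /g expr0 mul1r -opprD opprK.
rewrite (_ : \sum_(k < p) g k (- y) * (- x) ^+ k / k`!%:R =
             \sum_(k < p) f k y * x ^+ k / k`!%:R) //.
apply: eq_bigr => k _; rewrite /g opprK; congr (_ / _).
by rewrite mulrC mulrA -exprMn mulrN1 opprK mulrC.
Qed.

End Taylor.

Section Growth.
Variable R : realType.

(** Under the law of W only moments up to a fixed order are assumed finite, so subgaussian growth is
    too weak there. The base 1 + |x| makes the weights increase with [s]. *)
Definition growth (s : R) (f : R -> R) :=
  exists C, forall x, `|f x| <= C * (1 + `|x|) `^ s.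

Lemma growth_primitive s (f f1 : R -> R) : 0 <= s ->
  (forall x : R, is_derive x 1 f (f1 x)) -> growth s f1 -> growth (s + 1) f.
Proof.
move=> s0 df [C HC]; exists (`|f 0| + `|C|) => x.
have x1 : 1 <= 1 + `|x| by rewrite lerDl.
have p1 : 1 <= (1 + `|x|) `^ (s + 1).
  by rewrite -[leLHS](powRr0 (1 + `|x|)); apply: ler_powR => //; lra.
have p0 : 0 <= (1 + `|x|) `^ s by exact: powR_ge0.
have pS : (1 + `|x|) `^ (s + 1) = (1 + `|x|) * (1 + `|x|) `^ s.
  by rewrite -[LHS]mulr_powRB1 ?addrK //; lra.
have bnd (z : R) : `|z - 0| <= `|x| -> `|f1 z| <= `|C| * (1 + `|x|) `^ s.
  rewrite subr0 => zx; apply: le_trans (HC z) _.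
  apply: (@le_trans _ _ (`|C| * (1 + `|z|) `^ s)).
    by rewrite ler_wpM2r ?powR_ge0 ?ler_norm.
  rewrite ler_wpM2l //; apply: ge0_ler_powR => //; rewrite ?nnegrE ?addr_ge0 //.
  by rewrite lerD2l.
have := @taylor_bound R 1 (fun k => if k is 0%N then f else f1) 0 x _ _ bnd.
rewrite big_ord_recl big_ord0 /= add0r expr0 expr1 fact0 !divr1 mulr1 addr0 => H.
have {}H : `|f x - f 0| <= `|C| * (1 + `|x|) `^ s * `|x|.
  by apply: H => k; rewrite ltnS leqn0 => /eqP -> z.
rewrite mulrDl -(subrK (f 0) (f x)) addrC; apply: le_trans (ler_normD _ _) _.
apply: lerD; first by rewrite ler_peMr.
apply: le_trans H _; rewrite pS mulrA mulrAC ler_wpM2r // ler_wpM2l //.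
by rewrite lerDr.
Qed.

End Growth.

Section SteinSolution.
Variables (R : realType) (m : nat) (u : nat -> R -> R) (A B r : R).
Hypothesis m1 : (1 <= m)%N.
Hypothesis du : forall k, (k < m)%N -> forall x : R, is_derive x 1 (u k) (u k.+1 x).
Hypotheses (A0 : 0 <= A) (B0 : 0 <= B) (r0 : 0 <= r).
Hypothesis um : forall x, `|u m x| <= A + B * `|x| `^ r.

(** The Leibniz rule applied to phi' = x phi + u - E u (Z), that is phi^(k+1) = x phi^(k) + k
    phi^(k-1) + u^(k) for k >= 1. The formula reaches order m + 1, one more than the number of
    derivatives of u. *)
Fixpoint stein_deriv (k : nat) : R -> R :=
  match k with
  | 0 => stein (fun x => u 0%N x - Ex gamma (u 0%N))
  | 1 => fun x => x * stein (fun x => u 0%N x - Ex gamma (u 0%N)) x +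
                  (u 0%N x - Ex gamma (u 0%N))
  | (k'.+1 as k1).+1 => fun x => x * stein_deriv k1 x + k1%:R * stein_deriv k' x + u k1 x
  end.

Lemma subgaussian_u k : (k <= m)%N -> subgaussian (u k).
Proof.
move=> km; rewrite -(subKn km); elim: (m - k)%N (leq_subr k m) => [|j IH] jm.
  rewrite subn0; have sP : subgaussian (fun x : R => A + B * `|x| `^ r).
    by apply: subgaussianD; [exact: subgaussian_cst|apply: subgaussianZ; exact: subgaussian_powR].
  apply: subgaussian_le sP => x; apply: le_trans (um x) _; exact: ler_norm.
have lt : (m - j.+1 < m)%N by rewrite ltn_subrL m1.
apply: (subgaussian_primitive (du lt)); rewrite subnSK //; apply: IH; exact: ltnW.
Qed.

Lemma continuous_u0 : continuous (u 0%N).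
Proof. exact: der_continuous (du m1). Qed.

Lemma centered_u : [/\ continuous (fun x => u 0%N x - Ex gamma (u 0%N)),
  subgaussian (fun x => u 0%N x - Ex gamma (u 0%N)) &
  Ex gamma (fun x => u 0%N x - Ex gamma (u 0%N)) = 0].
Proof.
have cu := continuous_u0; have su := subgaussian_u (leq0n m).
split.
- by move=> x; apply: cvgB; [exact: cu|exact: cvg_cst].
- by apply: subgaussianD su (subgaussian_cst _).
- rewrite ExB ?Ex_cst ?subrr //; last exact: itg_cst.
  by apply: itg_gamma su; exact: continuous_measurable.
Qed.

Lemma der_stein_deriv k : (k <= m)%N -> forall x : R,
  is_derive x 1 (stein_deriv k) (stein_deriv k.+1 x).
Proof.
have [cu su _] := centered_u.
have d0 (x : R) : is_derive x 1 (stein_deriv 0) (stein_deriv 1 x) by exact: der_stein.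
have d1 (x : R) : is_derive x 1 (stein_deriv 1) (stein_deriv 2 x).
  apply: der_eq (derD (derM (der_id x) (d0 x)) (derB (du m1 x) (der_cst _ x))) _.
  by rewrite /=; ring.
suff H : (k <= m)%N -> (forall x : R, is_derive x 1 (stein_deriv k) (stein_deriv k.+1 x)) /\
   ((k < m)%N -> forall x : R, is_derive x 1 (stein_deriv k.+1) (stein_deriv k.+2 x)).
  by move=> /H[].
elim: k => [|k IH] km; first by split.
have [IH1 IH2] := IH (ltnW km); split; first exact: IH2.
move=> k1m x.
apply: der_eq (derD (derD (derM (der_id x) (IH2 km x)) (derZ k.+1%:R (IH1 x))) (du k1m x)) _.
rewrite -[stein_deriv k.+3 x]/(x * stein_deriv k.+2 x + k.+2%:R * stein_deriv k.+1 x + u k.+2 x).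
by rewrite -(natr1 k.+1); ring.
Qed.

Lemma subgaussian_stein_deriv k : (k <= m)%N -> subgaussian (stein_deriv k).
Proof.
have [cu su Eu] := centered_u.
have s0 : subgaussian (stein_deriv 0).
  by apply: subgaussian_stein => //; exact: continuous_measurable.
have s1 : subgaussian (stein_deriv 1).
  by apply: subgaussianD su; apply: subgaussianM s0; exact: subgaussian_id.
suff H : (k <= m)%N -> subgaussian (stein_deriv k) /\ subgaussian (stein_deriv k.+1).
  by move=> /H[].
elim: k => [|k IH] km; first by split.
have [IH1 IH2] := IH (ltnW km); split=> //.
apply: subgaussianD (subgaussian_u km); apply: subgaussianD (subgaussianZ _ IH1).
by apply: subgaussianM IH2; exact: subgaussian_id.
Qed.

Lemma stein_deriv_bound x : `|stein_deriv m.+1 x| <=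
  2 * A + B * (stein_coef r * `|x| `^ r +
               2 `^ (r + 2) * Ex gamma (fun z : R => `|z| `^ (r + 1))).
Proof.
case: m m1 um (@der_stein_deriv) (@subgaussian_stein_deriv) => // k _ uk dS sS.
apply: (@second_derivative_bound R k.+1%:R A B r (stein_deriv k) (stein_deriv k.+1)) => //.
- by rewrite ler1n.
- exact: dS (leqnSn k).
- exact: dS (leqnn _).
- exact: sS (leqnSn k).
- exact: sS (leqnn _).
- move=> z; rewrite /=.
  by rewrite (_ : _ - _ - _ = u k.+1 z) //; ring.
Qed.

(** The bound at order m + 1 is integrated downwards, each primitive raising the exponent by 1. *)
Lemma growth_stein_deriv k : (k <= m.+1)%N -> growth (r + (m.+1 - k)%:R) (stein_deriv k).
Proof.
move=> km; rewrite -{2}(subKn km).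
elim: (m.+1 - k)%N (leq_subr k m.+1) => [|j IH] jm.
  rewrite subn0 addr0; set D := 2 `^ (r + 2) * Ex gamma (fun z : R => `|z| `^ (r + 1)).
  have D0 : 0 <= D.
    by rewrite mulr_ge0 ?powR_ge0 //; apply: Ex_ge0 => z; exact: powR_ge0.
  exists (2 * A + B * (stein_coef r + D)) => x; apply: le_trans (stein_deriv_bound x) _.
  have p1 : 1 <= (1 + `|x|) `^ r.
    by rewrite -[leLHS](powRr0 (1 + `|x|)); apply: ler_powR => //; rewrite lerDl.
  have p2 : `|x| `^ r <= (1 + `|x|) `^ r.
    by apply: ge0_ler_powR; rewrite ?nnegrE ?addr_ge0 // lerDr.
  rewrite -/D; set c := stein_coef r.
  have q1 : A <= A * (1 + `|x|) `^ r by rewrite ler_peMr.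
  have q2 : c * `|x| `^ r <= c * (1 + `|x|) `^ r by rewrite ler_wpM2l // stein_coef_ge0.
  have q3 : D <= D * (1 + `|x|) `^ r by rewrite ler_peMr.
  have q4 : B * (c * `|x| `^ r + D) <= B * (c * (1 + `|x|) `^ r + D * (1 + `|x|) `^ r).
    by rewrite ler_wpM2l // lerD.
  lra.
rewrite -natr1 addrA; apply: (@growth_primitive R _ _ (stein_deriv (m.+1 - j))).
- by rewrite addr_ge0.
- move=> x; have := @der_stein_deriv (m.+1 - j.+1); rewrite subnSK //; apply.
  by rewrite subSS leq_subr.
- exact: IH (ltnW jm).
Qed.

End SteinSolution.

(** * Independence *)

Section Independence.
Context d (T : measurableType d) (R : realType) (P : probability T R).

Definition indep (Y Z : T -> R) := forall A B : set R, measurable A -> measurable B ->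
  P (Y @^-1` A `&` Z @^-1` B) = (P (Y @^-1` A) * P (Z @^-1` B))%E.

Lemma indep_comp (Y Z : T -> R) (f q : R -> R) : indep Y Z ->
  measurable_fun [set: R] f -> measurable_fun [set: R] q ->
  indep (f \o Y) (q \o Z).
Proof.
move=> YZ mf mq A B mA mB.
have mfA : measurable (f @^-1` A) by rewrite -[X in measurable X]setTI; exact: mf.
have mqB : measurable (q @^-1` B) by rewrite -[X in measurable X]setTI; exact: mq.
exact: YZ mfA mqB.
Qed.

(** On rectangles the law of (Y, Z) is the product of the two laws, hence it is the product measure;
    Tonelli gives integrability and Fubini the value. *)
Lemma indep_prod (Y Z : T -> R) : indep Y Z -> itg P Y -> itg P Z ->
  itg P (fun t => Y t * Z t) /\ Ex P (fun t => Y t * Z t) = Ex P Y * Ex P Z.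
Proof.
move=> YZ iY iZ.
have mY := itg_measurable iY; have mZ := itg_measurable iZ.
pose Ym : {mfun T >-> R} := mfun_Sub (mem_set mY).
pose Zm : {mfun T >-> R} := mfun_Sub (mem_set mZ).
have mYZ : measurable_fun [set: T]
    ((fun t => (Y t, Z t)) : T -> R * R).
  exact: measurable_fun_pair.
pose W : {mfun T >-> (R * R)%type} :=
  mfun_Sub (mem_set mYZ).
pose m1 := distribution P Ym; pose m2 := distribution P Zm; pose m' := distribution P W.
have mE : forall X, measurable X -> (m1 \x m2)%E X = m' X.
  by apply: product_measure_unique => A B mA mB; exact: YZ.
have mp : measurable_fun [set: R * R]
    (fun z : R * R => z.1 * z.2 : R).
  by apply: measurable_funM; [exact: measurable_fst|exact: measurable_snd].
have I1 : m1.-integrable [set: R] (fun y => y%:E).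
  apply/integrableP; split; first exact/measurable_EFinP.
  rewrite ge0_integral_distribution //; last exact/measurableT_comp/measurable_EFinP.
  by have /integrableP[] := iY.
have I2 : m2.-integrable [set: R] (fun y => y%:E).
  apply/integrableP; split; first exact/measurable_EFinP.
  rewrite ge0_integral_distribution //; last exact/measurableT_comp/measurable_EFinP.
  by have /integrableP[] := iZ.
have iabs (m : probability R R) : m.-integrable [set: R] (fun y => y%:E) ->
    (\int[m]_y `|y|%:E)%E \is a fin_num.
  move=> Im; rewrite ge0_fin_numE; last by apply: integral_ge0 => y _; rewrite lee_fin.
  by have /integrableP[_] := Im.
have mabs : measurable_fun [set: R] (fun y : R => `|y|%:E).
  by apply/measurable_EFinP; exact: normr_measurable.
have Ip : (m1 \x m2)%E.-integrable setT (fun z => (z.1 * z.2)%:E).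
  apply/integrable12ltyP; first exact/measurable_EFinP.
  rewrite (_ : (\int[m1]_x _)%E =
      ((\int[m1]_x `|x|%:E) * (\int[m2]_y `|y|%:E))%E); last first.
    rewrite -ge0_integralZr //; last first.
      by apply: integral_ge0 => y _; rewrite lee_fin.
    apply: eq_integral => x _; rewrite -ge0_integralZl //.
    by apply: eq_integral => y _; rewrite /= normrM.
  have := fin_numM (iabs _ I1) (iabs _ I2); rewrite ge0_fin_numE //.
  by rewrite mule_ge0 //; apply: integral_ge0 => y _; rewrite lee_fin.
have iYZ : itg P (fun t => Y t * Z t).
  apply/integrableP; split; first by apply/measurable_EFinP; exact: measurable_funM.
  have /integrableP[_] := Ip.
  rewrite (eq_measure_integral m'); last by move=> A mA _; exact: mE.
  rewrite ge0_integral_distribution //.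
  by apply/measurableT_comp => //; exact/measurable_EFinP.
split => //; rewrite /Ex /Rintegral -fineM; [|exact: integrable_fin_num..].
congr fine.
have -> : (\int[P]_t (Y t * Z t)%:E)%E = (\int[m']_z (z.1 * z.2)%:E)%E.
  by rewrite integral_distribution //; exact/measurable_EFinP.
rewrite -(@eq_measure_integral _ _ _ _ m' (m1 \x m2)%E); last by move=> A mA _; exact: mE.
rewrite -integral12_prod_meas1 //.
have e1 : (\int[P]_t (Y t)%:E = \int[m1]_x x%:E)%E.
  by rewrite integral_distribution //; exact/measurable_EFinP.
have e2 : (\int[P]_t (Z t)%:E = \int[m2]_x x%:E)%E.
  by rewrite integral_distribution //; exact/measurable_EFinP.
rewrite e1 e2 -(fineK (integrable_fin_num _ I2)) // -integralZr //.
apply: eq_integral => x _; rewrite fineK; last exact: integrable_fin_num.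
by rewrite /fubini_F /= -integralZl.
Qed.
End Independence.

Section SumIndependence.
Context d (T : measurableType d) (R : realType) (P : probability T R).
Variables (I : finType) (X : I -> {RV P >-> R}).
Hypothesis indX : mutually_independent X.

(** Joint conditions on the X j with j != i form a pi-system [G] whose sigma-algebra makes the sum
    measurable. For an event E determined by X i, the measures sending S to P (S and E) and to P (E)
    P (S) agree on [G], hence on all that it generates. *)
Lemma mutually_independent_sum (i : I) (c : R) :
  indep P (fun t => c * \sum_(j | j != i) X j t) (X i).
Proof.
pose G : set (set T) := [set S | exists2 A : I -> set R, (forall j, measurable (A j)) &
  S = \bigcap_(j in [set j | j \in [set~ i]%SET]) (X j @^-1` A j)].
have mpre j (A : set R) : measurable A -> measurable (X j @^-1` A).
  by move=> mA; rewrite -[X in measurable X]setTI; apply: measurable_funP.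
have Gm : G `<=` measurable.
  move=> S [A mA ->]; apply: fin_bigcap_measurable; first exact: finite_finset.
  by move=> j _; exact: mpre.
have GT : G [set: T].
  exists (fun=> [set: R]) => //; apply/esym/seteqP; split => // t _ j _ //.
have GI : setI_closed G.
  move=> _ _ [A mA ->] [B mB ->]; exists (fun j => A j `&` B j).
    by move=> j; exact: measurableI.
  apply/seteqP; split => t /=.
    by move=> [H1 H2] j ji; split; [exact: H1|exact: H2].
  by move=> H; split => j ji; have [] := H j ji.
move=> B A mB mA.
have mE : measurable (X i @^-1` A) by exact: mpre.
set E := X i @^-1` A in mE *.
have PE : P E \is a fin_num by rewrite fin_num_measure.
pose r : {nonneg R} := NngNum (fine_ge0 (measure_ge0 P E)).
have rE : (r%:num%:E = P E)%E by exact: fineK PE.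
have key : forall S, <<s G >> S -> mrestr P mE S = mscale r P S.
  apply: (@g_sigma_algebra_measure_unique _ R T G Gm (fun=> setT)) => //.
  - by rewrite bigcup_const //; exists 0%N.
  - move=> S [C mC ->]; rewrite -[LHS]/(P (_ `&` E)) -[RHS]/(r%:num%:E * P _)%E rE.
    (* Independence over all indices, with [A] at the place i, is compared with independence over
       the indices other than i. *)
    pose C' j := if j == i then A else C j.
    have mC' j : measurable (C' j) by rewrite /C'; case: ifP.
    have := indX [set: I]%SET mC'.
    have -> : \bigcap_(j in [set j | j \in [set: I]%SET]) (X j @^-1` C' j) =
        \bigcap_(j in [set j | j \in [set~ i]%SET]) (X j @^-1` C j) `&` E.
      apply/seteqP; split => t /=.
        move=> H; split=> [j|].
          by rewrite /= !inE => ji; have := H j (finset.in_setT _); rewrite /C' (negbTE ji).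
        by have := H i (finset.in_setT _); rewrite /C' eqxx.
      move=> [H1 H2] j _; rewrite /C'; case: eqP => [->//|/eqP ji].
      by apply: H1; rewrite /= !inE.
    move=> ->; rewrite (indX [set~ i]%SET mC).
    rewrite (bigD1 i) //= {1}/C' eqxx; congr (_ * _)%E.
    apply: eq_big => [j|j]; first by rewrite !inE.
    by move=> /andP[_ ji]; rewrite /C' (negbTE ji).
  - move=> _; apply: (@le_lt_trans _ _ 1%E); last exact: ltry.
    rewrite -[leLHS]/(P (setT `&` E)); apply: probability_le1.
    exact: measurableI.
have mV : measurable_fun [set: g_sigma_algebraType G]
    (fun t : g_sigma_algebraType G => c * \sum_(j | j != i) X j t).
  apply: measurable_funM => //.
  under eq_fun do rewrite big_mkcond.
  apply: measurable_sum => j; have [ji|_ //] := boolP (j != i).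
  move=> _ C mC; rewrite setTI.
  apply: sub_sigma_algebra; exists (fun k => if k == j then C else setT).
    by move=> k; case: ifP.
  apply/seteqP; split => t /=.
    by move=> H k _; case: eqP => [->|].
  by move=> H; have := H j; rewrite /= eqxx; apply; rewrite !inE ji.
set V := (fun t => c * \sum_(j | j != i) X j t).
have VB : <<s G >> (V @^-1` B) by have := mV measurableT B mB; rewrite setTI.
by have := key _ VB; rewrite -[LHS]/(P (_ `&` E)) -[RHS]/(r%:num%:E * P _)%E rE muleC.
Qed.

End SumIndependence.

(** * Faa di Bruno's formula *)

Section FaaDiBruno.

(** One list of block sizes for each set partition of {1, ..., k}: the new element forms a block of
    its own, when the outer function is differentiated, or joins an existing block, when an inner
    factor is. *)
Fixpoint faa_terms (k : nat) : seq (seq nat) :=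
  match k with
  | 0 => [:: [::]]
  | k'.+1 => flatten [seq (1%N :: l) :: [seq incr_nth l i | i <- iota 0 (size l)]
                     | l <- faa_terms k']
  end.

Lemma sumn_incr_nth l i : sumn (incr_nth l i) = (sumn l).+1.
Proof.
elim: l i => [|a l IH] [|i] //=; last by rewrite IH addnS.
by elim: i => //= i ->.
Qed.

Lemma faa_termsP k l : l \in faa_terms k -> sumn l = k /\ all (fun i => 0 < i)%N l.
Proof.
elim: k l => [|k IH] l; first by rewrite inE => /eqP ->.
rewrite /= => /flatten_mapP[l' /IH[Hs Ha]]; rewrite inE => /predU1P[->|].
  by rewrite /= Hs add1n.
move=> /mapP[i]; rewrite mem_iota add0n /= => il ->; split.
  by rewrite sumn_incr_nth Hs.
apply/allP => j /(nthP 0%N) [s]; rewrite size_incr_nth il => sl <-.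
rewrite nth_incr_nth addn_gt0; apply/orP; right.
by move/allP: Ha; apply; exact: mem_nth.
Qed.

Lemma faa_terms_le k l i : l \in faa_terms k -> i \in l -> (0 < i <= k)%N.
Proof.
move=> /faa_termsP[<- /allP H] il; rewrite H //=.
elim: l il {H} => // a l IH; rewrite inE => /predU1P[->|/IH] /=; first exact: leq_addr.
by move=> /leq_trans; apply; exact: leq_addl.
Qed.

Lemma faa_terms_size k l : l \in faa_terms k -> (size l <= k)%N.
Proof.
move=> /faa_termsP[<-]; elim: l => // a l IH /= /andP[a0 /IH H].
by rewrite -add1n leq_add.
Qed.

Lemma stirling2_small m k : (m < k)%N -> stirling2 m k = 0%N.
Proof.
elim: m k => [|m IH] [|k] //= mk; rewrite !IH ?muln0 //.
exact: ltnW.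
Qed.

(** Set partitions sorted by their number of blocks. The arbitrary weight [a] serves the induction,
    which passes to the weight j -> a (j + 1) + j a (j). *)
Lemma faa_terms_stirling (R : pzRingType) k (a : nat -> R) :
  \sum_(l <- faa_terms k) a (size l) = \sum_(j < k.+1) (stirling2 k j)%:R * a j.
Proof.
elim: k a => [|k IH] a; first by rewrite big_seq1 big_ord_recl big_ord0 addr0 mul1r.
rewrite /= big_flatten big_map /=.
have -> : \sum_(l <- faa_terms k)
    \sum_(s <- (1%N :: l) :: [seq incr_nth l i | i <- iota 0 (size l)]) a (size s) =
    \sum_(l <- faa_terms k) (fun j => a j.+1 + j%:R * a j) (size l).
  apply: eq_bigr => l _; rewrite big_cons big_map /=; congr (_ + _).
  rewrite big_seq (eq_bigr (fun=> a (size l))); last first.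
    by move=> i; rewrite mem_iota add0n /= => il; rewrite size_incr_nth il.
  by rewrite -big_seq big_const_seq count_predT size_iota iter_addr_0 mulr_natl.
rewrite (IH (fun j => a j.+1 + j%:R * a j)) [RHS]big_ord_recl mul0r add0r.
under eq_bigr do rewrite mulrDr; rewrite big_split /=.
(* The index is shifted by one: the first term carries the factor 0, and the added last one contains
   S(k, k + 1) = 0. *)
have -> : \sum_(i < k.+1) (stirling2 k i)%:R * (i%:R * a i) =
    \sum_(i < k.+1) ((i.+1 * stirling2 k i.+1)%N)%:R * a i.+1.
  rewrite big_ord_recl mul0r mulr0 add0r [RHS]big_ord_recr /=.
  rewrite (stirling2_small (ltnSn k)) muln0 mul0r addr0.
  by apply: eq_bigr => i _; rewrite natrM mulrA -!natrM mulnC.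
rewrite -big_split /=; apply: eq_bigr => i _.
by rewrite -mulrDl -natrD addnC.
Qed.

Variable R : realType.
Variables (H G : nat -> R -> R).

Definition faa_term (l : seq nat) (x : R) : R := H (size l) (G 0%N x) * \prod_(i <- l) G i x.
Definition faa_deriv (k : nat) (x : R) : R := \sum_(l <- faa_terms k) faa_term l x.

Lemma der_faa_prod m (l : seq nat) (x : R) :
  (forall k, (k < m)%N -> forall z : R, is_derive z 1 (G k) (G k.+1 z)) ->
  (forall i, i \in l -> (i < m)%N) ->
  is_derive x 1 (fun z => \prod_(i <- l) G i z)
    (\sum_(i <- iota 0 (size l)) \prod_(j <- incr_nth l i) G j x).
Proof.
move=> dG; elim: l => [|a l IH] lm.
  rewrite big_nil (_ : (fun _ => _) = fun=> 1); first exact: der_cst.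
  by apply/funext => z; rewrite big_nil.
rewrite (_ : (fun _ => _) = fun z => G a z * \prod_(i <- l) G i z); last first.
  by apply/funext => z; rewrite big_cons.
have {}IH := IH (fun i il => lm i (mem_behead (s := a :: l) il)).
apply: der_eq (derM (dG a (lm a (mem_head _ _)) x) IH) _.
rewrite /= big_cons big_cons; congr (_ + _).
rewrite -[1%N]addn0 iotaDl big_map mulr_sumr; apply: eq_bigr => i _.
by rewrite add1n /= big_cons.
Qed.

Lemma der_faa_deriv m k (x : R) : (k < m)%N ->
  (forall k, (k < m)%N -> forall z : R, is_derive z 1 (G k) (G k.+1 z)) ->
  (forall k, (k < m)%N -> forall z : R, is_derive z 1 (H k) (H k.+1 z)) ->
  is_derive x 1 (faa_deriv k) (faa_deriv k.+1 x).
Proof.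
move=> km dG dH; have m0 : (0 < m)%N by apply: leq_ltn_trans km.
pose D (l : seq nat) : R := faa_term (1%N :: l) x +
  \sum_(i <- iota 0 (size l)) faa_term (incr_nth l i) x.
have dterm l : l \in faa_terms k -> is_derive x 1 (faa_term l) (D l).
  move=> lk; have sl : (size l < m)%N by apply: leq_ltn_trans km; exact: faa_terms_size lk.
  have lm i : i \in l -> (i < m)%N.
    by move=> il; have /andP[_ ik] := faa_terms_le lk il; apply: leq_ltn_trans km.
  apply: der_eq (derM (der_comp (dH _ sl (G 0%N x)) (dG 0%N m0 x)) (der_faa_prod x dG lm)) _.
  rewrite /D /faa_term /= big_cons mulrA; congr (_ + _).
  rewrite mulr_sumr big_seq [RHS]big_seq; apply: eq_bigr => i.
  by rewrite mem_iota add0n /= => il; rewrite size_incr_nth il.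
have -> : faa_deriv k.+1 x = \sum_(l <- faa_terms k) D l.
  rewrite /faa_deriv /= big_flatten big_map; apply: eq_bigr => l _.
  by rewrite big_cons big_map.
rewrite /faa_deriv; elim: (faa_terms k) dterm => [|l s IH] dterm.
  rewrite big_nil (_ : (fun _ => _) = fun=> 0); first exact: der_cst.
  by apply/funext => z; rewrite big_nil.
rewrite big_cons (_ : (fun _ => _) = fun z => faa_term l z + \sum_(l <- s) faa_term l z).
  apply: derD; first exact: dterm (mem_head _ _).
  by apply: IH => l' l's; apply: dterm; rewrite inE l's orbT.
by apply/funext => z; rewrite big_cons.
Qed.

(** Each |G i x| is at most P^(i / m) and the block sizes add up to m, so every product is at most
    P; what remains is the number of products with k blocks. *)
Lemma faa_deriv_bound m (L : nat -> R) (P : R) (x : R) : (0 < m)%N ->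
  (forall k, (0 < k <= m)%N -> forall z, `|H k z| <= L k) ->
  (forall k, (0 < k <= m)%N -> `|G k x| `^ (m%:R / k%:R) <= P) ->
  `|faa_deriv m x| <= (\sum_(1 <= k < m.+1) (stirling2 m k)%:R * L k) * P.
Proof.
move=> m0 HL GP.
have P0 : 0 <= P by apply: le_trans (GP 1%N _) => //; exact: powR_ge0.
have GP' k : (0 < k <= m)%N -> `|G k x| <= P `^ (k%:R / m%:R).
  move=> km; have /andP[k0 _] := km.
  have := @ge0_ler_powR R (k%:R / m%:R) _ _ _ _ _ (GP k km).
  rewrite !nnegrE powR_ge0 P0 divr_ge0 // => /(_ isT isT isT).
  rewrite -powRrM (_ : m%:R / k%:R * (k%:R / m%:R) = 1) ?powRr1 //.
  by field; rewrite !pnatr_eq0 -!lt0n m0 k0.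
have prodP l : l \in faa_terms m -> \prod_(i <- l) `|G i x| <= P.
  move=> lm; have [sl al] := faa_termsP lm.
  have lle i : i \in l -> (0 < i <= m)%N by exact: faa_terms_le lm.
  have [Pz|Pn] := eqVneq P 0.
    case: l sl lm lle {al} => [/= m00|a l _ _ lle]; first by rewrite -m00 in m0.
    rewrite big_cons Pz (_ : `|G a x| = 0) ?mul0r //.
    apply/eqP; rewrite eq_le normr_ge0 andbT.
    apply: le_trans (GP' a (lle a (mem_head _ _))) _.
    have /andP[a0 _] := lle a (mem_head _ _).
    by rewrite Pz powR0 // mulf_neq0 ?invr_eq0 ?pnatr_eq0 -?lt0n.
  have -> : P = P `^ ((sumn l)%:R / m%:R).
    by rewrite sl divff ?powRr1 // pnatr_eq0 -lt0n.
  elim: l lle {sl al lm} => [|a l IH] lle; first by rewrite big_nil mul0r powRr0.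
  rewrite big_cons /= natrD mulrDl powRD ?Pn ?implybT //.
  apply: ler_pM => //; first by apply: prodr_ge0.
    by apply: GP'; apply: lle; exact: mem_head.
  by apply: IH => i il; apply: lle; rewrite inE il orbT.
have slm l : l \in faa_terms m -> (0 < size l <= m)%N.
  move=> lm; rewrite (faa_terms_size lm) andbT; have [sl _] := faa_termsP lm.
  by case: l sl {lm} => //= m00; rewrite -m00 in m0.
have L0 k : (0 < k <= m)%N -> 0 <= L k.
  by move=> km; apply: le_trans (HL k km 0).
apply: (@le_trans _ _ (\sum_(l <- faa_terms m) L (size l) * P)).
  apply: le_trans (ler_norm_sum _ _ _) _.
  rewrite big_seq [leRHS]big_seq; apply: ler_sum => l lm.
  rewrite normrM ler_pM ?normr_ge0 ?HL ?slm //.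
  by rewrite normr_prod prodP.
rewrite -mulr_suml ler_wpM2r // faa_terms_stirling big_ord_recl.
rewrite (_ : stirling2 m 0 = 0%N) ?mul0r ?add0r; last by case: m m0 {HL GP GP' prodP slm L0}.
by rewrite big_add1 /= big_mkord.
Qed.

End FaaDiBruno.

(** * Absolute continuity and total variation *)

Section Chains.
Variable R : realType.
Implicit Types (a b : R) (f : R -> R) (s : seq (R * R)).

(* Ordered lists of intervals replace the disjoint families of
   [absolutely_continuous_on] because they can be concatenated. *)
Fixpoint chain a s b : bool :=
  match s with
  | [::] => a <= b
  | p :: s' => [&& a <= p.1, p.1 <= p.2 & chain p.2 s' b]
  end.

Definition chain_length s : R := \sum_(p <- s) (p.2 - p.1).
Definition chain_var f s : R := \sum_(p <- s) `|f p.2 - f p.1|.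

Definition chain_ac a b f := forall e : R, 0 < e -> exists2 d : R, 0 < d &
  forall s, chain a s b -> chain_length s < d -> chain_var f s <= e.

Lemma chain_le a s b : chain a s b -> a <= b.
Proof.
elim: s a => //= p s IH a /and3P[ap pp /IH]; apply: le_trans.
exact: le_trans ap pp.
Qed.

Lemma chain_weaken a a' s b : a' <= a -> chain a s b -> chain a' s b.
Proof.
move=> a'a; case: s => [|p s] /=; first exact: le_trans.
by move=> /and3P[ap -> ->]; rewrite (le_trans a'a ap).
Qed.

Lemma chain_cat a s t c b : chain a s c -> chain c t b -> chain a (s ++ t) b.
Proof.
elim: s a => [|p s IH] a /=; first by move=> ac; apply: chain_weaken.
by move=> /and3P[-> -> /IH H] /H ->.
Qed.

Lemma chain_catP a s t b : chain a (s ++ t) b -> exists2 c, chain a s c & chain c t b.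
Proof.
elim: s a => [|p s IH] a /=; first by exists a.
by move=> /and3P[ap pp /IH[c H1 H2]]; exists c => //; rewrite ap pp H1.
Qed.

Lemma chain_nth a s b (p0 : R * R) i : chain a s b -> (i < size s)%N ->
  a <= (nth p0 s i).1 /\ (nth p0 s i).1 <= (nth p0 s i).2 /\ (nth p0 s i).2 <= b.
Proof.
elim: s a i => //= p s IH a [|i] /and3P[ap pp H] => [_|]; last first.
  rewrite ltnS => /(IH _ _ H)[H1 H2]; split=> //=.
  exact: le_trans (le_trans ap pp) H1.
by split=> //; split=> //; exact: chain_le H.
Qed.

Lemma chain_disjoint a s b (p0 : R * R) i j : chain a s b -> (i < j < size s)%N ->
  (nth p0 s i).2 <= (nth p0 s j).1.
Proof.
elim: s a i j => [|p s IH] a i j /=; first by rewrite ltn0 andbF.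
move=> /and3P[ap pp H]; case: j => [|j]; first by rewrite ltn0.
case: i => [|i] /=; last by rewrite !ltnS; apply: IH H.
by rewrite ltnS => js; have [] := chain_nth p0 H js.
Qed.

Lemma absolutely_continuous_chain a b f : absolutely_continuous_on a b f ->
  chain_ac a b f.
Proof.
move=> ac e e0; have [d d0 H] := ac e e0; exists d => // s cs sd.
pose p0 : R * R := (0, 0).
have := H (size s) (fun i => (nth p0 s i).1) (fun i => (nth p0 s i).2).
rewrite /chain_var /chain_length in sd *.
rewrite (big_nth p0) big_mkord in sd; rewrite (big_nth p0) big_mkord => /(_ _ _ sd) K.
apply/ltW/K; first by move=> i; exact: chain_nth.
apply/trivIsetP => i j _ _ ij; wlog lij : i j ij / (i < j)%N => [W|].
  have := ij; rewrite -val_eqE neq_ltn => /orP[|ji]; first exact: W.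
  by rewrite setIC; apply: W; rewrite // eq_sym.
apply/seteqP; split => // x [] /=; rewrite !in_itv /= => /andP[_ xi] /andP[jx _].
have := @chain_disjoint a s b p0 i j cs; rewrite lij ltn_ord => /(_ isT).
by rewrite leNgt (lt_trans jx xi).
Qed.

Fixpoint partition_pairs a (t : seq R) : seq (R * R) :=
  match t with [::] => [::] | x :: t' => (a, x) :: partition_pairs x t' end.

Lemma partition_pairs_chain a b t : itv_partition a b t -> chain a (partition_pairs a t) b.
Proof.
move=> []; elim: t a => [|x t IH] a /=; first by move=> _ /eqP ->.
by move=> /andP[ax xt] /(IH x xt) ->; rewrite lexx ltW.
Qed.

Lemma partition_pairs_length a b t : itv_partition a b t ->
  chain_length (partition_pairs a t) = b - a.
Proof.
move=> []; elim: t a => [|x t IH] a /=.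
  by move=> _ /eqP ->; rewrite /chain_length big_nil subrr.
move=> /andP[ax xt] /(IH x xt); rewrite /chain_length big_cons => -> /=.
by rewrite addrC addrA subrK.
Qed.

Lemma partition_pairs_var a b t f : itv_partition a b t ->
  chain_var f (partition_pairs a t) = variation a b f t.
Proof.
move=> abt; rewrite variation_zip // => {abt}; rewrite /chain_var.
elim: t a => [|x t IH] a /=; first by rewrite !big_nil.
by rewrite !big_cons IH.
Qed.

Lemma chain_var_cat f s t : chain_var f (s ++ t) = chain_var f s + chain_var f t.
Proof. by rewrite /chain_var big_cat. Qed.

Lemma chain_length_cat s t : chain_length (s ++ t) = chain_length s + chain_length t.
Proof. by rewrite /chain_length big_cat. Qed.

(** Intervals move one at a time from [s2] to [s1], cut along an arbitrary partition. Cutting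
    preserves the length, so the bound persists, and the supremum over partitions turns the
    variation of an interval into its total variation. *)
Lemma chain_total_variation a b f (e d : R) :
  (forall s, chain a s b -> chain_length s < d -> chain_var f s <= e) ->
  forall s2 s1, chain a (s1 ++ s2) b -> chain_length (s1 ++ s2) < d ->
  ((chain_var f s1)%:E + \sum_(p <- s2) total_variation p.1 p.2 f <= e%:E)%E.
Proof.
move=> H; elim=> [|p s2 IH] s1.
  by rewrite cats0 big_nil adde0 lee_fin; exact: H.
move=> cs ld; have [c c1 /= /and3P[cp pp c2]] := chain_catP cs.
rewrite big_cons.
have S0 : (0 <= \sum_(q <- s2) total_variation q.1 q.2 f)%E.
  elim: s2 (p.2) c2 {IH cs ld} => [|q s2 IH] x /=; first by rewrite big_nil.
  move=> /and3P[_ qq /IH H2]; rewrite big_cons adde_ge0 //.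
  exact: total_variation_ge0.
have step t : itv_partition p.1 p.2 t ->
    ((chain_var f s1)%:E + ((variation p.1 p.2 f t)%:E +
      \sum_(q <- s2) total_variation q.1 q.2 f) <= e%:E)%E.
  move=> pt; rewrite addeA -EFinD -(partition_pairs_var f pt) -chain_var_cat; apply: IH.
    rewrite -catA; apply: chain_cat c1 _.
    apply: (@chain_cat _ _ _ p.2) => //; apply: chain_weaken cp _.
    exact: partition_pairs_chain.
  move: ld; rewrite -catA !chain_length_cat (partition_pairs_length pt).
  by rewrite /chain_length big_cons.
have pt0 : exists t, itv_partition p.1 p.2 t.
  move: pp; rewrite le_eqVlt => /predU1P[->|pp]; first by exists [::].
  by exists [:: p.2]; exact: itv_partition1.
(* Finiteness is read off the estimate for one partition; it permits subtraction in the extended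
   reals. *)
have Sfin : (\sum_(q <- s2) total_variation q.1 q.2 f)%E \is a fin_num.
  have [t /step H1] := pt0; rewrite ge0_fin_numE //.
  rewrite ltey; apply/eqP => Soo; move: H1; rewrite Soo.
  by rewrite addey // addey // leye_eq.
rewrite -leeBrDl // -leeBrDr // -(fineK Sfin) -!EFinB.
apply: ge_ereal_sup => _ [_ [t pt <-] <-].
have := step t pt; rewrite -(fineK Sfin) -!EFinD !lee_fin => H1; lra.
Qed.

Lemma chain_ac_total_variation a b f : chain_ac a b f ->
  forall e : R, 0 < e -> exists2 d : R, 0 < d & forall s, chain a s b ->
    chain_length s < d -> (\sum_(p <- s) total_variation p.1 p.2 f <= e%:E)%E.
Proof.
move=> ac e e0; have [d d0 H] := ac e e0; exists d => // s cs sd.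
have := chain_total_variation H (s2 := s) (s1 := [::]) cs sd.
by rewrite /chain_var big_nil add0e.
Qed.

(** Total variation is at most 1 over intervals shorter than d, and finitely many steps of length d
    / 2 reach x from a. *)
Lemma chain_ac_fin_num a b f x : a <= b -> chain_ac a b f -> a <= x <= b ->
  total_variation a x f \is a fin_num.
Proof.
move=> ab ac; have [d d0 H] := chain_ac_total_variation ac ltr01.
have step y z : a <= y -> y <= z -> z <= b -> z - y < d ->
    total_variation y z f \is a fin_num.
  move=> ay yz zb zyd; rewrite ge0_fin_numE ?total_variation_ge0 //.
  have := H [:: (y, z)]; rewrite /= ay yz zb /chain_length !big_seq1 /= => /(_ isT zyd).
  by move=> /le_lt_trans; apply; exact: ltry.
have [n Hn] : exists n : nat, (x - a) / (d / 2) < n%:R.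
  exists (Num.bound `|(x - a) / (d / 2)|).
  apply: le_lt_trans (archi_boundP (normr_ge0 _)); exact: ler_norm.
rewrite ltr_pdivrMr ?divr_gt0 // in Hn.
elim: n x Hn => [|n IH] x Hn /andP[ax xb]; first by rewrite mul0r in Hn; lra.
have [xd|xd] := leP (x - a) (d / 2); first by apply: step => //; lra.
have d20 : 0 < d / 2 by lra.
rewrite (@total_variationD _ a x (x - d / 2) f); [|lra|lra].
rewrite fin_numD IH; first by apply: step; lra.
  by rewrite -natr1 mulrDl mul1r in Hn; lra.
by apply/andP; split; lra.
Qed.

Definition tv a f (x : R) : R := fine (total_variation a x f).

Lemma tv_sub a b f x y : a <= b -> chain_ac a b f -> a <= x -> x <= y -> y <= b ->
  total_variation x y f = (tv a f y - tv a f x)%:E.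
Proof.
move=> ab ac ax xy yb.
have fx := chain_ac_fin_num (x := x) ab ac; have fy := chain_ac_fin_num (x := y) ab ac.
rewrite ax (le_trans xy yb) in fx; rewrite yb (le_trans ax xy) in fy.
have {}fx := fx isT; have {}fy := fy isT.
rewrite EFinB /tv !fineK // (total_variationD f ax xy) addeAC subee // add0e //.
Qed.

Lemma tv_nondecreasing a b f x y : a <= b -> chain_ac a b f ->
  a <= x -> x <= y -> y <= b -> tv a f x <= tv a f y.
Proof.
move=> ab ac ax xy yb; rewrite -subr_ge0 -lee_fin -(tv_sub ab ac) //.
exact: total_variation_ge0.
Qed.

Lemma tv_ge a b f x y : a <= b -> chain_ac a b f -> a <= x -> x <= y -> y <= b ->
  `|f y - f x| <= tv a f y - tv a f x.
Proof.
move=> ab ac ax xy yb; rewrite -lee_fin -(tv_sub ab ac) //.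
exact: total_variation_ge.
Qed.

Lemma chain_ac_tv a b f : a <= b -> chain_ac a b f -> chain_ac a b (tv a f).
Proof.
move=> ab ac e e0; have [d d0 H] := chain_ac_total_variation ac e0.
exists d => // s cs sd; rewrite -lee_fin; apply: le_trans (H s cs sd).
rewrite -sumEFin big_seq [leRHS]big_seq; apply: lee_sum => p ps.
have := ps; rewrite -index_mem => /(chain_nth p cs); rewrite nth_index //.
move=> [H1 [H2 H3]]; rewrite (tv_sub ab ac) // ger0_norm ?subr_ge0 //.
exact: (@tv_nondecreasing a b).
Qed.

Lemma chain_acB a b f g : chain_ac a b f -> chain_ac a b g ->
  chain_ac a b (fun x => f x - g x).
Proof.
move=> cf cg e e0; have e20 : 0 < e / 2 by lra.
have [d d0 H] := cf _ e20; have [d' d'0 H'] := cg _ e20.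
exists (Num.min d d'); first by rewrite lt_min d0.
move=> s cs; rewrite lt_min => /andP[/(H s cs) H1 /(H' s cs) H2].
apply: (@le_trans _ _ (chain_var f s + chain_var g s)); last lra.
rewrite /chain_var -big_split /=; apply: ler_sum => p _.
have -> : f p.2 - g p.2 - (f p.1 - g p.1) = (f p.2 - f p.1) - (g p.2 - g p.1) by ring.
exact: ler_normB.
Qed.

End Chains.

(** * Densities of monotone absolutely continuous functions *)

Section Density.
Variables (R : realType) (a b : R) (M : R -> R).
Hypothesis ab : a < b.
Hypothesis Mnd : forall x y, a <= x -> x <= y -> y <= b -> M x <= M y.
Hypothesis Mac : chain_ac a b M.
Local Notation mu := (@lebesgue_measure R).

(** Composition with this retraction extends [M] to a nondecreasing function on the whole line, as a
    Stieltjes measure requires. *)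
Definition clamp (x : R) : R := Num.max a (Num.min x b).

Lemma clamp_id x : a <= x <= b -> clamp x = x.
Proof.
move=> /andP[ax xb]; rewrite /clamp; rewrite (min_idPl xb).
by apply/max_idPr.
Qed.

Lemma clamp_bounds x : a <= clamp x <= b.
Proof.
by rewrite /clamp le_max lexx /= ge_max (ltW ab) /= ge_min lexx orbT.
Qed.

Lemma clamp_le x y : x <= y -> clamp x <= clamp y.
Proof.
move=> xy; rewrite /clamp ge_max le_max lexx /= le_max; apply/orP; right.
by rewrite le_min !ge_min xy lexx orbT.
Qed.

Lemma clamp_lip x y : x <= y -> clamp y - clamp x <= y - x.
Proof.
move=> xy; rewrite /clamp /Num.max /Num.min.
by repeat (case: ifPn; rewrite -?leNgt); move=> *; lra.
Qed.

Definition Mclamp (x : R) : R := M (clamp x).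

Lemma Mclamp_nd : nondecreasing Mclamp.
Proof.
move=> x y xy; have /andP[ax xb] := clamp_bounds x; have /andP[ay yb] := clamp_bounds y.
by apply: Mnd => //; exact: clamp_le.
Qed.

Lemma Mclamp_rc : right_continuous Mclamp.
Proof.
move=> x; apply/cvgrPdist_le => e e0; have [d d0 H] := Mac e0.
near=> y; have xy : x <= y by near: y; exact: nbhs_right_ge.
have /andP[ax xb] := clamp_bounds x; have /andP[ay yb] := clamp_bounds y.
have := H [:: (clamp x, clamp y)]; rewrite /= ax (clamp_le xy) yb /chain_length /chain_var.
rewrite !big_seq1 /= distrC => /(_ isT); apply.
apply: le_lt_trans (clamp_lip xy) _; rewrite ltrBlDl.
by near: y; apply: nbhs_right_lt; rewrite ltrDl.
Unshelve. all: by end_near. Qed.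

Definition Mcumulative : cumulative R R :=
  HB.pack Mclamp (isCumulative.Build R _ R Mclamp Mclamp_nd Mclamp_rc).

Definition Mmeasure : {measure set (measurableTypeR R) -> \bar R} :=
  lebesgue_stieltjes_measure Mcumulative.

Lemma MmeasureE x y : a <= x -> x <= y -> y <= b ->
  Mmeasure `]x, y]%classic = (M y - M x)%:E.
Proof.
move=> ax xy yb.
rewrite -[LHS]/(lebesgue_stieltjes_measure Mcumulative _).
rewrite /lebesgue_stieltjes_measure /measure_extension.
rewrite measurable_mu_extE; last exact: is_ocitv.
rewrite -[LHS]/(wlength Mclamp `]x, y]%classic) wlength_itv_bnd // /Mclamp !clamp_id //.
  by rewrite ax (le_trans xy yb).
by rewrite (le_trans ax xy).
Qed.

Definition chain_union (s : seq (R * R)) : set R := \big[setU/set0]_(p <- s) `]p.1, p.2]%classic.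

Lemma chain_union_measurable s : measurable (chain_union s : set (measurableTypeR R)).
Proof. by apply: bigsetU_measurable => p _; exact: measurable_itv. Qed.

Lemma chain_union_sub x s y : chain x s y -> chain_union s `<=` `]x, y]%classic.
Proof.
elim: s x => [|p s IH] x /=; first by rewrite /chain_union big_nil => _; exact: sub0set.
move=> /and3P[xp pp cs]; rewrite /chain_union big_cons => z [|/(IH _ cs)] /=; rewrite !in_itv /=.
  move=> /andP[pz zp]; rewrite (le_lt_trans xp pz) /=.
  exact: le_trans zp (chain_le cs).
by move=> /andP[pz ->]; rewrite (le_lt_trans xp) // (le_lt_trans pp).
Qed.

Lemma chain_union_lebesgue x s y : chain x s y -> mu (chain_union s) = (chain_length s)%:E.
Proof.
elim: s x => [|p s IH] x /=.
  by rewrite /chain_union /chain_length !big_nil measure0.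
move=> /and3P[xp pp cs]; rewrite /chain_union /chain_length !big_cons.
rewrite measureU //; first last.
- apply/seteqP; split => // z [] /=; rewrite in_itv /= => /andP[_ zp].
  by move=> /(chain_union_sub cs) /=; rewrite in_itv /= ltNge zp.
- exact: chain_union_measurable.
rewrite EFinD; congr (_ + _)%E; last exact: IH cs.
apply: etrans (lebesgue_measure_itv _) _; rewrite /= lte_fin; case: ltP => // pp'.
have -> : p.1 = p.2 by apply: le_anti; rewrite pp.
by rewrite subrr.
Qed.

Lemma chain_union_Mmeasure x s : a <= x -> chain x s b ->
  (Mmeasure (chain_union s) <= (chain_var M s)%:E)%E.
Proof.
elim: s x => [|p s IH] x ax /=.
  by rewrite /chain_union /chain_var !big_nil measure0.
move=> /and3P[xp pp cs]; rewrite /chain_union /chain_var !big_cons.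
have pb := chain_le cs; have ap := le_trans ax xp.
apply: le_trans (measureU2 _ _ _) _; first exact: measurable_itv.
  exact: chain_union_measurable.
rewrite EFinD leeD //; last by apply: IH cs; exact: le_trans ap pp.
apply: (@le_trans _ _ (M p.2 - M p.1)%:E); last by rewrite lee_fin ler_norm.
by rewrite -(MmeasureE ap pp pb); exact: lexx.
Qed.

Definition grid (n k : nat) : R := a + (b - a) / n.+1%:R * k%:R.

Lemma gridS n k : grid n k.+1 = grid n k + (b - a) / n.+1%:R.
Proof. by rewrite /grid -(natr1 k) mulrDr mulr1 addrA. Qed.

Lemma grid_le n k : grid n k <= grid n k.+1.
Proof. by rewrite gridS lerDl divr_ge0 // subr_ge0 ltW. Qed.

Definition grid_chain (g : pred nat) n j k : seq (R * R) :=
  [seq (grid n i, grid n i.+1) | i <- iota j k & g i].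

Lemma grid_chainP g n j k : chain (grid n j) (grid_chain g n j k) (grid n (j + k)).
Proof.
rewrite /grid_chain; elim: k j => [|k IH] j /=; first by rewrite addn0.
rewrite -addSnnS; case: (g j) => /=; first by rewrite lexx grid_le IH.
by apply: chain_weaken (grid_le n j) _; exact: IH.
Qed.

Lemma grid_chain_ab g n : chain a (grid_chain g n 0 n.+1) b.
Proof.
have := grid_chainP g n 0 n.+1; rewrite /grid mulr0 addr0 add0n divfK.
  by rewrite addrC subrK.
by rewrite pnatr_eq0.
Qed.

Lemma grid_cell n x : a < x -> x <= b ->
  exists2 k : nat, (k < n.+1)%N & grid n k < x <= grid n k.+1.
Proof.
move=> ax xb.
have bE : grid n n.+1 = b by rewrite /grid divfK ?pnatr_eq0 // addrC subrK.
have ex : exists k : nat, x <= grid n k.+1 by exists n; rewrite bE.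
case: (ex_minnP ex) => k xk kmin; exists k; last first.
  rewrite xk andbT ltNge; apply/negP => xk'.
  case: k kmin xk xk' => [|k] kmin xk xk'.
    by rewrite /grid mulr0 addr0 leNgt ax in xk'.
  by have := kmin k xk'; rewrite ltnn.
by rewrite ltnS; apply: kmin; rewrite bE.
Qed.

Lemma chain_unionP s z : chain_union s z <->
  exists2 p, p \in s & `]p.1, p.2]%classic z.
Proof.
rewrite /chain_union; elim: s => [|p s IH]; first by rewrite big_nil; split => // -[].
rewrite big_cons; split.
  move=> [pz|/IH[q qs qz]]; first by exists p => //; exact: mem_head.
  by exists q => //; rewrite inE qs orbT.
move=> [q]; rewrite inE => /predU1P[->|qs] qz; first by left.
by right; apply/IH; exists q.
Qed.

(** The cells of a grid that lie inside [U] form a chain of length less than [d], so their union has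
    measure at most [e]; every point of [U] in ]a, b] is covered by all sufficiently fine grids. *)
Lemma Mmeasure_open (U : set R) (e d : R) : open U -> (mu U < d%:E)%E ->
  (forall s, chain a s b -> chain_length s < d -> chain_var M s <= e) ->
  (Mmeasure (U `&` `]a, b]) <= e%:E)%E.
Proof.
move=> oU Ud H.
have mU : measurable (U : set (measurableTypeR R)) by exact: open_measurable.
pose g n k := `[< `]grid n k, grid n k.+1]%classic `<=` U >].
pose Un n := chain_union (grid_chain (g n) n 0 n.+1).
have mUn n : measurable (Un n : set (measurableTypeR R)) by exact: chain_union_measurable.
have UnU n : Un n `<=` U.
  move=> z /chain_unionP[p /mapP[k]]; rewrite mem_filter => /andP[/asboolP gk _] ->.
  exact: gk.
have MUn n : (Mmeasure (Un n) <= e%:E)%E.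
  have cs := grid_chain_ab (g n) n.
  apply: le_trans (chain_union_Mmeasure (lexx a) cs) _; rewrite lee_fin; apply: H => //.
  rewrite -lte_fin -(chain_union_lebesgue cs); apply: le_lt_trans Ud.
  apply: le_measure; [exact: mem_set (mUn n)|exact: mem_set mU|exact: UnU].
(* Successive grids are not nested; the intersections over all finer grids do increase, and
   continuity of the measure from below applies to them. *)
pose L n := \bigcap_(k in [set k | (n <= k)%N]) Un k.
have mL n : measurable (L n : set (measurableTypeR R)).
  by apply: bigcap_measurable => [|k _]; [exists n => /=; exact: leqnn|exact: mUn].
have ML n : (Mmeasure (L n) <= e%:E)%E.
  apply: le_trans (MUn n); apply: le_measure.
  - exact: mem_set (mL n).
  - exact: mem_set (mUn n).
  - by move=> z; apply; exact: leqnn.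
have Lnd : nondecreasing_seq L.
  by move=> n k nk; apply/subsetPset => z Lz j kj; apply: Lz; exact: leq_trans kj.
have mUL : measurable (\bigcup_n L n : set (measurableTypeR R)).
  by apply: bigcupT_measurable.
have : (Mmeasure (\bigcup_n L n) <= e%:E)%E.
  have Hc := nondecreasing_cvg_mu (mu := Mmeasure) mL mUL Lnd.
  rewrite -(cvg_lim _ Hc) //; apply: lime_le; first by apply/cvg_ex; eexists; exact: Hc.
  exact: nearW.
apply: le_trans; apply: le_measure; [|exact: mem_set mUL|].
  by apply: mem_set; apply: measurableI => //; exact: measurable_itv.
move=> x [Ux]; rewrite /= in_itv /= => /andP[ax xb].
have [r /= r0 Hr] : nbhs x U by exact: open_nbhs_nbhs.
have [n Hn] : exists n : nat, (b - a) / r < n%:R.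
  exists (Num.bound `|(b - a) / r|).
  apply: le_lt_trans (archi_boundP (normr_ge0 _)); exact: ler_norm.
exists n => // k /= nk.
have [j jk /andP[j1 j2]] := grid_cell k ax xb.
apply/chain_unionP; exists (grid k j, grid k j.+1); last by rewrite /= in_itv /= j1.
apply/mapP; exists j => //; rewrite mem_filter mem_iota add0n jk /= andbT.
apply/asboolP => z; rewrite /= in_itv /= => /andP[z1 z2]; apply: Hr.
rewrite /ball_ /=.
have h0 : (b - a) / k.+1%:R < r.
  rewrite ltr_pdivrMr // mulrC -ltr_pdivrMr //; apply: lt_le_trans Hn _.
  by rewrite ler_nat; exact: leq_trans nk _.
move: h0 j1 j2 z1 z2; rewrite gridS.
move: ((b - a) / _) (grid k j) => y v h0 j1 j2 z1 z2.
by rewrite ltr_norml; apply/andP; split; lra.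
Qed.

(** Outer regularity encloses a null set in open sets of arbitrarily small Lebesgue measure, to
    which [Mmeasure_open] applies. *)
Lemma Mmeasure_dominated (N : set R) : measurable (N : set (measurableTypeR R)) ->
  mu N = 0%E -> Mmeasure (N `&` `]a, b]) = 0%E.
Proof.
move=> mN N0; apply/eqP; rewrite eq_le measure_ge0 andbT.
apply/lee_addgt0Pr => e e0; rewrite add0e.
have [d d0 H] := Mac e0.
have Noo : (mu N < +oo)%E by rewrite N0.
have [U [oU NU Ud]] := lebesgue_regularity_outer mN Noo d0.
have mU : measurable (U : set (measurableTypeR R)) by exact: open_measurable.
apply: (@le_trans _ _ (Mmeasure (U `&` `]a, b]))).
  apply: le_measure; try (apply: mem_set; apply: measurableI => //; exact: measurable_itv).
  exact: setSI.
apply: (@Mmeasure_open U e d) => //.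
apply: le_lt_trans Ud; rewrite -{1}(setDUK NU).
apply: le_trans (measureU2 _ _ _) _; [exact: mN|exact: measurableD|].
rewrite -[leRHS]add0e; apply: leeD; last exact: lexx.
by rewrite -N0; exact: lexx.
Qed.

(* [rho] is the Radon-Nikodym derivative of the Stieltjes measure of [M]. *)
Lemma chain_ac_density : exists rho : R -> R, itg mu rho /\
  forall x, a <= x -> x <= b -> M x - M a = (\int[mu]_(t in `]a, x]) rho t)%R.
Proof.
have mab : measurable (`]a, b]%classic : set (measurableTypeR R)) by exact: measurable_itv.
have fin : (Mmeasure `]a, b]%classic < +oo)%E.
  rewrite (_ : Mmeasure _ = (M b - M a)%:E) ?ltry //.
  by apply: MmeasureE => //; exact: ltW.
pose nu : {finite_measure set (measurableTypeR R) -> \bar R} := mfrestr mab fin.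
have dom : charge_of_finite_measure nu `<< mu.
  apply/null_content_dominatesP => A mA A0.
  exact: Mmeasure_dominated.
pose rho0 := Radon_Nikodym (charge_of_finite_measure nu) mu.
have rhofin x : rho0 x \is a fin_num by exact: Radon_Nikodym_fin_num.
have irho : mu.-integrable setT rho0 by exact: Radon_Nikodym_integrable.
have rhoE : EFin \o (fine \o rho0) = rho0.
  by apply/funext => x /=; rewrite fineK.
exists (fine \o rho0); split; first by rewrite /itg rhoE.
move=> x ax xb; rewrite /Rintegral.
have -> : (\int[mu]_(t in `]a, x]) ((fine \o rho0) t)%:E)%E = nu `]a, x]%classic.
  rewrite [RHS](Radon_Nikodym_integral dom); last exact: measurable_itv.
  by apply: eq_integral => t _; rewrite /= fineK //; exact: rhofin.
rewrite -[nu _]/(Mmeasure (`]a, x] `&` `]a, b])) setIidl; last exact: subset_itvl.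
by rewrite (_ : Mmeasure _ = (M x - M a)%:E) //; exact: MmeasureE.
Qed.

End Density.

(** * Lipschitz bounds from essential suprema of derivatives *)

Section AbsolutelyContinuousLipschitz.
Variable R : realType.
Local Notation mu := (@lebesgue_measure R).

(** Jordan decomposition: [f] is the total variation V minus V - f, both nondecreasing and
    absolutely continuous. *)
Lemma chain_ac_integral (a b : R) (f : R -> R) : a < b -> chain_ac a b f ->
  exists rho : R -> R, itg mu rho /\
    forall x, a <= x -> x <= b -> f x - f a = (\int[mu]_(t in `]a, x]) rho t)%R.
Proof.
move=> ab ac; have ab' := ltW ab.
have acV := chain_ac_tv ab' ac.
have [|rho1 [i1 H1]] := chain_ac_density ab _ acV.
  by move=> x y ax xy yb; exact: (tv_nondecreasing ab' ac).
have [|rho2 [i2 H2]] := chain_ac_density ab _ (chain_acB acV ac).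
  move=> x y ax xy yb; have := tv_ge ab' ac ax xy yb.
  by move=> /(le_trans (ler_norm _)); lra.
exists (fun x => rho1 x - rho2 x); split; first exact: itgB.
move=> x ax xb.
have mx : measurable (`]a, x]%classic : set (measurableTypeR R)) by exact: measurable_itv.
rewrite RintegralB //; first by rewrite -H1 // -H2 //; ring.
  exact: integrableS i1.
exact: integrableS i2.
Qed.

(** By Lebesgue differentiation the density of [f] equals f' almost everywhere inside [a, b], so its
    bound can be integrated. *)
Lemma ac_lipschitz (a b L : R) (f : R -> R) : a <= b -> 0 <= L ->
  absolutely_continuous_on a b f ->
  {ae mu, forall x, `|f^`()%classic x| <= L} -> `|f b - f a| <= L * (b - a).
Proof.
rewrite le_eqVlt => /predU1P[<-|ab] L0 acf fL; first by rewrite !subrr normr0 mulr0.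
have [rho [irho Hrho]] := chain_ac_integral ab (absolutely_continuous_chain acf).
pose F (x : R) : R := (\int[mu]_(t in [set` Interval (BRight a) (BRight x)]) rho t)%R.
have mI (i : interval R) : measurable ([set` i] : set (measurableTypeR R)).
  exact: measurable_itv.
have lrho : locally_integrable [set: R] rho.
  have := @integrable_locally R rho setT measurableT irho.
  rewrite (_ : rho \_ setT = rho) //.
  by apply/funext => x; rewrite patchE in_setT.
have iy y : mu.-integrable [set` Interval (BRight a) (BRight y)] (EFin \o rho).
  by apply: integrableS irho.
have Fae := FTC1 iy lrho.
have rhoL : {ae mu, forall x, `]a, b[%classic x -> (`|rho x|%:E <= L%:E)%E}.
  apply: filterS2 fL Fae; first exact: (ae_filter_ringOfSetsType mu).
  move=> x fx Fx /=; rewrite in_itv /= => /andP[ax xb].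
  have [dF1 dF2] := Fx ax.
  have dF : is_derive x 1 (fun z => f a + F z) (rho x).
    apply: der_eq (derD (der_cst (f a) x) (_ : is_derive x 1 F (rho x))) _.
      by split; [exact: dF1|rewrite -derive1E; exact: dF2].
    by rewrite add0r.
  have df : is_derive x 1 f (rho x).
    apply: near_eq_is_derive dF; near=> z.
    have az : a < z by near: z; exact: lt_nbhsr.
    have zb : z < b by near: z; exact: lt_nbhsl.
    by rewrite /F -(Hrho z (ltW az) (ltW zb)); ring.
  have [_ E] := df; rewrite lee_fin -E -derive1E; exact: fx.
rewrite Hrho ?(ltW ab) //.
rewrite -Rintegral_itv_bndo_bndc; last by apply: integrableS irho.
have ii : mu.-integrable `]a, b[ (EFin \o rho) by apply: integrableS irho.
have inorm : mu.-integrable `]a, b[ (fun x => `|rho x|%:E).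
  by apply: eq_integrable (integrable_norm ii).
apply: le_trans (le_normr_Rintegral (mI _) ii) _.
rewrite -lee_fin /Rintegral fineK; last first.
  exact: integrable_fin_num inorm.
apply: (@le_trans _ _ (\int[mu]_(x in `]a, b[) L%:E)%E).
  apply: ae_ge0_le_integral => //.
  exact: measurable_int inorm.
rewrite integral_cst //.
have e : mu `]a, b[%classic = (b - a)%:E.
  by rewrite lebesgue_measure_itv /= lte_fin ab -EFinB.
by rewrite EFinM -e; exact: lexx.
Unshelve. all: by end_near. Qed.

(** If the derivative of order k exists everywhere, this is the mean value theorem. Otherwise k = m,
    since m - 1 derivatives always exist, and absolute continuity of h^(m-1) takes over. *)
Lemma derivative_norm_lipschitz (m k : nat) (h : R -> R) : class_Cb m h ->
  (1 <= k <= m)%N -> exists L : R, [/\ derivative_norm k h = L%:E, 0 <= L &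
    forall x y, `|h^`(k.-1)%classic x - h^`(k.-1)%classic y| <= L * `|x - y|].
Proof.
move=> [hd hac hfin] km; have /andP[k1 km'] := km.
have Nfin := hfin k km.
have N0 : (0 <= derivative_norm k h)%E.
  rewrite /derivative_norm; case: asboolP => [_|_].
    apply: (@le_trans _ _ `|h^`(k)%classic 0|%:E); first by rewrite lee_fin.
    by apply: ereal_sup_ubound; exists 0.
  apply: ess_sup_gee; last by apply: nearW => x; rewrite lee_fin.
  (* A nonnegative function has a nonnegative essential supremum only if the measure is nonzero. *)
  have e1 : mu `[0%R, 1%R]%classic = 1%E.
    by rewrite lebesgue_measure_itv /= lte_fin ltr01 -EFinB subr0.
  apply: (@lt_le_trans _ _ (mu `[0%R, 1%R]%classic)); first by rewrite e1 lte01.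
  by apply: le_measure; rewrite ?inE.
have NE : derivative_norm k h \is a fin_num by rewrite ge0_fin_numE.
exists (fine (derivative_norm k h)); split; first by rewrite fineK.
  by rewrite fine_ge0.
suff main x y : x <= y ->
    `|h^`(k.-1)%classic y - h^`(k.-1)%classic x| <= fine (derivative_norm k h) * (y - x).
  move=> x y; have [xy|/ltW yx] := leP x y.
    by rewrite distrC (distrC x) (ger0_norm (x := y - x)) ?subr_ge0 // main.
  by rewrite (ger0_norm (x := x - y)) ?subr_ge0 // main.
move=> xy; move: (NE); rewrite /derivative_norm; case: asboolP => [hk|nhk] Nf.
  have kk : (k.-1 < k)%N by rewrite prednK.
  have dh (z : R) : is_derive z 1 h^`(k.-1)%classic (h^`(k)%classic z).
    split; first exact: hk kk z.
    by rewrite -derive1E -[in RHS](prednK k1).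
  apply: (der_lip xy (fun z _ => dh z)) => z _.
  rewrite -lee_fin fineK //; apply: ereal_sup_ubound; by exists z.
have km1 : k = m.
  apply/eqP; rewrite eqn_leq km' leqNgt; apply/negP => lt; apply: nhk => j jk z.
  by apply: hd; apply: leq_trans jk _; rewrite -ltnS prednK // (leq_ltn_trans _ lt).
have acl := hac x y xy; rewrite -km1 in acl.
apply: ac_lipschitz acl _ => //; first by rewrite fine_ge0 //; move: N0; rewrite /derivative_norm asboolF.
have H := @ess_sup_ge _ _ R mu (fun z => `|h^`(k)%classic z|%:E).
apply: (@filterS _ (almost_everywhere mu) (ae_filter_ringOfSetsType mu) _ _ _ H) => z /=.
rewrite -[X in (_ <= X)%E -> _](fineK Nf) lee_fin => Hz.
apply: le_trans _ Hz; rewrite -[in leRHS](prednK k1); exact: lexx.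
Qed.

End AbsolutelyContinuousLipschitz.

(** * Smoothing *)

Section SteklovMean.
Variable R : realType.
Local Notation mu := (@lebesgue_measure R).

Lemma lipschitz_continuous (h : R -> R) (L : R) : 0 <= L ->
  (forall x y, `|h x - h y| <= L * `|x - y|) -> continuous h.
Proof.
move=> L0 hL x; apply/cvgrPdist_lt => a a0; have L1 : 0 < L + 1 by lra.
near=> y.
have xy : `|x - y| < a / (L + 1).
  by near: y; apply: (@cvgr_dist_lt _ _ _ _ _ id x cvg_id); rewrite divr_gt0.
apply: le_lt_trans (hL x y) _; rewrite ltr_pdivlMr // in xy.
apply: le_lt_trans xy; have := normr_ge0 (x - y); nra.
Unshelve. all: by end_near. Qed.

Lemma steklov_mean (h : R -> R) (L e : R) : 0 < e -> 0 <= L ->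
  (forall x y, `|h x - h y| <= L * `|x - y|) ->
  exists k : R -> R, (forall x : R, is_derive x 1 k (e^-1 * (h (x + e) - h x))) /\
    forall x, `|k x - h x| <= L * e.
Proof.
move=> e0 L0 hL.
have ch := lipschitz_continuous L0 hL.
have ih a b : mu.-integrable `]a, b] (EFin \o h).
  have [ab|ba] := leP a b; last by rewrite set_itv_ge ?integrable_set0 // bnd_simp -leNgt ltW.
  have I : mu.-integrable `[a, b] (EFin \o h).
    by apply: continuous_compact_integrable; [exact: segment_compact|exact: continuous_subspaceT].
  by apply: integrableS I => //; exact: subset_itv_oc_cc.
(* [F a] is shown differentiable only beyond its base point [a]; near x the base point x - 1 is
   taken. *)
have [F dF FB] : exists2 F : R -> R -> R,
    (forall a x : R, a < x -> is_derive x 1 (F a) (h x)) &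
    forall a x : R, a <= x -> (\int[mu]_(t in `]x, x + e]) h t)%R = F a (x + e) - F a x.
  exists (fun a x => \int[mu]_(t in [set` Interval (BRight a) (BRight x)]) h t)%R => a x ax.
    have x1 : x < x + 1 by lra.
    have [|H1 H2] := continuous_FTC1 x1 (ih a (x + 1)) _ (ch x).
      by rewrite ?bnd_simp ?lte_fin.
    by split; [exact: H1|rewrite -derive1E; exact: H2].
  by rewrite Rintegral_itvB // bnd_simp //; lra.
pose k x := e^-1 * (\int[mu]_(t in `]x, x + e]) h t)%R.
exists k; split=> x.
  have xe (c : R) : is_derive c 1 (fun y : R => y + e) 1.
    by apply: der_eq (derD (der_id c) (der_cst e c)) _; rewrite addr0.
  have D : is_derive x 1 (fun y => e^-1 * (F (x - 1) (y + e) - F (x - 1) y))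
      (e^-1 * (h (x + e) - h x)).
    have d1 : is_derive x 1 (F (x - 1)) (h x) by apply: dF; lra.
    have d2 : is_derive (x + e) 1 (F (x - 1)) (h (x + e)) by apply: dF; lra.
    have d3 : is_derive x 1 (fun y => F (x - 1) (y + e)) (h (x + e)).
      by apply: der_eq (der_comp (g := fun y : R => y + e) d2 (xe x)) _; rewrite mulr1.
    exact: derZ (derB d3 d1).
  apply: near_eq_is_derive D; near=> y.
  rewrite /k (FB (x - 1)) //; apply: ltW; near: y; apply: lt_nbhsr; lra.
have xxe : x <= x + e by lra.
have D y : x <= y <= x + e -> is_derive y 1 (fun y => F (x - 1) y - h x * y) (h y - h x).
  move=> /andP[xy _]; apply: der_eq (derB (dF (x - 1) y _) (derZ (h x) (der_id y))) _.
    by lra.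
  by rewrite mulr1.
have := der_lip (M := L * e) xxe D _.
have H y : x <= y <= x + e -> `|h y - h x| <= L * e.
  move=> /andP[xy ye]; apply: le_trans (hL y x) _.
  by rewrite ler_wpM2l // ger0_norm ?subr_ge0 // lerBlDl.
move=> /(_ H); rewrite /k (FB (x - 1)); last by lra.
set a := F _ _; set b := F _ _ => ab.
have -> : e^-1 * (a - b) - h x = e^-1 * (a - h x * (x + e) - (b - h x * x)).
  by field; rewrite gt_eqF.
rewrite normrM gtr0_norm ?invr_gt0 // ler_pdivrMl //; apply: le_trans ab _.
by rewrite addrAC subrr add0r mulrC.
Unshelve. all: by end_near. Qed.

(** The derivative of order k + 1 of the Steklov mean is the difference quotient of h^(k) with step
    [e]. The Lipschitz constant of h^(k), that is L (k + 1), bounds it even for k + 1 = m, where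
    h^(m) may be missing at some points. *)
Lemma smoothing (m : nat) (h : R -> R) (e : R) (L := fun k => fine (derivative_norm k h)) :
  (1 <= m)%N -> class_Cb m h -> 0 < e ->
  exists he : nat -> R -> R, [/\
    forall k, (k < m)%N -> forall x : R, is_derive x 1 (he k) (he k.+1 x),
    forall k, (0 < k <= m)%N -> forall x, `|he k x| <= L k &
    forall x, `|he 0%N x - h x| <= L 1%N * e].
Proof.
move=> m1 hC e0; have [hd _ _] := hC.
have lip k : (0 < k <= m)%N -> 0 <= L k /\ forall x y,
    `|h^`(k.-1)%classic x - h^`(k.-1)%classic y| <= L k * `|x - y|.
  move=> km; have [l [Ek l0 H]] := derivative_norm_lipschitz hC km.
  by rewrite /L Ek.
have [|L0 hL] := lip 1%N; first by rewrite m1.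
have [k0 [dk0 k0h]] := steklov_mean e0 L0 hL.
exists (fun k => if k is k'.+1 then
  fun x => e^-1 * (h^`(k')%classic (x + e) - h^`(k')%classic x) else k0).
split; last exact: k0h.
  move=> [|k] km x; first exact: dk0.
  have dk y : is_derive (y : R) 1 h^`(k)%classic (h^`(k.+1)%classic y).
    split; first by apply: hd; rewrite -ltnS prednK.
    by rewrite -derive1E.
  have xe : is_derive x 1 (fun y : R => y + e) 1.
    by apply: der_eq (derD (der_id x) (der_cst e x)) _; rewrite addr0.
  have d3 : is_derive x 1 (fun y => h^`(k)%classic (y + e)) (h^`(k.+1)%classic (x + e)).
    by apply: der_eq (der_comp (g := fun y : R => y + e) (dk (x + e)) xe) _; rewrite mulr1.
  exact: derZ (derB d3 (dk x)).
move=> [//|k] km x.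
have [Lk H] := lip k.+1 km.
change (`|e^-1 * (h^`(k)%classic (x + e) - h^`(k)%classic x)| <= L k.+1).
have ev : 0 <= e^-1 by rewrite invr_ge0 ltW.
rewrite normrM (ger0_norm ev).
have := H (x + e) x; have -> : x + e - x = e by ring.
by rewrite (gtr0_norm e0) -(ler_pdivrMr _ _ e0) mulrC.
Qed.

End SteklovMean.

(** * Moments of sums *)

Section IntegrablePowers.
Context d (T : measurableType d) (R : realType) (P : probability T R).
Implicit Types Y Z : T -> R.

Lemma powR_normD_le (a y z : R) : 0 <= a ->
  `|y + z| `^ a <= 2 `^ a * (`|y| `^ a + `|z| `^ a).
Proof.
move=> a0; wlog yz : y z / `|y| <= `|z| => [H|].
  by have [/H //|/ltW /H] := leP `|y| `|z|; rewrite addrC [X in _ * X]addrC.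
apply: (@le_trans _ _ (2 `^ a * `|z| `^ a)); last first.
  by rewrite ler_wpM2l ?powR_ge0 // lerDr powR_ge0.
rewrite -powRM // ge0_ler_powR // ?nnegrE ?mulr_ge0 //.
by apply: le_trans (ler_normD _ _) _; lra.
Qed.

Lemma itg_powR_normD Y Z (a : R) : 0 <= a ->
  measurable_fun [set: T] Y -> measurable_fun [set: T] Z ->
  itg P (fun t => `|Y t| `^ a) -> itg P (fun t => `|Z t| `^ a) ->
  itg P (fun t => `|Y t + Z t| `^ a).
Proof.
move=> a0 mY mZ iY iZ; apply: itg_le (itgZ (2 `^ a) (itgD iY iZ)) => [|t].
  by apply: (measurableT_comp (measurable_norm_powR a)); exact: measurable_funD.
rewrite (ger0_norm (powR_ge0 _ _)).
by apply: le_trans (ler_norm _); exact: powR_normD_le.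
Qed.

Lemma itg_powR_normZ Y (c a : R) : itg P (fun t => `|Y t| `^ a) ->
  itg P (fun t => `|c * Y t| `^ a).
Proof.
move=> iY; have -> : (fun t => `|c * Y t| `^ a) = fun t => `|c| `^ a * `|Y t| `^ a.
  by apply/funext => t; rewrite normrM powRM.
exact: itgZ.
Qed.

Lemma itg_powR_norm_sum (I : finType) (p : pred I) (Y : I -> T -> R) (a : R) : 0 <= a ->
  (forall i, measurable_fun [set: T] (Y i)) ->
  (forall i, itg P (fun t => `|Y i t| `^ a)) ->
  measurable_fun [set: T] (fun t => \sum_(i | p i) Y i t) /\
  itg P (fun t => `|\sum_(i | p i) Y i t| `^ a).
Proof.
move=> a0 mY iY; elim: (index_enum I) => [|i s [mS iS]].
  under eq_fun => t do rewrite big_nil.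
  split; first exact: measurable_cst.
  under eq_fun => t do rewrite big_nil.
  exact: itg_cst.
under eq_fun => t do rewrite big_cons.
under [X in _ /\ itg _ X]eq_fun => t do rewrite big_cons.
by case: (p i) => //; split; [exact: measurable_funD|exact: itg_powR_normD].
Qed.

Lemma growth_ge0 (s : R) (f : R -> R) : growth s f -> exists2 C, 0 <= C &
  forall x, `|f x| <= C * (1 + `|x|) `^ s.
Proof.
move=> [C HC]; exists `|C| => // x; apply: le_trans (HC x) _.
by rewrite ler_wpM2r ?powR_ge0 // ler_norm.
Qed.

Lemma itg_growth (s : R) (f : R -> R) Y : 0 <= s -> measurable_fun [set: R] f ->
  growth s f -> measurable_fun [set: T] Y ->
  itg P (fun t => `|Y t| `^ s) -> itg P (fun t => f (Y t)).
Proof.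
move=> s0 mf /growth_ge0[C C0 HC] mY iY.
have i1 : itg P (fun t => `|1 + `|Y t| | `^ s).
  apply: itg_powR_normD => //; first exact: measurableT_comp.
    exact: (itg_cst P (`|1| `^ s)).
  by under eq_fun => t do rewrite normr_id.
apply: itg_le (itgZ C i1) => [|t]; first exact: (measurableT_comp mf mY).
apply: le_trans (HC _) _; rewrite [leRHS]ger0_norm ?mulr_ge0 ?powR_ge0 //.
by rewrite (ger0_norm (_ : 0 <= 1 + _)) ?addr_ge0.
Qed.

Lemma itg_growthM (s : R) (f : R -> R) Y Z : 0 <= s -> measurable_fun [set: R] f ->
  growth s f -> measurable_fun [set: T] Y -> measurable_fun [set: T] Z ->
  itg P (fun t => `|Y t| `^ (s + 1)) -> itg P (fun t => `|Z t| `^ (s + 1)) ->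
  itg P (fun t => Z t * f (Y t)).
Proof.
move=> s0 mf /growth_ge0[C C0 HC] mY mZ iY iZ.
have s1 : 0 <= s + 1 by lra.
have m1 : measurable_fun [set: T] (fun t => 1 + `|Y t|).
  by apply: measurable_funD => //; exact: measurableT_comp.
have mN : measurable_fun [set: T] (fun t => `|Z t|) by exact: measurableT_comp.
have i1 : itg P (fun t => `|1 + `|Y t| | `^ (s + 1)).
  apply: itg_powR_normD => //; first exact: measurableT_comp.
    exact: (itg_cst P (`|1| `^ (s + 1))).
  by under eq_fun => t do rewrite normr_id.
have i2 : itg P (fun t => `|(1 + `|Y t|) + `|Z t| | `^ (s + 1)).
  by apply: itg_powR_normD => //; under eq_fun => t do rewrite normr_id.
apply: itg_le (itgZ C i2) => [|t].
  by apply: measurable_funM => //; exact: (measurableT_comp mf mY).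
have y0 := normr_ge0 (Y t); have z0 := normr_ge0 (Z t).
(* A common majorant of |Z| and 1 + |Y| with integrable power s + 1 takes the place of Hölder's
   inequality. *)
set b := 1 + `|Y t| + `|Z t|; have b1 : 1 <= b by rewrite /b; lra.
have -> : `|C * `|b| `^ (s + 1)| = C * (b * b `^ s).
  rewrite ger0_norm ?mulr_ge0 ?powR_ge0 // (ger0_norm (_ : 0 <= b)); last by lra.
  rewrite addrC powRD ?powRr1 //; first by lra.
  by rewrite (gt_eqF (_ : 0 < b)) ?implybT //; lra.
rewrite normrM; apply: (@le_trans _ _ (b * (C * b `^ s))); last by rewrite mulrCA.
apply: ler_pM => //; first by rewrite /b; lra.
apply: le_trans (HC _) _; rewrite ler_wpM2l // ge0_ler_powR // ?nnegrE /b; lra.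
Qed.

End IntegrablePowers.

Section MomentMonotonicity.
Context d (T : measurableType d) (R : realType) (P : probability T R).
Implicit Types Y Z : T -> R.

(** Convexity of |.|^r at v. For r < 2 the exponent r - 2 is negative, but the factor v makes the
    linear term vanish at v = 0. *)
Lemma powR_normD_tangent (r v x : R) : 1 <= r ->
  `|v| `^ r + r * (v * `|v| `^ (r - 2) * x) <= `|v + x| `^ r.
Proof.
move=> r1; have [->|v0] := eqVneq v 0.
  by rewrite !mul0r mulr0 normr0 addr0 powR0 ?powR_ge0 // gt_eqF //; lra.
have l0 : 0 < `|v| by rewrite normr_gt0.
apply: le_trans (powR_ge_tangent r1 (normr_ge0 (v + x)) l0).
have -> : `|v| `^ (r - 2) = `|v| `^ r / `|v| ^+ 2.
  by rewrite powRB ?(gt_eqF l0) ?implybT // powR_mulrn.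
set q := `|v| `^ r; have q0 : 0 < q by rewrite powR_gt0.
have H : `|v| ^+ 2 + v * x <= `|v| * `|v + x|.
  by rewrite sqr_normE expr2 -mulrDr -normrM ler_norm.
have -> : r * q / `|v| * `|v + x| + (1 - r) * q =
    q + r * (q / `|v| ^+ 2 * (`|v| * `|v + x| - `|v| ^+ 2)).
  by field; rewrite gt_eqF.
rewrite lerD2l ler_wpM2l //; first by lra.
have -> : v * (q / `|v| ^+ 2) * x = q / `|v| ^+ 2 * (v * x) by ring.
by rewrite ler_wpM2l ?divr_ge0 ?(ltW q0) ?sqr_ge0 //; lra.
Qed.

(** In the tangent inequality at Y the linear term has expectation 0, because Z is centered and
    independent of Y. *)
Lemma centered_moment_le Y Z (r : R) : 1 <= r ->
  measurable_fun [set: T] Y -> measurable_fun [set: T] Z -> indep P Y Z ->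
  itg P (fun t => `|Y t| `^ r) -> itg P (fun t => `|Z t| `^ r) ->
  itg P Z -> Ex P Z = 0 ->
  Ex P (fun t => `|Y t| `^ r) <= Ex P (fun t => `|Y t + Z t| `^ r).
Proof.
move=> r1 mY mZ YZ iY iZ iZ1 EZ.
pose q (v : R) := v * `|v| `^ (r - 2).
have mq : measurable_fun [set: R] q.
  by apply: measurable_funM => //; exact: measurable_norm_powR.
have qE v : `|q v| <= `|v| `^ (r - 1).
  have [->|v0] := eqVneq v 0; first by rewrite /q mul0r normr0 powR_ge0.
  rewrite /q normrM (ger0_norm (powR_ge0 _ _)) (_ : r - 1 = 1 + (r - 2)); last by ring.
  by rewrite [leRHS]powRD ?normr_eq0 ?v0 ?implybT // powRr1.
have ir : itg P (fun t => `|Y t| `^ (r - 1)).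
  by apply: itg_norm_powR_le iY => //; apply/andP; split; lra.
have iq : itg P (fun t => q (Y t)).
  apply: itg_le ir => [|t]; first exact: (measurableT_comp mq mY).
  by apply: le_trans (qE _) (ler_norm _).
have mid : measurable_fun [set: R] (id : R -> R) by exact: measurable_id.
have [iqZ EqZ] := indep_prod (indep_comp YZ mq mid) iq iZ1.
have <- : Ex P (fun t => `|Y t| `^ r + r * (q (Y t) * Z t)) = Ex P (fun t => `|Y t| `^ r).
  rewrite ExD //; last exact: itgZ.
  by rewrite ExZ // [X in r * X](_ : _ = 0) ?mulr0 ?addr0 // EqZ /= EZ mulr0.
apply: Ex_le => [||t]; first by apply: itgD => //; exact: itgZ.
  by apply: itg_powR_normD => //; lra.
exact: powR_normD_tangent.
Qed.

End MomentMonotonicity.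

(** * The Stein expansion *)

(** With k = m this merges the two Taylor remainders into the factor m + 2 = p + 1 of the
    theorem. *)
Lemma weighted_le (R : realDomainType) (k x y : R) : 0 <= k -> x <= y ->
  (k + 1) * x + y <= (k + 2) * y.
Proof. by move=> k0 xy; nra. Qed.

Section SteinExpansion.
Context d (T : measurableType d) (R : realType) (P : probability T R).
Variables (n : nat) (X : 'I_n -> {RV P >-> R}) (m : nat) (r s a b : R).
Variable phi : nat -> R -> R.
Hypothesis indX : mutually_independent X.
Hypotheses (r0 : 0 <= r) (s0 : 0 < s) (sn : s ^+ 2 * n%:R = 1) (a0 : 0 <= a) (b0 : 0 <= b).
Hypothesis dphi : forall k, (k <= m)%N -> forall x : R, is_derive x 1 (phi k) (phi k.+1 x).
Hypothesis gphi : forall k, (k <= m.+1)%N -> growth (r + (m.+1 - k)%:R) (phi k).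
Hypothesis bphi : forall x, `|phi m.+1 x| <= a + b * `|x| `^ r.
Hypothesis momX : forall i k, (k <= m.+1)%N ->
  Ex P (fun t => X i t ^+ k) = Ex gamma (fun x : R => x ^+ k).
Hypothesis finX : forall i, itg P (fun t => `|X i t| `^ (r + m.+3%:R)).

Let xi i t := s * X i t.
Let V i t := s * \sum_(j | j != i) X j t.
Let W t := s * \sum_j X j t.

Lemma sum_split i t : W t = V i t + xi i t.
Proof. by rewrite /W /V /xi (bigD1 i) //= mulrDr addrC. Qed.

Lemma measurable_summand i : measurable_fun [set: T] (X i).
Proof. exact: measurable_funP. Qed.

Lemma itg_summand i c : 0 <= c <= r + m.+3%:R -> itg P (fun t => `|X i t| `^ c).
Proof. by move=> cr; apply: itg_norm_powR_le (finX i) => //; exact: measurable_summand. Qed.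

Lemma itg_xi i c : 0 <= c <= r + m.+3%:R -> itg P (fun t => `|xi i t| `^ c).
Proof. by move=> cr; apply: itg_powR_normZ; exact: itg_summand. Qed.

Lemma measurable_xi i : measurable_fun [set: T] (xi i).
Proof. by apply: measurable_funM => //; exact: measurable_summand. Qed.

Lemma partial_sum_itg (p : pred 'I_n) c : 0 <= c <= r + m.+3%:R ->
  measurable_fun [set: T] (fun t => s * \sum_(j | p j) X j t) /\
  itg P (fun t => `|s * \sum_(j | p j) X j t| `^ c).
Proof.
move=> cr; have /andP[c0 _] := cr.
have [mS iS] := itg_powR_norm_sum p c0 measurable_summand (fun i => itg_summand i cr).
by split; [exact: measurable_funM|exact: itg_powR_normZ].
Qed.

Lemma moment_range0 : 0 <= (0 : R) <= r + m.+3%:R.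
Proof. by rewrite lexx addr_ge0. Qed.

Lemma measurable_V i : measurable_fun [set: T] (V i).
Proof. by have [] := partial_sum_itg (fun j => j != i) moment_range0. Qed.

Lemma measurable_W : measurable_fun [set: T] W.
Proof. by have [] := partial_sum_itg predT moment_range0. Qed.

Lemma itg_V i c : 0 <= c <= r + m.+3%:R -> itg P (fun t => `|V i t| `^ c).
Proof. by move=> cr; have [] := partial_sum_itg (fun j => j != i) cr. Qed.

Lemma itg_W c : 0 <= c <= r + m.+3%:R -> itg P (fun t => `|W t| `^ c).
Proof. by move=> cr; have [] := partial_sum_itg predT cr. Qed.

Lemma indep_V i : indep P (V i) (xi i).
Proof.
have mid : measurable_fun [set: R] (id : R -> R) by exact: measurable_id.
apply: (indep_comp (f := id) (q := fun x => s * x)) => //.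
  exact: mutually_independent_sum.
exact: measurable_funM.
Qed.

Lemma measurable_phi k : (k <= m)%N -> measurable_fun [set: R] (phi k).
Proof. by move=> km; apply: continuous_measurable; exact: der_continuous (dphi km). Qed.

Lemma moment_range k : (k <= m.+3)%N ->
  0 <= (k%:R : R) <= r + m.+3%:R /\ 0 <= r + k%:R <= r + m.+3%:R.
Proof.
move=> km; have k3 : k%:R <= m.+3%:R :> R by rewrite ler_nat.
have r0' : 0 <= r := r0.
by have := ler0n R k; split; apply/andP; split; lra.
Qed.

Lemma itg_xi_expn i k : (k <= m.+3)%N -> itg P (fun t => xi i t ^+ k).
Proof.
move=> km; have [ck _] := moment_range km.
apply: itg_le (itg_xi i ck) => [|t]; first exact: measurable_funX (measurable_xi i).
by rewrite powR_mulrn // !normrX normr_id.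
Qed.

Lemma itg_phi_V i k : (k <= m)%N -> itg P (fun t => phi k (V i t)).
Proof.
move=> km; apply: itg_growth (measurable_V i) _; last first.
- have [|_ cr] := @moment_range (m.+1 - k); last exact: itg_V cr.
  by apply: leq_trans (leq_subr _ _) _; apply: ltnW.
- by apply: gphi; exact: leqW.
- exact: measurable_phi.
- exact: addr_ge0.
Qed.

Lemma itg_phi1_W : (1 <= m)%N -> itg P (fun t => phi 1%N (W t)).
Proof.
move=> m1; apply: itg_growth measurable_W _; last first.
- have [|_ cr] := @moment_range (m.+1 - 1); last exact: itg_W cr.
  by apply: leq_trans (leq_subr _ _) _; apply: ltnW.
- exact: gphi.
- exact: measurable_phi.
- exact: addr_ge0.
Qed.

Lemma itg_phi0_W (Z : T -> R) : measurable_fun [set: T] Z ->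
  (forall c, 0 <= c <= r + m.+3%:R -> itg P (fun t => `|Z t| `^ c)) ->
  itg P (fun t => Z t * phi 0%N (W t)).
Proof.
move=> mZ iZ; have cr : 0 <= r + (m.+1 - 0)%:R + 1 <= r + m.+3%:R.
  by rewrite !addr_ge0 //= subn0 -addrA natr1 lerD2l ler_nat.
apply: (itg_growthM _ _ (gphi (leq0n _)) measurable_W mZ (itg_W cr) (iZ _ cr)).
  exact: addr_ge0.
exact: measurable_phi.
Qed.

(** The coefficient of phi^(k) (y) in the Taylor expansion of s^2 phi' (y + x) - x phi (y + x) about
    y. At k = 0 the truncated exponent [k.-1] is harmless because of the factor [k%:R]. *)
Let q k (x : R) : R := (s ^+ 2 * k%:R * x ^+ k.-1 - x ^+ k.+1) / k`!%:R.

(* Every [q k (xi i)] is centered, so the sum does not change the expectation. *)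
Definition stein_rem (y x : R) : R :=
  s ^+ 2 * phi 1%N (y + x) - x * phi 0%N (y + x) - \sum_(k < m.+1) phi k y * q k x.

(** phi' is expanded to order m and phi to order m + 1, so both remainders involve phi^(m+1),
    evaluated at points of modulus at most |y| + |x|. *)
Lemma stein_rem_bound y x : `|stein_rem y x| <=
  (s ^+ 2 * m.+1%:R * `|x| ^+ m + `|x| ^+ m.+2) / m.+1`!%:R * (a + b * (`|y| + `|x|) `^ r).
Proof.
set M := a + _.
have phiM z : `|z - y| <= `|x| -> `|phi m.+1 z| <= M.
  move=> zy; apply: le_trans (bphi z) _; rewrite /M lerD2l ler_wpM2l //.
  rewrite ge0_ler_powR ?nnegrE ?addr_ge0 //.
  by rewrite -(subrK y z) addrC (le_trans (ler_normD _ _)) // lerD2l.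
have T0 := @taylor_bound R m.+1 phi y x M (fun k km => dphi (km : (k <= m)%N)) phiM.
have T1 := @taylor_bound R m (fun k => phi k.+1) y x M (fun k km => dphi km) phiM.
have s2 : 0 < s ^+ 2 by rewrite exprn_gt0.
set t0 := `|_ - _| in T0; set t1 := `|_ - _| in T1.
apply: (@le_trans _ _ (s ^+ 2 * t1 + `|x| * t0)).
  have -> : stein_rem y x =
      s ^+ 2 * (phi 1%N (y + x) - \sum_(k < m) phi k.+1 y * x ^+ k / k`!%:R) -
      x * (phi 0%N (y + x) - \sum_(k < m.+1) phi k y * x ^+ k / k`!%:R).
    have -> : \sum_(k < m) phi k.+1 y * x ^+ k / k`!%:R =
        \sum_(k < m.+1) phi k y * (k%:R * x ^+ k.-1 / k`!%:R).
      rewrite big_ord_recl /= mul0r mul0r mulr0 add0r; apply: eq_bigr => k _.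
      rewrite /bump /= add1n factS natrM.
      have u0 : (k.+1%:R : R) != 0 by rewrite pnatr_eq0.
      have v0 : (k`!%:R : R) != 0 by rewrite pnatr_eq0 -lt0n fact_gt0.
      by move: (k.+1%:R : R) (k`!%:R : R) u0 v0 => u v u0 v0; field; rewrite u0 v0.
    rewrite /stein_rem !mulrBr !mulr_sumr.
    have -> : \sum_(k < m.+1) phi k y * q k x =
        \sum_(k < m.+1) s ^+ 2 * (phi k y * (k%:R * x ^+ k.-1 / k`!%:R)) -
        \sum_(k < m.+1) x * (phi k y * x ^+ k / k`!%:R).
      by rewrite -sumrB; apply: eq_bigr => k _; rewrite /q (exprS x k); ring.
    ring.
  apply: le_trans (ler_normB _ _) _.
  by rewrite (normrM (s ^+ 2)) (normrM x) (gtr0_norm s2) lexx.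
have H0 : `|x| * t0 <= `|x| * (M * `|x| ^+ m.+1 / m.+1`!%:R) by rewrite ler_wpM2l.
have H1 : s ^+ 2 * t1 <= s ^+ 2 * (M * `|x| ^+ m / m`!%:R) by rewrite ler_pM2l.
apply: le_trans (lerD H1 H0) _; rewrite le_eqVlt; apply/orP; left; apply/eqP.
rewrite factS natrM !exprS.
have u0 : (m.+1%:R : R) != 0 by rewrite pnatr_eq0.
have v0 : (m`!%:R : R) != 0 by rewrite pnatr_eq0 -lt0n fact_gt0.
by move: (m.+1%:R : R) (m`!%:R : R) u0 v0 => u v u0 v0; field; rewrite u0 v0.
Qed.

Lemma Ex_xi_expn i k : (k <= m.+1)%N ->
  Ex P (fun t => xi i t ^+ k) = s ^+ k * Ex gamma (fun x : R => x ^+ k).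
Proof.
move=> km; rewrite -(momX i km).
have -> : (fun t => xi i t ^+ k) = fun t => s ^+ k * X i t ^+ k.
  by apply/funext => t; rewrite /xi exprMn.
rewrite ExZ //; have [|ck _] := @moment_range k; first by apply: leq_trans km _; do 2! apply: leqW.
apply: itg_le (itg_summand i ck) => [|t].
  exact: measurable_funX (measurable_summand i).
by rewrite powR_mulrn // !normrX normr_id.
Qed.

Lemma Ex_stein_coef i k : (k <= m)%N ->
  itg P (fun t => q k (xi i t)) /\ Ex P (fun t => q k (xi i t)) = 0.
Proof.
move=> km.
have k1 : (k.-1 <= m.+1)%N by apply: leq_trans (leq_pred _) _; exact: leqW.
have i1 : itg P (fun t => s ^+ 2 * k%:R * xi i t ^+ k.-1).
  by apply: itgZ; apply: itg_xi_expn; apply: leq_trans k1 _; do 2! apply: leqW.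
have i2 : itg P (fun t => xi i t ^+ k.+1).
  apply: itg_xi_expn; apply: leq_trans (_ : (m.+1 <= _)%N); first exact: km.
  by do 2! apply: leqW.
have -> : (fun t => q k (xi i t)) = fun t =>
    (k`!%:R)^-1 * (s ^+ 2 * k%:R * xi i t ^+ k.-1 - xi i t ^+ k.+1).
  by apply/funext => t; rewrite /q mulrC.
split; first by apply: itgZ; exact: itgB.
rewrite ExZ ?ExB //; last exact: itgB.
rewrite ExZ; last by apply: itg_xi_expn; apply: leq_trans k1 _; do 2! apply: leqW.
rewrite !Ex_xi_expn //; case: k {k1 i1 i2} km => [|k] km /=.
  have -> : (fun x : R => x ^+ 1) = fun x => x by apply/funext => x; rewrite expr1.
  by rewrite gaussian_moment1; ring.
by rewrite gaussian_moment_rec !exprS; ring.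
Qed.

Lemma Ex_stein_rem i : (1 <= m)%N -> itg P (fun t => stein_rem (V i t) (xi i t)) /\
  Ex P (fun t => stein_rem (V i t) (xi i t)) =
  Ex P (fun t => s ^+ 2 * phi 1%N (W t) - xi i t * phi 0%N (W t)).
Proof.
move=> m1.
have mq k : measurable_fun [set: R] (q k).
  by apply: measurable_funM => //; apply: measurable_funB; [apply: measurable_funM|].
have H (k : 'I_m.+1) : itg P (fun t => phi k (V i t) * q k (xi i t)) /\
    Ex P (fun t => phi k (V i t) * q k (xi i t)) = 0.
  have km : (k <= m)%N by rewrite -ltnS.
  have [iq Eq] := Ex_stein_coef i km.
  have [i1 ->] := indep_prod (indep_comp (@indep_V i) (measurable_phi km) (mq k))
    (itg_phi_V i km) iq.
  by rewrite [X in _ * X]Eq mulr0.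
have iA : itg P (fun t => s ^+ 2 * phi 1%N (W t) - xi i t * phi 0%N (W t)).
  apply: itgB; first by apply: itgZ; exact: itg_phi1_W.
  by apply: itg_phi0_W; [exact: measurable_xi|exact: itg_xi].
have iS : itg P (fun t => \sum_(k < m.+1) phi k (V i t) * q k (xi i t)).
  by apply: itg_sum => k; have [] := H k.
have -> : (fun t => stein_rem (V i t) (xi i t)) = fun t =>
    (s ^+ 2 * phi 1%N (W t) - xi i t * phi 0%N (W t)) -
    \sum_(k < m.+1) phi k (V i t) * q k (xi i t).
  by apply/funext => t; rewrite /stein_rem -sum_split.
split; first exact: itgB.
rewrite ExB // Ex_sum => [|k]; last by have [] := H k.
by rewrite big1 ?subr0 // => k _; have [] := H k.
Qed.

Lemma stein_expansion : (1 <= m)%N ->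
  Ex P (fun t => phi 1%N (W t) - W t * phi 0%N (W t)) =
  \sum_i Ex P (fun t => stein_rem (V i t) (xi i t)).
Proof.
move=> m1; under eq_bigr => i _ do rewrite (Ex_stein_rem i m1).2.
rewrite -Ex_sum => [|i]; last first.
  apply: itgB; first by apply: itgZ; exact: itg_phi1_W.
  by apply: itg_phi0_W; [exact: measurable_xi|exact: itg_xi].
(* The n equal terms s^2 phi' (W) add up to phi' (W) since s^2 n = 1. *)
congr Ex; apply/funext => t; rewrite sumrB sumr_const card_ord -mulr_suml -mulr_natl.
by rewrite -mulr_sumr -/(W t) mulrA (mulrC n%:R) sn mul1r.
Qed.

Let M i c : R := Ex P (fun t => `|X i t| `^ c).

Lemma second_moment i : (1 <= m)%N -> Ex P (fun t => X i t ^+ 2) = 1.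
Proof. by move=> m1; rewrite momX // gaussian_moment2. Qed.

Lemma summand_moment_le i c c' : (1 <= m)%N -> 0 <= c <= c' -> 2 <= c' -> c' <= r + m.+3%:R ->
  M i c <= M i c'.
Proof.
move=> m1 cc c2 cr; apply: (moment_le (measurable_summand i)) => //.
  by apply: itg_summand; apply/andP; split => //; lra.
exact: second_moment.
Qed.

(** Independence of [V i] and [X i] factors the expectation of the bound on the remainder, and E
    X_i^2 = 1 raises the orders m and r + m to m + 2 and r + m + 2. The constant [cr] stays open
    because its value depends on whether r >= 1. *)
Lemma Ex_stein_rem_le i (cr : R) : (1 <= m)%N -> 0 <= cr ->
  (forall x y, 0 <= x -> 0 <= y -> (x + y) `^ r <= cr * (x `^ r + y `^ r)) ->
  `|Ex P (fun t => stein_rem (V i t) (xi i t))| <=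
  s ^+ m.+2 / m.+1`!%:R * (m.+2%:R * (a * M i m.+2%:R +
    b * cr * (M i m.+2%:R * Ex P (fun t => `|V i t| `^ r) + s `^ r * M i (r + m.+2%:R)))).
Proof.
move=> m1 cr0 Hcr; have [iR _] := Ex_stein_rem i m1; have r0' : 0 <= r := r0.
have a0' : 0 <= a := a0; have b0' : 0 <= b := b0; have s0' : 0 < s := s0.
apply: le_trans (Ex_norm iR) _.
have m0 : 0 < m%:R :> R by rewrite ltr0n.
have mS : m.+1%:R = m%:R + 1 :> R by rewrite natr1.
have mSS : m.+2%:R = m%:R + 2 :> R by rewrite -!natr1; ring.
have mSSS : m.+3%:R = m%:R + 3 :> R by rewrite -!natr1; ring.
have iX c : 0 <= c <= r + m.+3%:R -> itg P (fun t => `|X i t| `^ c) by exact: itg_summand.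
have iVr : itg P (fun t => `|V i t| `^ r) by apply: itg_V; apply/andP; split; lra.
have VX : indep P (V i) (X i) by exact: mutually_independent_sum.
have iVX c : 0 <= c <= r + m.+3%:R ->
    itg P (fun t => `|V i t| `^ r * `|X i t| `^ c) /\
    Ex P (fun t => `|V i t| `^ r * `|X i t| `^ c) = Ex P (fun t => `|V i t| `^ r) * M i c.
  move=> Hc; exact: (indep_prod (indep_comp VX (measurable_norm_powR r)
    (measurable_norm_powR c)) iVr (iX _ Hc)).
have Hm : 0 <= (m%:R : R) <= r + m.+3%:R by apply/andP; split; lra.
have Hm2 : 0 <= (m.+2%:R : R) <= r + m.+3%:R by apply/andP; split; lra.
have Hrm : 0 <= r + m%:R <= r + m.+3%:R by apply/andP; split; lra.
have Hrm2 : 0 <= r + m.+2%:R <= r + m.+3%:R by apply/andP; split; lra.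
have [i1 E1] := iVX _ Hm; have [i2 E2] := iVX _ Hm2.
set c0 := s ^+ m.+2 / m.+1`!%:R.
have c00 : 0 <= c0 by rewrite divr_ge0 // exprn_ge0 // ltW.
pose G t := c0 * (a * (m.+1%:R * `|X i t| `^ m%:R + `|X i t| `^ m.+2%:R) +
  b * cr * ((m.+1%:R * (`|V i t| `^ r * `|X i t| `^ m%:R) +
    `|V i t| `^ r * `|X i t| `^ m.+2%:R) +
    s `^ r * (m.+1%:R * `|X i t| `^ (r + m%:R) + `|X i t| `^ (r + m.+2%:R)))).
have j1 : itg P (fun t => m.+1%:R * `|X i t| `^ m%:R + `|X i t| `^ m.+2%:R).
  by apply: itgD (iX _ Hm2); apply: itgZ; exact: iX.
have j2 : itg P (fun t => m.+1%:R * (`|V i t| `^ r * `|X i t| `^ m%:R) +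
    `|V i t| `^ r * `|X i t| `^ m.+2%:R) by apply: itgD i2; exact: itgZ.
have j3 : itg P (fun t => m.+1%:R * `|X i t| `^ (r + m%:R) + `|X i t| `^ (r + m.+2%:R)).
  by apply: itgD (iX _ Hrm2); apply: itgZ; exact: iX.
have j23 := itgD j2 (itgZ (s `^ r) j3).
have iG : itg P G by apply: itgZ; apply: itgD; apply: itgZ.
apply: (@le_trans _ _ (Ex P G)).
  apply: Ex_le => [||t] //; first exact: itg_norm.
  apply: le_trans (stein_rem_bound _ _) _.
  have Xr c : 0 < c -> `|X i t| `^ (r + c) = `|X i t| `^ r * `|X i t| `^ c.
    by move=> cp; rewrite powRD // gt_eqF // ltr_wpDl.
  rewrite /G (Xr m%:R m0) (Xr m.+2%:R (ltr0Sn _ _)).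
  rewrite !powR_mulrn // /xi normrM (gtr0_norm s0) !exprMn.
  have := Hcr `|V i t| (s * `|X i t|) (normr_ge0 _) (mulr_ge0 (ltW s0) (normr_ge0 _)).
  rewrite powRM // ?(ltW s0) //.
  set v := `|V i t| `^ r; set x := `|X i t|; set w := x `^ r; set sr := s `^ r => HH.
  have x0 : 0 <= x by exact: normr_ge0.
  have xm : 0 <= m.+1%:R * x ^+ m + x ^+ m.+2 by apply: addr_ge0; [apply: mulr_ge0 => //|]; apply: exprn_ge0.
  have -> : (s ^+ 2 * m.+1%:R * (s ^+ m * x ^+ m) + s ^+ m.+2 * x ^+ m.+2) / m.+1`!%:R =
      c0 * (m.+1%:R * x ^+ m + x ^+ m.+2).
    by rewrite /c0 !exprS; ring.
  have -> : c0 * (a * (m.+1%:R * x ^+ m + x ^+ m.+2) + b * cr * (m.+1%:R * (v * x ^+ m) +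
      v * x ^+ m.+2 + sr * (m.+1%:R * (w * x ^+ m) + w * x ^+ m.+2))) =
      c0 * (m.+1%:R * x ^+ m + x ^+ m.+2) * (a + b * (cr * (v + sr * w))) by ring.
  apply: ler_wpM2l; first exact: mulr_ge0.
  by rewrite lerD2l; apply: ler_wpM2l.
have k0 := iX _ Hm; have k2 := iX _ Hm2; have k3 := iX _ Hrm; have k4 := iX _ Hrm2.
rewrite /G (ExZ c0 (itgD (itgZ a j1) (itgZ (b * cr) j23))).
rewrite (ExD (itgZ a j1) (itgZ (b * cr) j23)) (ExZ a j1) (ExZ (b * cr) j23).
rewrite (ExD j2 (itgZ (s `^ r) j3)) (ExZ (s `^ r) j3).
rewrite (ExD (itgZ m.+1%:R k0) k2) (ExZ m.+1%:R k0) (ExD (itgZ m.+1%:R i1) i2).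
rewrite (ExZ m.+1%:R i1) E1 E2 (ExD (itgZ m.+1%:R k3) k4) (ExZ m.+1%:R k3).
apply: ler_wpM2l => //.
have H1 : M i m%:R <= M i m.+2%:R.
  apply: summand_moment_le m1 _ _ _; last by case/andP: Hm2.
    by rewrite ler0n ler_nat -addn2 leq_addr.
  by rewrite ler_nat.
have H2 : M i (r + m%:R) <= M i (r + m.+2%:R).
  apply: summand_moment_le m1 _ _ _; last by case/andP: Hrm2.
    by rewrite addr_ge0 //= lerD2l ler_nat -addn2 leq_addr.
  by rewrite -[leLHS]add0r lerD // ler_nat.
have v0 : 0 <= Ex P (fun t => `|V i t| `^ r) by apply: Ex_ge0 => t; exact: powR_ge0.
have sr0 : 0 <= s `^ r by exact: powR_ge0.
move: H1 H2 v0 sr0; rewrite -/(M i m%:R) -/(M i m.+2%:R).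
rewrite -/(M i (r + m%:R)) -/(M i (r + m.+2%:R)).
move: (M i m%:R) (M i m.+2%:R) (M i (r + m%:R)) (M i (r + m.+2%:R)) => M0 M2 M3 M4.
move: (Ex _ _) (_ `^ _) => v sr H1 H2 v0 sr0.
rewrite mSS mS; move: m0; set k : R := m%:R => m0.
have B1 := weighted_le (ltW m0) H1; have B2 := weighted_le (ltW m0) H2.
apply: (@le_trans _ _ (a * ((k + 2) * M2) + b * cr * (v * ((k + 2) * M2) +
    sr * ((k + 2) * M4)))); last by rewrite le_eqVlt; apply/orP; left; apply/eqP; ring.
apply: lerD; apply: ler_wpM2l => //; first exact: mulr_ge0.
apply: lerD; last exact: ler_wpM2l.
have -> : (k + 1) * (v * M0) + v * M2 = v * ((k + 1) * M0 + M2) by ring.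
exact: ler_wpM2l.
Qed.

Lemma summand_moment_ge0 i c : 0 <= M i c.
Proof. by apply: Ex_ge0 => t; exact: powR_ge0. Qed.

Lemma Ex_xi i : Ex P (xi i) = 0 /\ itg P (xi i).
Proof.
have E := Ex_xi_expn i (isT : (1 <= m.+1)%N); have I := @itg_xi_expn i 1 isT.
have e : (fun t => xi i t ^+ 1) = xi i by apply/funext => t; rewrite expr1.
rewrite e in E I; split => //; rewrite E.
have -> : (fun x : R => x ^+ 1) = fun x => x by apply/funext => x; rewrite expr1.
by rewrite gaussian_moment1 mulr0.
Qed.

(** For r >= 1, convexity and centering give E|V i|^r <= E|W|^r. For r < 1 subadditivity gives this
    only up to s^r E|X_i|^r; the extra term goes into the summand of order r + m + 3, with the help
    of the smaller [stein_coef]. *)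
Lemma partial_sum_moment_le i : (1 <= m)%N -> exists2 cr : R, 0 <= cr &
  (forall x y, 0 <= x -> 0 <= y -> (x + y) `^ r <= cr * (x `^ r + y `^ r)) /\
  stein_coef r * cr * (M i m.+2%:R * Ex P (fun t => `|V i t| `^ r) +
    s `^ r * M i (r + m.+2%:R)) <=
  2 `^ r * (2 `^ (r + 1) * M i m.+2%:R * Ex P (fun t => `|W t| `^ r) +
    2 `^ (r + 2) * s `^ r * M i (r + m.+3%:R)).
Proof.
move=> m1; have r0' : 0 <= r := r0; have s0' : 0 < s := s0.
have M20 := summand_moment_ge0 i m.+2%:R; have M30 := summand_moment_ge0 i (r + m.+3%:R).
have M40 := summand_moment_ge0 i (r + m.+2%:R).
have rr : 0 <= r <= r + m.+3%:R by rewrite r0' /= lerDl.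
have W0 : 0 <= Ex P (fun t => `|W t| `^ r) by apply: Ex_ge0 => t; exact: powR_ge0.
have sr0 : 0 <= s `^ r by exact: powR_ge0.
have p2 : 1 <= 2 `^ r :> R by rewrite -[leLHS](powRr0 2) ler_powR // ler1n.
have e1 : 2 `^ (r + 1) = 2 * 2 `^ r :> R by rewrite powRD ?pnatr_eq0 ?implybT // powRr1 // mulrC.
have e2 : 2 `^ (r + 2) = 4 * 2 `^ r :> R.
  by rewrite powRD ?pnatr_eq0 ?implybT // powR_mulrn // mulrC; congr (_ * _); ring.
have H23 : M i (r + m.+2%:R) <= M i (r + m.+3%:R).
  apply: summand_moment_le m1 _ _ _ => //.
    by rewrite addr_ge0 //= lerD2l ler_nat.
  by rewrite -[leLHS]add0r lerD // ler_nat.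
have iVr := itg_V i rr; have iWr := itg_W rr; have ixr := itg_xi i rr.
have [r1|r1] := leP 1 r.
  exists (2 `^ (r - 1)); first exact: powR_ge0.
  split; first by move=> x y x0 y0; exact: powRD_convex.
  have VW : Ex P (fun t => `|V i t| `^ r) <= Ex P (fun t => `|W t| `^ r).
    have [Exi ixi] := Ex_xi i.
    have := centered_moment_le r1 (measurable_V i) (measurable_xi i) (@indep_V i) iVr ixr ixi Exi.
    by under [X in _ <= Ex _ X -> _]eq_fun => t do rewrite -sum_split.
  have e3 : 2 `^ (r - 1) = 2^-1 * 2 `^ r :> R.
    by rewrite powRD ?pnatr_eq0 ?implybT // powR_inv1 // mulrC.
  rewrite /stein_coef r1 e1 e2 e3.
  move: (Ex P (fun t => `|W t| `^ r)) (Ex P (fun t => `|V i t| `^ r)) W0 VW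
    (M i m.+2%:R) (M i (r + m.+2%:R)) (M i (r + m.+3%:R)) M20 M40 M30 H23 (s `^ r) sr0 (2 `^ r) p2.
  move=> w v w0 vw M2 M4 M3 M20 M40 M30 H23 sr sr0 y y1.
  have -> : 4 * y * (2^-1 * y) * (M2 * v + sr * M4) = y ^+ 2 * (2 * (M2 * v) + 2 * (sr * M4)).
    by field.
  have -> : y * (2 * y * M2 * w + 4 * y * sr * M3) = y ^+ 2 * (2 * (M2 * w) + 4 * (sr * M3)).
    by ring.
  have H1 := ler_wpM2l M20 vw; have H2 := ler_wpM2l sr0 H23; have H3 := mulr_ge0 sr0 M30.
  by apply: ler_wpM2l; [exact: sqr_ge0|lra].
exists 1 => //; split.
  by move=> x y x0 y0; rewrite mul1r; apply: powRD_concave => //; rewrite r0' ltW.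
have VW : Ex P (fun t => `|V i t| `^ r) <= Ex P (fun t => `|W t| `^ r) + s `^ r * M i r.
  rewrite -ExZ; last exact: itg_summand.
  rewrite -ExD //; last by apply: itgZ; exact: itg_summand.
  apply: Ex_le => [||t] //; first by apply: itgD => //; apply: itgZ; exact: itg_summand.
  have -> : V i t = W t - xi i t by rewrite (sum_split i) addrK.
  have sE : s `^ r * `|X i t| `^ r = `|xi i t| `^ r.
    by rewrite /xi normrM (gtr0_norm s0) powRM // ltW.
  rewrite sE.
  have rr1 : 0 <= r <= 1 by rewrite r0' ltW.
  apply: le_trans _ (powRD_concave rr1 (normr_ge0 _) (normr_ge0 _)).
  by rewrite ge0_ler_powR ?nnegrE ?addr_ge0 //; exact: ler_normB.
(* Here r < 1 <= 2, so the moment is compared with E X_i^2 = 1. *)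
have Mr : M i r <= 1.
  rewrite -(second_moment i m1).
  have -> : Ex P (fun t => X i t ^+ 2) = M i 2.
    by congr Ex; apply/funext => t; rewrite powR_mulrn // sqr_normE.
  apply: summand_moment_le m1 _ _ _; first by rewrite r0' /= (le_trans (ltW r1)) // ler1n.
    exact: lexx.
  by rewrite -[leLHS]add0r lerD // ler_nat.
have M23 : M i m.+2%:R <= M i (r + m.+3%:R).
  apply: summand_moment_le m1 _ _ _ => //.
    by rewrite ler0n /= -[leLHS]add0r lerD // ler_nat.
  by rewrite -[leLHS]add0r lerD // ler_nat.
have Mr0 := summand_moment_ge0 i r.
rewrite /stein_coef (lt_geF r1) mulr1 e1 e2.
move: (Ex P (fun t => `|W t| `^ r)) (Ex P (fun t => `|V i t| `^ r)) (M i r)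
  (M i m.+2%:R) (M i (r + m.+2%:R)) (M i (r + m.+3%:R)) (s `^ r) (2 `^ r)
  W0 VW Mr0 Mr M20 M40 M30 H23 M23 sr0 p2.
move=> w v Mr M2 M4 M3 sr y w0 vw Mr0 Mr1 M20 M40 M30 H23 M23 sr0 y1.
have H1 : M2 * v <= M2 * w + sr * M3.
  apply: le_trans (ler_wpM2l M20 vw) _; rewrite mulrDr lerD2l mulrCA.
  by apply: ler_wpM2l => //; apply: le_trans M23; rewrite ler_piMr.
have H2 := ler_wpM2l sr0 H23; have H3 := mulr_ge0 sr0 M30; have H4 := mulr_ge0 M20 w0.
have y0 : 0 <= y := le_trans ler01 y1.
have -> : y * (2 * y * M2 * w + 4 * y * sr * M3) = y * (y * (2 * (M2 * w) + 4 * (sr * M3))).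
  by ring.
rewrite (mulrC 2) -mulrA; apply: ler_wpM2l => //.
apply: (@le_trans _ _ (2 * (M2 * w) + 4 * (sr * M3))); first by lra.
by rewrite ler_peMl //; lra.
Qed.

Lemma itg_stein_operator : (1 <= m)%N ->
  itg P (fun t => phi 1%N (W t) - W t * phi 0%N (W t)).
Proof.
move=> m1; apply: itgB; first exact: itg_phi1_W.
by apply: itg_phi0_W; [exact: measurable_W|exact: itg_W].
Qed.

Lemma stein_operator_bound (c : R) : (1 <= m)%N -> 0 <= c -> b = c * stein_coef r ->
  `|Ex P (fun t => phi 1%N (W t) - W t * phi 0%N (W t))| <=
  s ^+ m.+2 / m.+1`!%:R * m.+2%:R * \sum_i (a * M i m.+2%:R +
    c * (2 `^ r * (2 `^ (r + 1) * M i m.+2%:R * Ex P (fun t => `|W t| `^ r) +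
      2 `^ (r + 2) * s `^ r * M i (r + m.+3%:R)))).
Proof.
move=> m1 c0 bE; rewrite stein_expansion // mulr_sumr.
apply: le_trans (ler_norm_sum _ _ _) _; apply: ler_sum => i _.
have [cr cr0 [H1 H2]] := partial_sum_moment_le i m1.
apply: le_trans (Ex_stein_rem_le i m1 cr0 H1) _; rewrite -[leRHS]mulrA.
apply: ler_wpM2l; first by rewrite divr_ge0 // exprn_ge0 // ltW.
apply: ler_wpM2l => //; rewrite lerD2l bE -(mulrA c) -mulrA.
exact: ler_wpM2l.
Qed.

End SteinExpansion.

(** * Normal approximation *)

Section StandardNormal.
Context d (T : measurableType d) (R : realType) (Q : probability T R) (Z : {RV Q >-> R}).
Hypothesis hZ : standard_normal Z.

Lemma standard_normal_itg (f : R -> R) : itg gamma f ->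
  itg Q (f \o Z) /\ Ex Q (f \o Z) = Ex gamma f.
Proof.
move=> fi; have mf := itg_measurable fi.
(* [Z] is retyped so that its law lives on the carrier of [gamma]. *)
have mZ : @measurable_fun _ _ T (measurableTypeR R) [set: T] Z.
  have mZ : measurable_fun [set: T] Z by exact: measurable_funP.
  by move=> mT Y mY; exact: mZ mT Y mY.
pose Z' : {RV Q >-> measurableTypeR R} :=
  @mfun_Sub _ _ T (measurableTypeR R) Z (mem_set mZ).
have gE (F : measurableTypeR R -> \bar R) :
    (\int[distribution Q Z']_x F x = \int[gamma]_x F x)%E.
  by apply: eq_measure_integral => A mA _; exact: hZ.
have iZ : itg Q (f \o Z).
  have mF : measurable_fun [set: measurableTypeR R] (fun x => `|f x|%:E).
    by apply/measurable_EFinP; exact: measurableT_comp.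
  have F0 (x : measurableTypeR R) : (0 <= `|f x|%:E)%E by rewrite lee_fin.
  apply/integrableP; split; first by apply/measurable_EFinP; exact: (measurableT_comp mf mZ).
  have <- := ge0_integral_distribution Z' mF F0; rewrite gE.
  by have /integrableP[_] := fi.
split => //; rewrite /Ex /Rintegral; congr fine.
rewrite -gE integral_distribution //; exact/measurable_EFinP.
Qed.

End StandardNormal.

Section NormalApproximation.
Context d (T : measurableType d) (R : realType) (P : probability T R).
Variables (n : nat) (X : 'I_n -> {RV P >-> R}) (m : nat) (A B r s : R) (g h : R -> R).
Hypotheses (indX : mutually_independent X) (m1 : (1 <= m)%N).
Hypotheses (A0 : 0 <= A) (B0 : 0 <= B) (r0 : 0 <= r) (s0 : 0 < s) (sn : s ^+ 2 * n%:R = 1).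
Hypothesis momX : forall i k, (k <= m.+1)%N ->
  Ex P (fun t => X i t ^+ k) = Ex gamma (fun x : R => x ^+ k).
Hypothesis finX : forall i, itg P (fun t => `|X i t| `^ (r + m.+3%:R)).
Hypothesis gC : class_CP m (fun w => A + B * `|w| `^ r) g.
Hypothesis hC : class_Cb m h.

Let L k : R := fine (derivative_norm k h).
Let H : R := \sum_(1 <= k < m.+1) (stirling2 m k)%:R * L k.
Let W t := s * \sum_j X j t.
Let M i c : R := Ex P (fun t => `|X i t| `^ c).
Let e1 : R := Ex gamma (fun z : R => `|z| `^ (r + 1)).

Lemma derivative_norm_fine k : (0 < k <= m)%N -> 0 <= L k /\ derivative_norm k h = (L k)%:E.
Proof. by move=> km; have [l [E l0 _]] := derivative_norm_lipschitz hC km; rewrite /L E. Qed.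

Lemma stirling_sum_ge0 : 0 <= H.
Proof.
rewrite /H big_nat_cond; apply: sumr_ge0 => k /andP[km _].
by rewrite mulr_ge0 //; have [] := derivative_norm_fine km.
Qed.

Lemma der_g k : (k < m)%N -> forall x : R, is_derive x 1 g^`(k)%classic (g^`(k.+1)%classic x).
Proof. by have [dg _] := gC => km x; split; [exact: dg km x|rewrite -derive1E]. Qed.

Lemma h_lipschitz : 0 <= L 1%N /\ forall x y, `|h x - h y| <= L 1%N * `|x - y|.
Proof.
have [|l [E l0 hl]] := derivative_norm_lipschitz hC (_ : (0 < 1 <= m)%N); first by rewrite m1.
by rewrite /L E; split.
Qed.

Lemma continuous_hg : continuous (h \o g).
Proof.
have [L0 hL] := h_lipschitz; have cg := der_continuous (der_g m1).
move=> x; apply: continuous_comp; first exact: cg.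
exact: (lipschitz_continuous L0 hL).
Qed.

Let K : R := s ^+ m.+2 / m.+1`!%:R * m.+2%:R * (H *
  \sum_i ((2 * A + B * (2 `^ (r + 2) * e1)) * M i m.+2%:R +
    B * (2 `^ r * (2 `^ (r + 1) * M i m.+2%:R * Ex P (fun t => `|W t| `^ r) +
      2 `^ (r + 2) * s `^ r * M i (r + m.+3%:R))))).

Lemma normal_approximation_smooth (u : nat -> R -> R) :
  (forall k, (k < m)%N -> forall x : R, is_derive x 1 (u k) (u k.+1 x)) ->
  (forall x, `|u m x| <= H * (A + B * `|x| `^ r)) ->
  itg P (fun t => u 0%N (W t)) /\ itg gamma (u 0%N) /\
  `|Ex P (fun t => u 0%N (W t)) - Ex gamma (u 0%N)| <= K.
Proof.
move=> du uH; have H0 := stirling_sum_ge0.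
have um x : `|u m x| <= H * A + H * B * `|x| `^ r.
  by apply: le_trans (uH x) _; rewrite mulrDr mulrA.
have HA : 0 <= H * A by exact: mulr_ge0.
have HB : 0 <= H * B by exact: mulr_ge0.
have e0 : 0 <= e1 by apply: Ex_ge0 => t; exact: powR_ge0.
pose a := 2 * (H * A) + H * B * (2 `^ (r + 2) * e1).
pose b := H * B * stein_coef r.
have a0 : 0 <= a by rewrite addr_ge0 // !mulr_ge0 ?powR_ge0.
have b0 : 0 <= b by rewrite mulr_ge0 // stein_coef_ge0.
have iu : itg gamma (u 0%N).
  apply: itg_gamma; last exact: (subgaussian_u m1 du r0 um (leq0n m)).
  exact: continuous_measurable (continuous_u0 m1 du).
have bphi x : `|stein_deriv u m.+1 x| <= a + b * `|x| `^ r.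
  apply: le_trans (stein_deriv_bound m1 du HA HB r0 um x) _.
  by rewrite /a /b /e1 le_eqVlt; apply/orP; left; apply/eqP; ring.
have dS := fun k km => @der_stein_deriv _ _ _ _ _ _ m1 du r0 um k km.
have gS := fun k km => @growth_stein_deriv _ _ _ _ _ _ m1 du HA HB r0 um k km.
have iS := itg_stein_operator s r0 dS gS finX m1.
have BS := stein_operator_bound indX r0 s0 sn a0 b0 dS gS bphi momX finX m1 HB (erefl b).
have opE t : stein_deriv u 1 (W t) - W t * stein_deriv u 0 (W t) =
    u 0%N (W t) - Ex gamma (u 0%N) by rewrite /=; ring.
have iW : itg P (fun t => u 0%N (W t)).
  have -> : (fun t => u 0%N (W t)) = fun t =>
    (stein_deriv u 1 (W t) - W t * stein_deriv u 0 (W t)) + Ex gamma (u 0%N).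
    by apply/funext => t; rewrite opE subrK.
  by apply: itgD iS _; exact: itg_cst.
split => //; split => //.
have -> : Ex P (fun t => u 0%N (W t)) - Ex gamma (u 0%N) =
    Ex P (fun t => stein_deriv u 1 (W t) - W t * stein_deriv u 0 (W t)).
  under [in RHS]eq_fun => t do rewrite opE.
  by rewrite ExB ?Ex_cst //; exact: itg_cst.
apply: le_trans BS _; rewrite le_eqVlt; apply/orP; left; apply/eqP.
rewrite /K; congr (_ * _); rewrite mulr_sumr; apply: eq_bigr => i _.
by rewrite /a -/(M i _) -/(M i _) -/(W _); ring.
Qed.

(** The bound [K] is the same for all Steklov means, and replacing h by such a mean changes both
    expectations by at most L 1 times e; then e tends to 0. Although h may be unbounded, its
    distance to the mean is bounded, which also yields integrability. *)
Lemma normal_approximation : itg P (fun t => h (g (W t))) /\ itg gamma (h \o g) /\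
  `|Ex P (fun t => h (g (W t))) - Ex gamma (h \o g)| <= K.
Proof.
have [L0 hL] := h_lipschitz.
have mhg := continuous_measurable continuous_hg.
have approx e : 0 < e -> itg P (fun t => h (g (W t))) /\ itg gamma (h \o g) /\
    `|Ex P (fun t => h (g (W t))) - Ex gamma (h \o g)| <= K + 2 * (L 1%N * e).
  move=> e0; have [he [dhe bhe hhe]] := smoothing m1 hC e0.
  pose G k := g^`(k)%classic; pose u := faa_deriv he G.
  have du k (km : (k < m)%N) (x : R) : is_derive x 1 (u k) (u k.+1 x).
    exact: (der_faa_deriv x km der_g dhe).
  have um x : `|u m x| <= H * (A + B * `|x| `^ r).
    apply: faa_deriv_bound => // k km; have [_] := gC; exact.
  have [iuW [iu Hu]] := normal_approximation_smooth du um.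
  have u0E x : u 0%N x = he 0%N (g x).
    by rewrite /u /faa_deriv big_seq1 /faa_term big_nil mulr1.
  have close x : `|h (g x) - u 0%N x| <= L 1%N * e.
    by rewrite u0E distrC.
  have mW := measurable_W s r0 finX.
  have mu0 := itg_measurable iu.
  have idW : itg P (fun t => h (g (W t)) - u 0%N (W t)).
    apply: itg_le (itg_cst P (L 1%N * e)) => [|t].
      apply: measurable_funB; first exact: (measurableT_comp mhg mW).
      exact: (measurableT_comp mu0 mW).
    by apply: le_trans (close _) (ler_norm _).
  have idg : itg gamma (fun x => h (g x) - u 0%N x).
    apply: itg_le (itg_cst gamma (L 1%N * e)) => [|t]; first exact: measurable_funB.
    by apply: le_trans (close _) (ler_norm _).
  have iW : itg P (fun t => h (g (W t))).
    have -> : (fun t => h (g (W t))) = fun t => (h (g (W t)) - u 0%N (W t)) + u 0%N (W t).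
      by apply/funext => t; rewrite subrK.
    exact: itgD.
  have ig : itg gamma (h \o g).
    have -> : h \o g = fun t => (h (g t) - u 0%N t) + u 0%N t.
      by apply/funext => t; rewrite subrK.
    exact: itgD.
  split => //; split => //.
  have B1 : `|Ex P (fun t => h (g (W t))) - Ex P (fun t => u 0%N (W t))| <= L 1%N * e.
    rewrite -ExB //; apply: le_trans (Ex_norm idW) _; rewrite -[leRHS](Ex_cst P).
    by apply: Ex_le => //; [exact: itg_norm|exact: itg_cst].
  have B2 : `|Ex gamma (h \o g) - Ex gamma (u 0%N)| <= L 1%N * e.
    rewrite -ExB //; apply: le_trans (Ex_norm idg) _; rewrite -[leRHS](Ex_cst gamma).
    by apply: Ex_le => //; [exact: itg_norm|exact: itg_cst].
  move: B1 B2 Hu; rewrite !ler_norml => /andP[? ?] /andP[? ?] /andP[? ?].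
  by apply/andP; split; lra.
have [iW [ig _]] := approx 1 ltr01.
split => //; split => //; apply/ler_addgt0Pr => e e0.
(* The added 1 guards against L 1 = 0. *)
have L1 : 0 < 2 * L 1%N + 1 by lra.
have [_ [_ He]] := approx (e / (2 * L 1%N + 1)) (divr_gt0 e0 L1).
apply: le_trans He _; rewrite lerD2l.
have -> : 2 * (L 1%N * (e / (2 * L 1%N + 1))) = 2 * L 1%N / (2 * L 1%N + 1) * e.
  by field; rewrite gt_eqF.
by rewrite ler_piMl ?(ltW e0) // ler_pdivrMr //; lra.
Qed.

End NormalApproximation.

Lemma expectation_itg d (T : measurableType d) (R : realType) (P : probability T R)
  (f : T -> R) : itg P f -> 'E_P[f]%E = (Ex P f)%:E.
Proof. by move=> fi; rewrite unlock Ex_EFin. Qed.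

Lemma itg_expectation_fin d (T : measurableType d) (R : realType) (P : probability T R)
  (f : T -> R) : measurable_fun [set: T] f -> (forall t, 0 <= f t) ->
  ('E_P[f] < +oo)%E -> itg P f.
Proof.
move=> mf f0; rewrite unlock => fy; apply/integrableP; split; first exact/measurable_EFinP.
under eq_integral => t _ do rewrite /= ger0_norm //.
exact: fy.
Qed.

Lemma inv_sqrt_powR (R : realType) (x c : R) : 0 <= x ->
  (Num.sqrt x)^-1 `^ c = (x `^ (c / 2))^-1.
Proof.
move=> x0; rewrite -powR12_sqrt // -(powRN x 2^-1) -powRrM -powRN.
by congr powR; ring.
Qed.

Theorem theorem3p3 (R : realType) (p n : nat) (hp : (2 <= p)%N) (hn : (1 <= n)%N)
    (A B r : R) (hA : 0 <= A) (hB : 0 <= B) (hr : 0 <= r)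
    (g : R -> R) (hg : class_CP p.-1 (fun w => A + B * `|w| `^ r) g)
    (d : measure_display) (T : measurableType d) (Pr : probability T R)
    (X : 'I_n -> {RV Pr >-> R}) (indX : mutually_independent X)
    (d' : measure_display) (T' : measurableType d') (Q : probability T' R)
    (Z : {RV Q >-> R}) (hZ : standard_normal Z)
    (hmom : forall (i : 'I_n) (k : nat), (1 <= k <= p)%N ->
       ('E_Pr[fun t => (X i t ^+ k)%R] = 'E_Q[fun t => (Z t ^+ k)%R])%E)
    (hfin : forall i : 'I_n,
       ('E_Pr[fun t => (`|X i t| `^ (r + p%:R + 2))%R] < +oo)%E)
    (h : R -> R) (hh : class_Cb p.-1 h) :
  let W := normalized_sum X in
  (`| 'E_Pr[fun t => h (g (W t))] - 'E_Q[fun t => h (g (Z t))] |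
   <= ((p%:R + 1) / (p`!%:R * n%:R `^ ((p%:R + 1) / 2)))%:E
      * stirling_norm p.-1 h
      * \sum_(i < n)
          ((3 * A)%:E * 'E_Pr[fun t => (`|X i t| ^+ p.+1)%R]
           + (2 `^ r * B)%:E
             * ((2 `^ (r + 1))%:E * 'E_Pr[fun t => (`|X i t| ^+ p.+1)%R]
                  * ('E_Pr[fun t => (`|W t| `^ (r + 1))%R]
                     + 'E_Pr[fun t => (`|W t| `^ r)%R])
                + 4%:E * 'E_Q[fun t => (`|Z t| `^ (r + 1))%R]
                  * 'E_Pr[fun t => (`|X i t| ^+ p.+2)%R]
                + (2 `^ (r + 2) / n%:R `^ (r / 2))%:E
                  * 'E_Pr[fun t => (`|X i t| `^ (r + p%:R + 2))%R])))%E.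
Proof.
case: p hp hmom hfin hg hh => [|[|m']] // _; set m := m'.+1 => hmom hfin hg hh; cbv zeta.
set W := normalized_sum X.
have m1 : (1 <= m)%N by [].
change (class_Cb m h) in hh; change (class_CP m (fun w => A + B * `|w| `^ r) g) in hg.
change (m'.+2.-1) with m.
have mp : m.+1%:R + 2 = m.+3%:R :> R by rewrite -!natr1; ring.
have n0 : 0 < n%:R :> R by rewrite ltr0n.
pose s : R := (Num.sqrt n%:R)^-1.
have s0 : 0 < s by rewrite invr_gt0 sqrtr_gt0.
have sn : s ^+ 2 * n%:R = 1.
  by rewrite /s exprVn sqr_sqrtr ?(ltW n0) // mulVf // gt_eqF.
have finX i : itg Pr (fun t => `|X i t| `^ (r + m.+3%:R)).
  apply: itg_expectation_fin => [|t|]; last by have := hfin i; rewrite -addrA mp.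
    apply: (measurableT_comp (measurable_norm_powR _)); exact: measurable_summand.
  exact: powR_ge0.
have rangeN k : (k <= m.+3)%N -> 0 <= (k%:R : R) <= r + m.+3%:R.
  by move=> km; rewrite ler0n /= -[leLHS]add0r lerD // ler_nat.
pose M i c : R := Ex Pr (fun t => `|X i t| `^ c).
have iXn i k : (k <= m.+3)%N -> itg Pr (fun t => X i t ^+ k).
  move=> km; apply: itg_le (itg_summand finX i (rangeN k km)) => [|t].
    exact: measurable_funX (measurable_summand X i).
  by rewrite powR_mulrn // !normrX normr_id.
have momX i k : (k <= m.+1)%N -> Ex Pr (fun t => X i t ^+ k) = Ex gamma (fun x : R => x ^+ k).
  case: k => [|k] km; first by rewrite !Ex_cst.
  have [iZ EZ] := standard_normal_itg hZ (itg_gamma_expn R k.+1).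
  have := hmom i k.+1 km; rewrite expectation_itg; last first.
    by apply: iXn; apply: leq_trans km _; do 2! apply: leqW.
  by rewrite (expectation_itg iZ) EZ => -[].
have [iW [ig main]] := normal_approximation indX m1 hA hB hr s0 sn momX finX hg hh.
have [iZ EZ] := standard_normal_itg hZ ig.
rewrite (expectation_itg iW) (expectation_itg iZ) EZ.
have HE : stirling_norm m h = (\sum_(1 <= k < m.+1) (stirling2 m k)%:R *
    fine (derivative_norm k h))%:E.
  rewrite /stirling_norm -sumEFin !big_nat; apply: eq_bigr => k km.
  by have [_ ->] := derivative_norm_fine hh km.
rewrite HE.
have XE k i : (k <= m.+3)%N -> 'E_Pr[fun t => (`|X i t| ^+ k)%R]%E = (M i k%:R)%:E.
  move=> km; rewrite expectation_itg; last first.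
    by under eq_fun => t do rewrite -normrX; exact: itg_norm (iXn i k km).
  by congr (_%:E); congr Ex; apply/funext => t; rewrite powR_mulrn.
have r1 : 0 <= r + 1 <= r + m.+3%:R.
  by rewrite addr_ge0 //= lerD2l ler1n.
have rr : 0 <= r <= r + m.+3%:R by rewrite hr /= lerDl.
have WE c : 0 <= c <= r + m.+3%:R -> 'E_Pr[fun t => (`|W t| `^ c)%R]%E =
    (Ex Pr (fun t => `|W t| `^ c))%:E.
  by move=> cr; rewrite expectation_itg //; exact: (itg_W s finX cr).
have r10 : 0 <= r + 1 by case/andP: r1.
have [iZr EZr] := standard_normal_itg hZ (itg_gamma_powR r10).
have ZE : 'E_Q[fun t => (`|Z t| `^ (r + 1))%R]%E = (Ex gamma (fun z : R => `|z| `^ (r + 1)))%:E.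
  by rewrite (expectation_itg iZr) EZr.
have XrE i : 'E_Pr[fun t => (`|X i t| `^ (r + m.+1%:R + 2))%R]%E = (M i (r + m.+3%:R))%:E.
  by rewrite -addrA mp (expectation_itg (finX i)).
rewrite !WE // ZE.
have H0 := stirling_sum_ge0 hh.
set H := (\sum_(1 <= k < m.+1) _) in main HE H0 *; clearbody H.
set e1 := Ex gamma (fun z : R => `|z| `^ (r + 1)) in ZE main *.
have e0 : 0 <= e1 by apply: Ex_ge0 => t; exact: powR_ge0.
pose W1 := Ex Pr (fun t => `|W t| `^ (r + 1)).
pose W0 := Ex Pr (fun t => `|W t| `^ r).
have W10 : 0 <= W1 by apply: Ex_ge0 => t; exact: powR_ge0.
have W00 : 0 <= W0 by apply: Ex_ge0 => t; exact: powR_ge0.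
rewrite -[Ex Pr (fun t => `|s * \sum_j X j t| `^ r)]/W0 in main.
rewrite -/W1 -/W0.
under eq_bigr => i _ do
  rewrite !XE // XrE -!(EFinM, EFinD).
rewrite sumEFin -EFinB abse_EFin -!EFinM lee_fin.
apply: le_trans main _.
have sE c : s `^ c = (n%:R `^ (c / 2))^-1 by rewrite inv_sqrt_powR // ltW.
rewrite natr1 invfM -!sE powR_mulrn ?(ltW s0) //.
have -> : m.+2%:R * ((m.+1)`!%:R^-1 * s ^+ m.+2) * H = s ^+ m.+2 / (m.+1)`!%:R * m.+2%:R * H.
  by ring.
rewrite mulrA; apply: ler_wpM2l.
  apply: mulr_ge0 => //; apply: mulr_ge0 => //; apply: divr_ge0 => //.
  by apply: exprn_ge0; exact: ltW.
apply: ler_sum => i _; rewrite -!/(M i _).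
have M0 c : 0 <= M i c by apply: Ex_ge0 => t; exact: powR_ge0.
have M23 : M i m.+2%:R <= M i m.+3%:R.
  apply: (summand_moment_le momX finX i m1); first by rewrite ler0n ler_nat leqnSn.
    by rewrite ler_nat.
  by rewrite lerDr.
have p0 : 0 <= 2 `^ r :> R by exact: powR_ge0.
have p20 : 0 <= 2 `^ (r + 1) :> R by exact: powR_ge0.
have e2 : 2 `^ (r + 2) = 4 * 2 `^ r :> R.
  by rewrite powRD ?pnatr_eq0 ?implybT // powR_mulrn // mulrC; congr (_ * _); ring.
rewrite {1}e2 -subr_ge0.
set M2 := M i m.+2%:R in M23 *; set M3 := M i m.+3%:R in M23 *.
set RHS := (X in 0 <= X).
(* What the stated bound has to spare: 3 A against 2 A, the term with E|W|^(r + 1), and E|X_i|^(p +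
   2) in place of E|X_i|^(p + 1) beside E|Z|^(r + 1). *)
have -> : RHS = A * M2 + 2 `^ r * B * (2 `^ (r + 1) * M2 * W1) +
    4 * (2 `^ r * B * e1 * (M3 - M2)) by rewrite /RHS; ring.
have M20 : 0 <= M2 by exact: M0.
apply: addr_ge0; last by rewrite !mulr_ge0 // subr_ge0.
by apply: addr_ge0; [exact: mulr_ge0|do !apply: mulr_ge0].
Qed.
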